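(* For a prime $p$ and $a\in\mathbb{F}_p$, let $\mathcal{C}_a$ be the curve over $\mathbb{F}_p$ with affine equation $$\mathcal{C}_a:\ Y^2=X^{12}-aX^{10}-33X^8+2aX^6-33X^4-aX^2+1 .$$ Then $\mathcal{C}_a$ is $\mathbb{F}_{p^2}$-maximal for each pair $(p,a)$ in the following four tables (where the integer $a$ is read modulo $p$). Table 1: (11,0), (131,75), (251,221), (491,254), (599,24), (1439,984), (3371,933), (5639,4445), (5879,1294), (6971,2129), (7079,6366), (8039,4751), (8291,5367), (9839,7465), (10799,1835), (11171,5951), (12119,4310), (14879,2439), (16931,14808), (17159,4688), (18839,17890), (23039,5286), (23159,16126), (25919,24335), (50291,5355), (53411,49474), (53639,10108), (59051,25275), (69371,51864), (74771,11482), (74891,48023), (75239,47655), (81119,7710), (81359,48587). Table 2: (11,0), (23,0), (71,45), (263,185), (1031,881), (1283,1276), (1583,207), (2039,1586), (2087,752), (2543,565), (2843,2158), (7823,2710), (9851,6895), (10859,7298), (12107,1665), (15647,4803), (18719,9865), (23459,17387), (25463,14115), (26723,22923), (27791,27198), (29759,25238), (31511,30573), (32579,25335), (33791,31173), (34283,3491), (35099,20799), (37619,25640), (54959,54405), (56519,47622), (61007,47142), (61559,42225), (67043,32831), (71339,1126), (71843,10626), (89783,68842), (95027,9806). Table 3: (11,0), (131,56), (251,221), (491,237), (599,575), (1439,455), (3371,2438), (5639,1194), (5879,1294), (6971,2129), (7079,713), (8039,3288), (8291,2924), (9839,7465), (10799,1835), (11171,5951), (12119,4310), (14879,12440), (16931,2123),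 (17159,12471), (18839,17890), (23039,5286), (23159,7033), (25919,24335), (50291,5355), (53411,3937), (53639,10108), (59051,33776), (69371,51864), (74771,63289), (74891,48023), (75239,27584), (81119,7710), (81359,48587). Table 4: (11,0), (131,56), (251,30), (491,237), (599,24), (1439,455), (3371,933), (5639,4445), (5879,4585), (6971,4842), (7079,6366), (8039,3288), (8291,2924), (9839,2374), (10799,1835), (11171,5220), (12119,4310), (14879,2439), (16931,14808), (17159,12471), (18839,17890), (23039,5286), (23159,16126), (25919,1584), (50291,5355), (53411,3937), (53639,10108), (59051,33776), (69371,17507), (74771,11482), (74891,48023), (75239,27584), (81119,73409), (81359,32772).
   Context: A curve given by an affine plane equation means the projective, non-singular, geometrically irreducible algebraic curve with the corresponding function field. A curve $\mathcal{X}$ of genus $g$ defined over $\mathbb{F}_{p^2}$ is $\mathbb{F}_{p^2}$-maximal if $|\mathcal{X}(\mathbb{F}_{p^2})|=p^2+1+2gp$. *)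

(* Defs.v *)
From Stdlib Require Import BinNat.
From mathcomp Require Import all_boot all_order all_algebra.
From mathcomp Require Import boolp classical_sets functions cardinality.

Set Implicit Arguments.
Unset Strict Implicit.
Unset Printing Implicit Defensive.

Import GRing.Theory.
Local Open Scope classical_set_scope.
Local Open Scope ring_scope.

(* Affine plane curves are given by bivariate polynomials G : {poly {poly k}},
   with the conventions of polyXY: the outer variable is 'X, the inner one is
   'Y = 'X%:P, and G.[x, y] evaluates 'X at x and 'Y at y. *)

Definition map_poly2 (k L : fieldType) (j : {rmorphism k -> L})
    (G : {poly {poly k}}) : {poly {poly L}} :=
  map_poly (map_poly j) G.

(* Irreducibility is taken in the ring L[X, Y] itself; irreducible_poly would
   ignore factors that lie in L[Y]. *)
Definition geometrically_irreducible (k : fieldType)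
    (G : {poly {poly k}}) : Prop :=
  forall (L : fieldType) (j : {rmorphism k -> L}),
    [/\ map_poly2 j G != 0,
        map_poly2 j G \isn't a GRing.unit
      & forall A B : {poly {poly L}}, map_poly2 j G = A * B ->
          A \is a GRing.unit \/ B \is a GRing.unit].

Section FunctionField.

Variables (k K : fieldType) (iota : {rmorphism k -> K}).

(* K is the fraction field of k[X, Y] / (G), with x and y the classes of X
   and Y. *)
Definition is_function_field (G : {poly {poly k}}) (x y : K) : Prop :=
  (forall H : {poly {poly k}},
      (map_poly2 iota H).[x, y] = 0 <-> exists Q, H = Q * G)
  /\ (forall z : K, exists A B : {poly {poly k}},
        (map_poly2 iota B).[x, y] != 0
        /\ z = (map_poly2 iota A).[x, y] / (map_poly2 iota B).[x, y]).

(* The closed points of the projective non-singular curve with function field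
   K correspond to the places of K / k, i.e. to the valuation rings O of K
   with k <= O < K; O is the local ring at the point. *)
Definition is_place (O : set K) : Prop :=
  [/\ forall c : k, O (iota c),
      forall u v : K, O u -> O v -> O (u - v),
      forall u v : K, O u -> O v -> O (u * v),
      forall u : K, O u \/ O u^-1
    & O <> setT].

Definition maximal_ideal (O : set K) : set K :=
  [set u | O u /\ (u != 0 -> ~ O u^-1)].

(* The k-rational points are the places of degree one, i.e. those whose
   residue field is k. *)
Definition rational_places : set (set K) :=
  [set O | is_place O /\
           forall u : K, O u -> exists c : k, maximal_ideal O (u - iota c)].

Record derivation : Type := Derivation {
  derivation_fun :> K -> K;
  derivationD : forall u v : K,
    derivation_fun (u + v) = derivation_fun u + derivation_fun v;
  derivationM : forall u v : K,
    derivation_fun (u * v) = u * derivation_fun v + v * derivation_fun u;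
  derivationC : forall c : k, derivation_fun (iota c) = 0
}.

(* The space Omega of Kaehler differentials of K / k has finite dimension over
   K, hence embeds in the dual of Der_k(K, K): the differential u dv is
   represented by the map D |-> u * D v. *)
Definition differential : Type := derivation -> K.

(* om lies in the image of the Kaehler differentials of O over k: it is a
   finite sum of u dv with u and v in O. *)
Definition regular_at (O : set K) (om : differential) : Prop :=
  exists s : seq (K * K),
    (forall uv, uv \in s -> O uv.1 /\ O uv.2)
    /\ forall D : derivation, om D = \sum_(uv <- s) uv.1 * D uv.2.

Definition holomorphic (om : differential) : Prop :=
  (exists s : seq (K * K),
      forall D : derivation, om D = \sum_(uv <- s) uv.1 * D uv.2)
  /\ forall O : set K, is_place O -> regular_at O om.

(* The genus is the dimension over k of the space of holomorphic
   differentials; w is a basis of that space. *)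
Definition has_genus (g : nat) : Prop :=
  exists w : 'I_g -> differential,
    (forall i, holomorphic (w i))
    /\ forall om : differential, holomorphic om ->
         exists! c : 'rV[k]_g,
           forall D : derivation, om D = \sum_i iota (c 0 i) * w i D.

End FunctionField.

(* The curve G = 0 over F_p is F_{p^2}-maximal. F with the embedding j is a
   field with p^2 elements over F_p, and K / F is the function field of the
   curve over F; both exist and are unique up to isomorphism when p is prime
   and G is geometrically irreducible. *)
Definition Fp2_maximal (p : nat) (G : {poly {poly 'F_p}}) : Prop :=
  geometrically_irreducible G
  /\ forall (F : finFieldType) (j : {rmorphism 'F_p -> F}),
       #|F| = (p ^ 2)%N ->
     forall (K : fieldType) (iota : {rmorphism F -> K}) (x y : K),
       is_function_field iota (map_poly2 j G) x y ->
     exists g : nat, has_genus iota g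
       /\ (rational_places iota #= `I_(p ^ 2 + 1 + 2 * g * p)%N)%card.

Definition C_ (k : fieldType) (a : k) : {poly {poly k}} :=
  'Y ^+ 2 - ('X ^+ 12 - a%:P%:P * 'X ^+ 10 - 33%:R * 'X ^+ 8
             + 2%:R * a%:P%:P * 'X ^+ 6 - 33%:R * 'X ^+ 4
             - a%:P%:P * 'X ^+ 2 + 1).

(* The entries are binary naturals, to keep them compact. *)

Definition table1 : seq (N * N) := ([::
    (11,0); (131,75); (251,221); (491,254); (599,24); (1439,984); (3371,933);
    (5639,4445); (5879,1294); (6971,2129); (7079,6366); (8039,4751);
    (8291,5367); (9839,7465); (10799,1835); (11171,5951); (12119,4310);
    (14879,2439); (16931,14808); (17159,4688); (18839,17890); (23039,5286);
    (23159,16126); (25919,24335); (50291,5355); (53411,49474); (53639,10108);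
    (59051,25275); (69371,51864); (74771,11482); (74891,48023); (75239,47655);
    (81119,7710); (81359,48587)
])%num.

Definition table2 : seq (N * N) := ([::
    (11,0); (23,0); (71,45); (263,185); (1031,881); (1283,1276); (1583,207);
    (2039,1586); (2087,752); (2543,565); (2843,2158); (7823,2710);
    (9851,6895); (10859,7298); (12107,1665); (15647,4803); (18719,9865);
    (23459,17387); (25463,14115); (26723,22923); (27791,27198); (29759,25238);
    (31511,30573); (32579,25335); (33791,31173); (34283,3491); (35099,20799);
    (37619,25640); (54959,54405); (56519,47622); (61007,47142); (61559,42225);
    (67043,32831); (71339,1126); (71843,10626); (89783,68842); (95027,9806)
])%num.

Definition table3 : seq (N * N) := ([::
    (11,0); (131,56); (251,221); (491,237); (599,575); (1439,455);
    (3371,2438); (5639,1194); (5879,1294); (6971,2129); (7079,713);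
    (8039,3288); (8291,2924); (9839,7465); (10799,1835); (11171,5951);
    (12119,4310); (14879,12440); (16931,2123); (17159,12471); (18839,17890);
    (23039,5286); (23159,7033); (25919,24335); (50291,5355); (53411,3937);
    (53639,10108); (59051,33776); (69371,51864); (74771,63289); (74891,48023);
    (75239,27584); (81119,7710); (81359,48587)
])%num.

Definition table4 : seq (N * N) := ([::
    (11,0); (131,56); (251,30); (491,237); (599,24); (1439,455); (3371,933);
    (5639,4445); (5879,4585); (6971,4842); (7079,6366); (8039,3288);
    (8291,2924); (9839,2374); (10799,1835); (11171,5220); (12119,4310);
    (14879,2439); (16931,14808); (17159,12471); (18839,17890); (23039,5286);
    (23159,16126); (25919,1584); (50291,5355); (53411,3937); (53639,10108);
    (59051,33776); (69371,17507); (74771,11482); (74891,48023); (75239,27584);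
    (81119,73409); (81359,32772)
])%num.

(* Main.v *)
Require Import Defs.
From Stdlib Require Import BinNat.
From HB Require Import structures.
From mathcomp Require Import all_boot all_order all_algebra finfield.
From mathcomp Require Import boolp classical_sets functions cardinality.
From mathcomp Require Import ring zify.

Set Implicit Arguments.
Unset Strict Implicit.
Unset Printing Implicit Defensive.

Import Order.TTheory GRing.Theory Num.Theory.
Local Open Scope ring_scope.

(** C_a is the curve y^2 = f(x) with f(x) = x^6 G(x^2 + x^-2) and
    G(s) = s^3 - a s^2 - 36 s + 4 a. The proof has three parts.

    Geometry. The polynomial f is squarefree, because a^2 + 108 does not vanish
    modulo p (curve_poly_bezout); hence the equation is absolutely irreducible and
    the affine curve is smooth: its coordinate ring R = k[x] + k[x] y is regular at
    every prime (uniformiser). So the places of the function field at which x is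
    finite are the localisations of R, and the automorphism
    (x, y) -> (1 / x, y / x^6), which exists because f is reciprocal, carries the
    remaining places to places of this kind. A differential om is h dx / y, where h
    is its value on the derivation y d/dx. That derivation preserves the
    localisations of R, so that om can be regular only if h is in R; comparing the
    two charts, h is a polynomial in x of degree at most 4. Conversely the
    differentials x^i dx / y with i < 5 are regular, because dx / y = A y dx + 2 B dy
    when A f + B f' = 1. The genus is therefore 5 (hyperelliptic_genus). The rational
    places are the rational points of the affine curve and two points at infinity
    (card_rational_places), so that it remains to show that the sum of chi(f(x)) over
    the field F with p^2 elements is 10 p - 1, with chi the quadratic character.

    Decomposition. The group x -> x, -x, 1 / x, -1 / x acts on the curve with
    quotient coordinate s = x^2 + x^-2, and elementary substitutions in character
    sums reduce the count to the curves v^2 = G(s), v^2 = (s + 2) G(s),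
    v^2 = (s - 2) G(s) and v^2 = (s^2 - 4) G(s) (sum_chi_curve). An automorphism of
    order 3 of C_a makes the first three equivalent. The last one has genus 2; an
    involution that exchanges its branch points 2, -2 and infinity with the roots of
    G splits it into two elliptic curves (sum_chi_sextic). Thus the Jacobian of C_a
    is isogenous to E^3 x E1 x E2, and each of these elliptic curves must contribute
    a character sum of 2 p, which is to say that it has (p + 1)^2 points over F.

    Supersingularity. Character sums of elliptic curves are invariant under
    2-isogenies, by a substitution in the sum (isogeny2), and all the curves E, E1
    and E2 in the tables are joined by chains of 2-isogenies over F to the curve
    y^2 = x^3 - x. For the latter the sum is 2 p because p is 3 modulo 4
    (sum_chi_1728). In Legendre form a 2-isogeny is a step of the
    arithmetic-geometric mean, l^2 (1 + k)^2 = 4 k, so that the chains are lists of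
    parameters k in F_p(i) that a computation verifies (certificates_valid). *)

(** * Hyperelliptic function fields and their coordinate rings *)

Section Evaluation.

Variables (k K : fieldType) (iota : {rmorphism k -> K}).

Definition ev (x : K) : {poly k} -> K :=
  horner_morph (fun c => mulrC x (iota c)).

HB.instance Definition _ x := GRing.RMorphism.on (ev x).

Lemma evE x P : ev x P = (map_poly iota P).[x].
Proof. by []. Qed.

Lemma evC x c : ev x c%:P = iota c.
Proof. exact: horner_morphC. Qed.

Lemma evX x : ev x 'X = x.
Proof. exact: horner_morphX. Qed.

(** K = k(x)(y) with y^2 = f(x), described without reference to a plane
    equation: for a reciprocal f the pair (1 / x, y / x^(g+1)) satisfies the same
    conditions, so that the lemmas on the affine curve also apply around the
    points at infinity. *)
Record hyperelliptic (f : {poly k}) (x y : K) : Prop := Hyperelliptic {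
  hyperelliptic_eq : y ^+ 2 = ev x f;
  hyperelliptic_free : forall P Q,
    ev x P + ev x Q * y = 0 -> P = 0 /\ Q = 0;
  hyperelliptic_frac : forall z, exists P Q D,
    D != 0 /\ z * ev x D = ev x P + ev x Q * y
}.

End Evaluation.

Section Localisation.

Variables (k K : fieldType) (iota : {rmorphism k -> K}).
Variables (f : {poly k}) (x y : K).
Hypothesis model : hyperelliptic iota f x y.

Local Notation e := (ev iota x).

Definition coord_ring : set K :=
  [set z | exists P Q, z = e P + e Q * y]%classic.

Let yy : y * y = e f.
Proof. by rewrite -expr2 (hyperelliptic_eq model). Qed.

Lemma ev_eq0 P : (e P == 0) = (P == 0).
Proof.
apply/eqP/eqP => [eP|->]; last by rewrite rmorph0.
by have [|-> _] := @hyperelliptic_free _ _ _ _ _ _ model P 0;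
  rewrite // rmorph0 mul0r addr0.
Qed.

Lemma hyperelliptic_neq0 : x != 0 /\ y != 0.
Proof.
split; first by rewrite -[x](evX iota) ev_eq0 polyX_eq0.
apply/eqP => y0; have [|_ /eqP] := @hyperelliptic_free _ _ _ _ _ _ model 0 1.
  by rewrite y0 mulr0 rmorph0 addr0.
by rewrite oner_eq0.
Qed.

Lemma coord_ring_ev P : coord_ring (e P).
Proof. by exists P, 0; rewrite rmorph0 mul0r addr0. Qed.

Lemma coord_ring_x : coord_ring x.
Proof. by rewrite -[x](evX iota); apply: coord_ring_ev. Qed.

Lemma coord_ring_y : coord_ring y.
Proof. by exists 0, 1; rewrite rmorph0 rmorph1 mul1r add0r. Qed.

Lemma coord_ring_const c : coord_ring (iota c).
Proof. by rewrite -(evC iota x); apply: coord_ring_ev. Qed.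

Lemma coord_ring1 : coord_ring 1.
Proof. by rewrite -(rmorph1 e); apply: coord_ring_ev. Qed.

Lemma coord_ring0 : coord_ring 0.
Proof. by rewrite -(rmorph0 e); apply: coord_ring_ev. Qed.

Lemma coord_ringB u v : coord_ring u -> coord_ring v -> coord_ring (u - v).
Proof.
move=> [P [Q ->]] [P' [Q' ->]]; exists (P - P'), (Q - Q').
by rewrite !rmorphB; ring.
Qed.

Lemma coord_ringD u v : coord_ring u -> coord_ring v -> coord_ring (u + v).
Proof.
move=> [P [Q ->]] [P' [Q' ->]]; exists (P + P'), (Q + Q').
by rewrite !rmorphD; ring.
Qed.

Lemma coord_ringM u v : coord_ring u -> coord_ring v -> coord_ring (u * v).
Proof.
move=> [P [Q ->]] [P' [Q' ->]]; exists (P * P' + Q * Q' * f), (P * Q' + Q * P').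
by rewrite !rmorphD !rmorphM /= -yy; ring.
Qed.

Lemma coord_ringX u n : coord_ring u -> coord_ring (u ^+ n).
Proof.
move=> Ru; elim: n => [|n IH]; first exact: coord_ring1.
by rewrite exprS; apply: coord_ringM.
Qed.

Lemma coord_ring_fraction z :
  exists u v, [/\ coord_ring u, coord_ring v, v != 0 & z = u / v].
Proof.
have [P [Q [D [nzD zD]]]] := hyperelliptic_frac model z.
exists (e P + e Q * y), (e D).
split; [by exists P, Q| exact: coord_ring_ev | by rewrite ev_eq0 |].
by rewrite -zD mulfK // ev_eq0.
Qed.

(** The cofactor is the conjugate P - Q y of u = P + Q y. *)
Lemma coord_ring_norm u : coord_ring u -> u != 0 ->
  exists v N, [/\ coord_ring v, N != 0 & u * v = e N].
Proof.
move=> [P [Q uE]] nzu.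
exists (e P - e Q * y), (P * P - Q * Q * f).
have uvE : u * (e P - e Q * y) = e (P * P - Q * Q * f).
  by rewrite uE !rmorphB /= !rmorphM /= -yy; ring.
split=> //.
- by exists P, (- Q); rewrite rmorphN mulNr.
- rewrite -ev_eq0 -uvE mulf_neq0 //; apply: contra_neq nzu => v0.
  have [|P0 Q0] := @hyperelliptic_free _ _ _ _ _ _ model P (- Q).
    by rewrite rmorphN mulNr.
  by rewrite uE P0 rmorph0 -[Q]opprK Q0 oppr0 rmorph0 mul0r addr0.
Qed.

(** The ideals are carried as subsets of K, like places, so that centers and
    localisations can be compared directly. The zero ideal is excluded because
    its localisation, the whole of K, is not a place. *)
Record prime_ideal (m : set K) : Prop := PrimeIdeal {
  prime_ideal_sub : forall u, m u -> coord_ring u;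
  prime_idealB : forall u v, m u -> m v -> m (u - v);
  prime_idealM : forall u v, coord_ring u -> m v -> m (u * v);
  prime_ideal1 : ~ m 1;
  prime_ideal_prime : forall u v, coord_ring u -> coord_ring v -> m (u * v) ->
    m u \/ m v;
  prime_ideal_neq0 : exists2 u, m u & u != 0
}.

Definition local_ring (m : set K) : set K :=
  [set z | exists u v, [/\ coord_ring u, coord_ring v, ~ m v & z = u / v]]%classic.

Section PrimeIdeal.

Variable m : set K.
Hypothesis pm : prime_ideal m.

Lemma prime_ideal0 : m 0.
Proof. by have [u mu _] := prime_ideal_neq0 pm; rewrite -(subrr u); apply: prime_idealB. Qed.

Lemma prime_idealN u : m u -> m (- u).
Proof. by move=> mu; rewrite -sub0r; apply: prime_idealB => //; apply: prime_ideal0. Qed.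

Lemma prime_idealD u v : m u -> m v -> m (u + v).
Proof. by move=> mu mv; rewrite -[v]opprK; apply: prime_idealB => //; apply: prime_idealN. Qed.

Lemma prime_idealMr u v : coord_ring u -> m v -> m (v * u).
Proof. by rewrite mulrC; apply: prime_idealM. Qed.

Lemma prime_ideal_compl u v : coord_ring u -> coord_ring v ->
  ~ m u -> ~ m v -> ~ m (u * v).
Proof. by move=> Ru Rv mu mv /(prime_ideal_prime pm Ru Rv)[]. Qed.

Lemma compl_prime_neq0 u : ~ m u -> u != 0.
Proof. by move=> mu; apply/eqP => u0; apply: mu; rewrite u0; apply: prime_ideal0. Qed.

Lemma prime_ideal_const c : m (iota c) -> c = 0.
Proof.
move=> mc; apply/eqP/negPn/negP => nzc; apply: (prime_ideal1 pm).
rewrite -(rmorph1 iota) -(mulVf nzc) rmorphM.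
by apply: prime_idealM => //; apply: coord_ring_const.
Qed.

Lemma prime_idealX u n : coord_ring u -> m (u ^+ n) -> m u.
Proof.
move=> Ru; elim: n => [/(prime_ideal1 pm)//|n IH].
by rewrite exprS => /(prime_ideal_prime pm Ru (coord_ringX n Ru))[|/IH].
Qed.

(** The contraction of m to k[x] contains the norms of the elements of m; a
    nonzero polynomial of least degree in it generates it. *)
Lemma prime_ideal_contract :
  exists2 D, D != 0 & forall P, m (e P) <-> D %| P.
Proof.
have [d [nzd md] dmin] :
  exists2 d, d != 0 /\ m (e d) &
    forall P, P != 0 -> m (e P) -> (size d <= size P)%N.
  have [u mu nzu] := prime_ideal_neq0 pm.
  have [v [N [Rv nzN uvN]]] := coord_ring_norm (prime_ideal_sub pm mu) nzu.
  have mN : m (e N) by rewrite -uvN; apply: prime_idealMr.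
  have [n leNn] := ubnP (size N).
  elim: n => // n IH in N {uvN} nzN mN leNn *.
  have [[P [nzP mP ltP]]|noP] :=
      pselect (exists P, [/\ P != 0, m (e P) & (size P < size N)%N]).
    by apply: (IH P) => //; apply: leq_trans ltP _.
  exists N => // P nzP mP; rewrite leqNgt; apply/negP => ltP.
  by apply: noP; exists P.
exists d => // P; split=> [mP|/dvdpP[Q ->]].
  rewrite /dvdp; apply/negPn/negP => nzr.
  suff /(dmin _ nzr) : m (e (P %% d)) by rewrite leqNgt ltn_modp nzd.
  have -> : P %% d = P - P %/ d * d by rewrite {2}(divp_eq P d) addrC addKr.
  rewrite rmorphB rmorphM; apply: prime_idealB => //.
  by apply: prime_idealM => //; apply: coord_ring_ev.
by rewrite rmorphM; apply: prime_idealM => //; apply: coord_ring_ev.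
Qed.

End PrimeIdeal.
End Localisation.

(** * Regularity of the coordinate ring *)

Lemma size_mul_gt (k : fieldType) (D P : {poly k}) : (1 < size D)%N -> P != 0 ->
  (size P < size (P * D)%R)%N.
Proof.
move=> ltD nzP; have nzD : D != 0 by rewrite -size_poly_gt0 (ltn_trans _ ltD).
by rewrite size_mul // -(subnKC ltD) addnCA /= ltnS leq_addr.
Qed.

Lemma factor_power (k : fieldType) (D P : {poly k}) : (1 < size D)%N -> P != 0 ->
  exists n Q, P = D ^+ n * Q /\ ~~ (D %| Q).
Proof.
move=> ltD; have [n] := ubnP (size P); elim: n P => // n IH P leP nzP.
have [/dvdpP[Q PE]|ndvd] := boolP (D %| P); last first.
  by exists 0%N, P; rewrite expr0 mul1r.
have nzQ : Q != 0 by apply: contra_neq nzP => Q0; rewrite PE Q0 mul0r.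
have nzD : D != 0 by rewrite -size_poly_gt0 (ltn_trans _ ltD).
have [|//|n' [Q' [QE ndvd]]] := IH Q.
  by rewrite -ltnS; apply: leq_trans leP; rewrite ltnS PE size_mul_gt.
by exists n'.+1, Q'; split=> //; rewrite PE QE exprS; ring.
Qed.

Section Uniformiser.

Variables (k K : fieldType) (iota : {rmorphism k -> K}).
Variables (f : {poly k}) (x y : K).
Hypothesis model : hyperelliptic iota f x y.
Hypothesis nz2 : (2%:R : k) != 0.
Variables A B : {poly k}.
Hypothesis bezout : A * f + B * f^`() = 1.

Local Notation e := (ev iota x).
Local Notation R := (coord_ring iota x y).

Let yy : y * y = e f.
Proof. by rewrite -expr2 (hyperelliptic_eq model). Qed.

(** Where f vanishes, y is a uniformiser: f is squarefree, so that f = y^2 has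
    order one at the polynomial D of k[x] below m. Elsewhere D itself is a
    uniformiser: if D does not divide both P and Q, then P + Q y and P - Q y are
    not both in m, so that a power of D accounts for the whole norm of P + Q y.
    In both cases r is t^n times the unit u / v of the localisation. *)
Lemma uniformiser (m : set K) : prime_ideal iota x y m ->
  exists t, [/\ m t, t != 0 & forall r, R r -> r != 0 ->
    exists n u v, [/\ R u /\ R v, ~ m u, ~ m v & r * v = t ^+ n * u]].
Proof.
move=> pm.
have [D nzD mD] := prime_ideal_contract model pm.
have ltD : (1 < size D)%N.
  rewrite ltnNge; apply/negP => /size1_polyC DE; apply: (prime_ideal1 pm).
  by rewrite -(rmorph1 e) mD dvdp1 DE size_polyC -polyC_eq0 -DE nzD.
have Re P : R (e P) := coord_ring_ev iota x y P.
have RM := coord_ringM model.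
have nze P : P != 0 -> e P != 0 by rewrite (ev_eq0 model).
have ndvdD P : ~~ (D %| P) -> ~ m (e P) by move=> /negP ndvd /mD.
have [mf|mf] := pselect (m (e f)).
  have my : m y.
    apply: (@prime_idealX _ _ _ _ _ _ model _ pm _ 2); first exact: coord_ring_y.
    by rewrite expr2 yy.
  have nzf : f != 0.
    apply/eqP => f0; move: bezout; rewrite f0 mulr0 deriv0 mulr0 addr0.
    by move/eqP; rewrite eq_sym oner_eq0.
  have nzy : y != 0.
    by apply: contra_neq (nze _ nzf) => y0; rewrite -yy y0 mulr0.
  have [g fE] : exists g, f = g * D by apply/dvdpP; rewrite -mD.
  have mg : ~ m (e g).
    move=> /mD /dvdpP[h gE]; apply: (prime_ideal1 pm); rewrite -(rmorph1 e).
    rewrite mD -bezout dvdp_add // ?dvdp_mull //; first by rewrite fE dvdp_mulIr.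
    by rewrite fE gE !derivM; apply/dvdpP; exists ((h^`() * D + h * D^`()) + h * D^`()); ring.
  have evp P : P != 0 -> exists n u v,
      [/\ R u /\ R v, ~ m u, ~ m v & e P * v = y ^+ n.*2 * u].
    move=> nzP; have [n [Q [PE /ndvdD mQ]]] := factor_power ltD nzP.
    exists n, (e Q), (e (g ^+ n)); split=> //.
      by rewrite rmorphXn => /(prime_idealX model pm (Re g)).
    by rewrite PE -mul2n exprM expr2 yy fE !rmorphM !rmorphXn /= exprMn; ring.
  exists y; split=> // _ [P [Q ->]] nzr.
  have [P0|nzP] := eqVneq P 0.
    have nzQ : Q != 0.
      by apply: contra_neq nzr => Q0; rewrite P0 Q0 rmorph0 mul0r addr0.
    have [n [u [v [Ruv mu mv uvE]]]] := evp _ nzQ.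
    exists n.*2.+1, u, v; split=> //.
    by rewrite P0 rmorph0 add0r mulrAC uvE exprSr mulrAC.
  have [Q0|nzQ] := eqVneq Q 0.
    have [n [u [v [Ruv mu mv uvE]]]] := evp _ nzP.
    by exists n.*2, u, v; split=> //; rewrite Q0 rmorph0 mul0r addr0.
  have [a [u [v [[Ru Rv] mu mv uvE]]]] := evp _ nzP.
  have [b [u' [v' [[Ru' Rv'] mu' mv' uvE']]]] := evp _ nzQ.
  have Ry : R y := coord_ring_y iota x y.
  have RyX n : R (y ^+ n) := coord_ringX model n Ry.
  have sumE : (e P + e Q * y) * (v * v')
      = y ^+ a.*2 * (u * v') + y ^+ b.*2.+1 * (u' * v).
    by rewrite exprSr; transitivity ((e P * v) * v' + (e Q * v') * y * v);
      [ring | rewrite uvE uvE'; ring].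
  have Ruv : R (u * v') by apply: RM.
  have Ruv' : R (u' * v) by apply: RM.
  have muv : ~ m (u * v') by exact: (prime_ideal_compl pm).
  have muv' : ~ m (u' * v) by exact: (prime_ideal_compl pm).
  have [leab|ltba] := leqP a b.
    exists a.*2, (u * v' + y ^+ (b - a).*2.+1 * (u' * v)), (v * v'); split.
    - split; first by apply: coord_ringD => //; apply: RM.
      exact: RM.
    - have my' : m (y ^+ (b - a).*2.+1 * (u' * v)).
        by rewrite exprS -mulrA; apply: (prime_idealMr pm) => //; apply: RM.
      by move=> ms; apply: muv; rewrite -[u * v'](addrK (y ^+ (b - a).*2.+1 * (u' * v)));
        apply: (prime_idealB pm).
    - exact: (prime_ideal_compl pm).
    - rewrite sumE mulrDr; congr (_ + _); rewrite [RHS]mulrA -exprD; congr (y ^+ _ * _).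
      lia.
  exists b.*2.+1, (y ^+ (a - b.+1).*2.+1 * (u * v') + u' * v), (v * v'); split.
  - split; last exact: RM.
    by apply: coord_ringD => //; apply: RM.
  - have my' : m (y ^+ (a - b.+1).*2.+1 * (u * v')).
      by rewrite exprS -mulrA; apply: (prime_idealMr pm) => //; apply: RM.
    by move=> ms; apply: muv'; rewrite -[u' * v](addKr (y ^+ (a - b.+1).*2.+1 * (u * v'))) addrC;
      apply: (prime_idealB pm).
  - exact: (prime_ideal_compl pm).
  - rewrite sumE mulrDr; congr (_ + _); rewrite [RHS]mulrA -exprD; congr (y ^+ _ * _).
    lia.
(* From here on f is invertible at m. *)
have my : ~ m y.
  by move=> my; apply: mf; rewrite -yy; apply: (prime_idealM pm) => //;
    apply: coord_ring_y.
exists (e D); split; [by rewrite mD | exact: nze |].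
move=> r [P [Q rE]] nzr.
have [n] := ubnP (size P + size Q)%N; elim: n => // n IH in P Q r rE nzr *.
move=> lePQ.
have [/andP[/dvdpP[P' PE] /dvdpP[Q' QE]]|ndvd] := boolP ((D %| P) && (D %| Q)).
  have rE' : r = e D * (e P' + e Q' * y) by rewrite rE PE QE !rmorphM /=; ring.
  have nzr' : e P' + e Q' * y != 0.
    by apply: contra_neq nzr => r0; rewrite rE' r0 mulr0.
  have [|i [u [v [Ruv mu mv uvE]]]] := IH P' Q' _ erefl nzr'.
    have szD (S : {poly k}) : S != 0 -> (size S < size (S * D)%R)%N by exact: size_mul_gt.
    have szD0 (S : {poly k}) : (size S <= size (S * D)%R)%N.
      by have [->|/szD/ltnW//] := eqVneq S 0; rewrite mul0r.
    move: lePQ; rewrite ltnS PE QE; apply: leq_trans.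
    have [P0|/szD ltP] := eqVneq P' 0; last by rewrite -addSn leq_add.
    have [Q0|/szD ltQ] := eqVneq Q' 0; last by rewrite -addnS leq_add.
    by move: nzr'; rewrite P0 Q0 rmorph0 mul0r addr0 eqxx.
  by exists i.+1, u, v; split=> //; rewrite rE' -mulrA uvE exprS mulrA.
have [mr|mr] := pselect (m r); last first.
  exists 0%N, r, 1; split=> //; last by rewrite expr0 mulr1 mul1r.
    by split; [exists P, Q | apply: coord_ring1].
  exact: (prime_ideal1 pm).
pose r' := e P - e Q * y.
have Rr : R r by exists P, Q.
have Rr' : R r' by exists P, (- Q); rewrite rmorphN mulNr.
have m2 : ~ m (iota 2%:R) by move=> /(prime_ideal_const pm)/eqP; rewrite (negPf nz2).
have mr' : ~ m r'.
  move=> mr'; move/negP: ndvd; apply; apply/andP; split.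
    rewrite -mD; have /(prime_ideal_prime pm)[] // : m (iota 2%:R * e P).
    - suff -> : iota 2%:R * e P = r + r' by apply: (prime_idealD pm).
      by rewrite rE /r' rmorph_nat; ring.
    - exact: coord_ring_const.
  have /(prime_ideal_prime pm)[] // : m (e Q * y).
  - have /(prime_ideal_prime pm)[] // : m (iota 2%:R * (e Q * y)).
    + suff -> : iota 2%:R * (e Q * y) = r - r' by apply: (prime_idealB pm).
      by rewrite rE /r' rmorph_nat; ring.
    + exact: coord_ring_const.
    + by apply: RM => //; apply: coord_ring_y.
  - exact: coord_ring_y.
  - by rewrite -mD.
have rrE : r * r' = e (P * P - Q * Q * f).
  by rewrite rE /r' !rmorphB /= !rmorphM /= -yy; ring.
have [N0|nzN] := eqVneq (P * P - Q * Q * f) 0.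
  have r'0 : r' = 0.
    by apply/eqP; move/eqP: rrE; rewrite N0 rmorph0 mulf_eq0 (negPf nzr).
  by case: mr'; rewrite r'0; apply: (prime_ideal0 pm).
have [i [S [NE ndvdS]]] := factor_power ltD nzN.
exists i, (e S), r'; split=> //; first exact: ndvdD.
by rewrite rrE NE rmorphM rmorphXn.
Qed.

End Uniformiser.

(** * Places and prime ideals *)

Section Places.

Variables (k K : fieldType) (iota : {rmorphism k -> K}) (O : set K).
Hypothesis placeO : is_place iota O.

Lemma place_const c : O (iota c). Proof. by case: placeO. Qed.

Lemma placeB u v : O u -> O v -> O (u - v).
Proof. by case: placeO => _ OB _ _ _; apply: OB. Qed.

Lemma placeM u v : O u -> O v -> O (u * v).
Proof. by case: placeO => _ _ OM _ _; apply: OM. Qed.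

Lemma place_val u : O u \/ O u^-1.
Proof. by case: placeO. Qed.

Lemma place0 : O 0.
Proof. by rewrite -(rmorph0 iota); apply: place_const. Qed.

Lemma place1 : O 1.
Proof. by rewrite -(rmorph1 iota); apply: place_const. Qed.

Lemma placeN u : O u -> O (- u).
Proof. by move=> Ou; rewrite -sub0r; apply: placeB => //; apply: place0. Qed.

Lemma placeD u v : O u -> O v -> O (u + v).
Proof. by move=> Ou Ov; rewrite -[v]opprK; apply: placeB => //; apply: placeN. Qed.

Lemma placeX u n : O u -> O (u ^+ n).
Proof.
by move=> Ou; elim: n => [|n IH]; [apply: place1 | rewrite exprS; apply: placeM].
Qed.

Lemma place_sum (I : Type) (s : seq I) (P : pred I) (F : I -> K) :
  (forall i, P i -> O (F i)) -> O (\sum_(i <- s | P i) F i).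
Proof.
move=> OF; elim/big_rec: _ => [|i u Pi Ou]; first exact: place0.
by apply: placeD => //; apply: OF.
Qed.

Lemma place_ev x P : O x -> O (ev iota x P).
Proof.
move=> Ox; elim/poly_ind: P => [|P c OP]; first by rewrite rmorph0; apply: place0.
rewrite rmorphD rmorphM /= evX evC.
by apply: placeD; [apply: placeM | apply: place_const].
Qed.

Lemma maximal_ideal_unit u : O u -> ~ maximal_ideal O u -> u != 0 /\ O u^-1.
Proof.
move=> Ou mu; split; first by apply/eqP => u0; apply: mu; split; rewrite // u0 eqxx.
by apply: contrapT => nO; apply: mu; split.
Qed.

Lemma maximal_idealM u v : O u -> maximal_ideal O v -> maximal_ideal O (u * v).
Proof.
move=> Ou [Ov mv]; split; first exact: placeM.
rewrite mulf_eq0 negb_or => /andP[nzu nzv] Ouv; apply: (mv nzv).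
by rewrite -[v^-1](mulVKf nzu) -invfM; apply: placeM.
Qed.

Lemma maximal_ideal0 : maximal_ideal O 0.
Proof. by split; [apply: place0 | rewrite eqxx]. Qed.

Lemma maximal_idealN u : maximal_ideal O u -> maximal_ideal O (- u).
Proof. by rewrite -mulN1r; apply: maximal_idealM; apply/placeN/place1. Qed.

(** One of u / v and v / u is in O, so that u + v is a multiple of v or of u. *)
Lemma maximal_idealD u v : maximal_ideal O u -> maximal_ideal O v ->
  maximal_ideal O (u + v).
Proof.
have half w z : maximal_ideal O w -> maximal_ideal O z -> O (w / z) ->
    z != 0 -> maximal_ideal O (w + z).
  move=> mw mz Owz nzz.
  have -> : w + z = (w / z + 1) * z by rewrite mulrDl mul1r divfK.
  by apply: maximal_idealM => //; apply: placeD => //; apply: place1.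
move=> mu mv.
have [->|nzu] := eqVneq u 0; first by rewrite add0r.
have [->|nzv] := eqVneq v 0; first by rewrite addr0.
have [|] := place_val (u / v); first by move=> Ouv; apply: half.
by rewrite invf_div addrC => Ovu; apply: half.
Qed.

Lemma maximal_idealB u v : maximal_ideal O u -> maximal_ideal O v ->
  maximal_ideal O (u - v).
Proof. by move=> mu mv; apply: maximal_idealD => //; apply: maximal_idealN. Qed.

Lemma maximal_ideal1 : ~ maximal_ideal O 1.
Proof. by move=> [_]; rewrite oner_eq0 invr1 => /(_ isT); apply; apply: place1. Qed.

Lemma maximal_ideal_const c : maximal_ideal O (iota c) -> c = 0.
Proof.
move=> [_ mc]; apply/eqP/negPn/negP => nzc; apply: mc; first by rewrite fmorph_eq0.
by rewrite -fmorphV; apply: place_const.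
Qed.

Lemma maximal_ideal_prime u v : O u -> O v -> maximal_ideal O (u * v) ->
  maximal_ideal O u \/ maximal_ideal O v.
Proof.
move=> Ou Ov [_ muv]; apply: contrapT => /not_orP[mu mv].
have [nzu OuV] := maximal_ideal_unit Ou mu.
have [nzv OvV] := maximal_ideal_unit Ov mv.
by apply: muv; rewrite ?mulf_neq0 // invfM; apply: placeM.
Qed.

(** Valuation rings are integrally closed. *)
Lemma place_sqrt u : O (u ^+ 2) -> O u.
Proof.
move=> Ou2; have [//|Ou] := place_val u.
have [->|nzu] := eqVneq u 0; first exact: place0.
by rewrite -[u](mulfK nzu) -expr2; apply: placeM.
Qed.

End Places.

Section PlacesOverAffine.

Variables (k K : fieldType) (iota : {rmorphism k -> K}).
Variables (f : {poly k}) (x y : K).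
Hypothesis model : hyperelliptic iota f x y.
Hypothesis nz2 : (2%:R : k) != 0.
Variables A B : {poly k}.
Hypothesis bezout : A * f + B * f^`() = 1.

Local Notation e := (ev iota x).
Local Notation R := (coord_ring iota x y).

Lemma place_coord_ring O : is_place iota O -> O x ->
  forall u, R u -> O u.
Proof.
move=> pO Ox _ [P [Q ->]]; apply: (placeD pO); first exact: place_ev.
apply: (placeM pO); first exact: place_ev.
by apply: (place_sqrt pO); rewrite (hyperelliptic_eq model); apply: place_ev.
Qed.

Definition center (O : set K) : set K :=
  [set u | R u /\ maximal_ideal O u]%classic.

(** If the center were zero, the nonzero elements of the coordinate ring would
    be units of O, and O would be all of K. *)
Lemma center_prime O : is_place iota O -> O x -> prime_ideal iota x y (center O).
Proof.
move=> pO Ox; have RO := place_coord_ring pO Ox; split.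
- by move=> u [].
- by move=> u v [Ru mu] [Rv mv]; split; [apply: coord_ringB | apply: (maximal_idealB pO)].
- by move=> u v Ru [Rv mv]; split; [apply: (coord_ringM model) | apply: (maximal_idealM pO) => //; apply: RO].
- by move=> [_ /(maximal_ideal1 pO)].
- move=> u v Ru Rv [_ /(maximal_ideal_prime pO (RO _ Ru) (RO _ Rv))[]] m;
    by [left | right].
- apply: contrapT => no; case: pO => _ _ OM _; apply; apply/seteqP; split=> // z _.
  have [u [v [Ru Rv nzv ->]]] := coord_ring_fraction model z.
  apply: OM; first exact: RO.
  apply: contrapT => Ov; apply: no; exists v => //; split=> //.
  by split=> //; apply: RO.
Qed.

(** Up to units every element of K is a power of a uniformiser, of positive or
    negative exponent. *)
Lemma local_ring_place m : prime_ideal iota x y m ->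
  is_place iota (local_ring iota x y m).
Proof.
move=> pm; have RM := coord_ringM model; split.
- move=> c; exists (iota c), 1; split; rewrite ?divr1 //.
  + exact: coord_ring_const.
  + exact: coord_ring1.
  + exact: prime_ideal1 pm.
- move=> _ _ [u [v [Ru Rv mv ->]]] [u' [v' [Ru' Rv' mv' ->]]].
  exists (u * v' - u' * v), (v * v'); split.
  + by apply: coord_ringB; apply: RM.
  + exact: RM.
  + exact: (prime_ideal_compl pm).
  + have nzv := compl_prime_neq0 pm mv; have nzv' := compl_prime_neq0 pm mv'.
    by field; rewrite nzv nzv'.
- move=> _ _ [u [v [Ru Rv mv ->]]] [u' [v' [Ru' Rv' mv' ->]]].
  exists (u * u'), (v * v'); split.
  + exact: RM.
  + exact: RM.
  + exact: (prime_ideal_compl pm).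
  + have nzv := compl_prime_neq0 pm mv; have nzv' := compl_prime_neq0 pm mv'.
    by field; rewrite nzv nzv'.
- have [t [mt nzt unif]] := uniformiser model nz2 bezout pm.
  have Rt := prime_ideal_sub pm mt.
  move=> z; have [a [b [Ra Rb nzb ->]]] := coord_ring_fraction model z.
  have [a0|nza] := eqVneq a 0.
    left; exists 0, 1; split; rewrite ?a0 ?mul0r //.
    + exact: coord_ring0.
    + exact: coord_ring1.
    + exact: prime_ideal1 pm.
  have [i [u [v [[Ru Rv] mu mv aE]]]] := unif _ Ra nza.
  have [j [u' [v' [[Ru' Rv'] mu' mv' bE]]]] := unif _ Rb nzb.
  have nz w : ~ m w -> w != 0 := @compl_prime_neq0 _ _ _ _ _ _ pm w.
  have {}aE : a = t ^+ i * u / v by rewrite -aE mulfK // nz.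
  have {}bE : b = t ^+ j * u' / v' by rewrite -bE mulfK // nz.
  have sol (i0 j0 : nat) u0 v0 u1 v1 : (i0 <= j0)%N -> R u0 -> R v0 -> R u1 -> R v1 ->
     ~ m u0 -> ~ m v0 -> ~ m u1 -> ~ m v1 ->
     local_ring iota x y m ((t ^+ j0 * u1 / v1) / (t ^+ i0 * u0 / v0)).
    move=> leij Ru0 Rv0 Ru1 Rv1 mu0 mv0 mu1 mv1.
    exists (t ^+ (j0 - i0) * (u1 * v0)), (v1 * u0); split.
    + by apply: (RM); [exact: (coord_ringX model) | exact: RM].
    + exact: RM.
    + exact: (prime_ideal_compl pm).
    + rewrite -{1}(subnK leij) exprD.
      have := expf_neq0 i0 nzt; move: (t ^+ i0) => T nzT.
      by field; rewrite nzT !nz.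
  have [leji|/ltnW leij] := leqP j i.
    by left; rewrite aE bE; apply: sol.
  by right; rewrite invf_div aE bE; apply: sol.
- have [t [mt nzt _]] := uniformiser model nz2 bezout pm.
  have Rt := prime_ideal_sub pm mt.
  move=> lT; have : local_ring iota x y m t^-1 by rewrite lT.
  move=> [u [v [Ru Rv mv tE]]]; apply: (mv).
  have nzv := compl_prime_neq0 pm mv.
  have -> : v = u * t by rewrite -[u](divfK nzv) -tE mulrC mulrA mulfV ?mul1r.
  exact: (prime_idealM pm).
Qed.

(** An element z of O outside the localisation would have its inverse in the
    maximal ideal of the localisation, hence in that of O. *)
Lemma place_local_ring O : is_place iota O -> O x ->
  O = local_ring iota x y (center O).
Proof.
move=> pO Ox; have pm := center_prime pO Ox; have RO := place_coord_ring pO Ox.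
have unitO u : R u -> ~ center O u -> u != 0 /\ O u^-1.
  by move=> Ru mu; apply: maximal_ideal_unit; [apply: RO | move=> m; apply: mu].
apply/seteqP; split=> z; last first.
  by move=> [u [v [Ru Rv mv ->]]]; apply: (placeM pO); [apply: RO | case: (unitO v)].
move=> Oz; have [//|] := place_val (local_ring_place pm) z.
have [->|nzz] := eqVneq z 0; first by rewrite invr0.
move=> [u [v [Ru Rv mv zE]]].
have zvu : v = z * u by rewrite -[u](divfK (compl_prime_neq0 pm mv)) -zE mulVKf.
have mu : ~ center O u.
  move=> [_ mu]; apply: mv; split=> //.
  by rewrite zvu; apply: (maximal_idealM pO).
exists v, u; split=> //.
by rewrite zvu mulfK // (compl_prime_neq0 pm mu).
Qed.

End PlacesOverAffine.

(** * Differentials on the affine curve *)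

Section DerivationTheory.

Variables (k K : fieldType) (iota : {rmorphism k -> K}).
Variable Delta : derivation iota.

Lemma derivation0 : Delta 0 = 0.
Proof. by rewrite -[X in Delta X](rmorph0 iota) derivationC. Qed.

Lemma derivation_ev x P : Delta (ev iota x P) = ev iota x P^`() * Delta x.
Proof.
elim/poly_ind: P => [|P c IH].
  by rewrite rmorph0 derivation0 deriv0 rmorph0 mul0r.
rewrite rmorphD rmorphM /= evX evC derivationD derivationM derivationC IH.
rewrite derivD derivM derivX derivC !addr0 mulr1 rmorphD rmorphM /= evX.
by ring.
Qed.

Lemma derivationV u : u != 0 -> Delta u^-1 = - Delta u / u ^+ 2.
Proof.
move=> nzu; have : Delta (u * u^-1) = 0.
  by rewrite mulfV // -(rmorph1 iota) derivationC.
rewrite derivationM => /eqP; rewrite addr_eq0 => /eqP uE.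
apply: (mulfI nzu); rewrite uE.
by field.
Qed.

End DerivationTheory.

Section AffineDifferentials.

Variables (k K : fieldType) (iota : {rmorphism k -> K}).
Variables (f : {poly k}) (x y : K).
Hypothesis model : hyperelliptic iota f x y.
Hypothesis nz2 : (2%:R : k) != 0.
Variables A B : {poly k}.
Hypothesis bezout : A * f + B * f^`() = 1.

Local Notation e := (ev iota x).
Local Notation R := (coord_ring iota x y).

Let yy : y * y = e f.
Proof. by rewrite -expr2 (hyperelliptic_eq model). Qed.

Let nz2K : (2%:R : K) != 0.
Proof. by rewrite -(rmorph_nat iota) fmorph_eq0. Qed.

(** The derivative of P + Q y under y d/dx, where y dy/dx = f' / 2. *)
Definition der_num P Q : K := e P^`() * y + e (Q^`() * f) + e (Q * f^`()) / 2%:R.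

(** The quotient rule for z = (P + Q y) / D, required of all such presentations
    of z at once, so that the axioms of a derivation can be checked on any of
    them. *)
Definition der_spec z w : Prop := forall P Q D, D != 0 ->
  z * e D = e P + e Q * y -> w * e D = der_num P Q - z * (e D^`() * y).

(** Two presentations of z satisfy P * D1 = P1 * D and Q * D1 = Q1 * D; the
    derivatives of these two equations reconcile the quotient rules. *)
Lemma der_specI z w P Q D : D != 0 -> z * e D = e P + e Q * y ->
  w * e D = der_num P Q - z * (e D^`() * y) -> der_spec z w.
Proof.
move=> nzD zD wD P1 Q1 D1 nzD1 zD1.
have [] := @hyperelliptic_free _ _ _ _ _ _ model (P * D1 - P1 * D) (Q * D1 - Q1 * D).
  rewrite !rmorphB !rmorphM /=.
  transitivity (e D1 * (e P + e Q * y) - e D * (e P1 + e Q1 * y)); first by ring.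
  by rewrite -zD -zD1; ring.
move=> /subr0_eq PE /subr0_eq QE.
have := congr1 (fun S => e S^`()) PE; have := congr1 (fun S => e S^`()) QE.
have := congr1 e QE; rewrite !derivM !rmorphD !rmorphM /= => EQ dQ dP.
apply: (mulfI (_ : e D != 0)); first by rewrite (ev_eq0 model).
transitivity (e D1 * (w * e D)); first by ring.
rewrite wD /der_num !rmorphM /=.
have zD' := zD; have zD1' := zD1.
apply/eqP; rewrite -subr_eq0; apply/eqP.
transitivity ((e P^`() * e D1 + e P * e D1^`() - (e P1^`() * e D + e P1 * e D^`())) * y
  + (e Q^`() * e D1 + e Q * e D1^`() - (e Q1^`() * e D + e Q1 * e D^`())) * e f
  + (e Q * e D1 - e Q1 * e D) * e f^`() / 2%:R
  - e D^`() * y * (z * e D1 - (e P1 + e Q1 * y))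
  + e D1^`() * y * (z * e D - (e P + e Q * y))
  + (e Q1 * e D^`() - e Q * e D1^`()) * (e f - y * y)); first by field.
by rewrite dP dQ EQ zD zD1 yy !subrr; ring.
Qed.

Lemma der_spec_ex z : exists w, der_spec z w.
Proof.
have [P [Q [D [nzD zD]]]] := hyperelliptic_frac model z.
exists ((der_num P Q - z * (e D^`() * y)) / e D).
by apply: (der_specI nzD zD); rewrite divfK // (ev_eq0 model).
Qed.

Definition der_fun z : K := projT1 (cid (der_spec_ex z)).

Lemma der_funP z : der_spec z (der_fun z).
Proof. by rewrite /der_fun; case: cid. Qed.

Lemma der_fun_eq z w : der_spec z w -> der_fun z = w.
Proof.
move=> wP; have [P [Q [D [nzD zD]]]] := hyperelliptic_frac model z.
apply: (mulIf (_ : e D != 0)); first by rewrite (ev_eq0 model).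
by rewrite (wP _ _ _ nzD zD) (der_funP nzD zD).
Qed.

Lemma der_funD u v : der_fun (u + v) = der_fun u + der_fun v.
Proof.
have [P [Q [D [nzD uD]]]] := hyperelliptic_frac model u.
have [P1 [Q1 [D1 [nzD1 vD]]]] := hyperelliptic_frac model v.
have du := der_funP nzD uD; have dv := der_funP nzD1 vD.
apply: der_fun_eq; apply: (@der_specI _ _ (P * D1 + P1 * D) (Q * D1 + Q1 * D) (D * D1)).
- exact: mulf_neq0.
- rewrite !rmorphD !rmorphM /=.
  transitivity (e D1 * (u * e D) + e D * (v * e D1)); first by ring.
  by rewrite uD vD; ring.
- rewrite rmorphM /=.
  transitivity (e D1 * (der_fun u * e D) + e D * (der_fun v * e D1)); first by ring.
  rewrite du dv /der_num !(derivD, derivM) !(rmorphD, rmorphM) /= ?(rmorphD, rmorphM) /=.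
  apply/eqP; rewrite -subr_eq0; apply/eqP.
  transitivity (e D1^`() * y * (u * e D - (e P + e Q * y))
    + e D^`() * y * (v * e D1 - (e P1 + e Q1 * y))
    + (e Q * e D1^`() + e Q1 * e D^`()) * (y * y - e f)); first by field.
  by rewrite uD vD yy !subrr; ring.
Qed.

Lemma der_funM u v : der_fun (u * v) = u * der_fun v + v * der_fun u.
Proof.
have [P [Q [D [nzD uD]]]] := hyperelliptic_frac model u.
have [P1 [Q1 [D1 [nzD1 vD]]]] := hyperelliptic_frac model v.
have du := der_funP nzD uD; have dv := der_funP nzD1 vD.
have nze : e D != 0 by rewrite (ev_eq0 model).
have nze1 : e D1 != 0 by rewrite (ev_eq0 model).
have {uD}uE : u = (e P + e Q * y) / e D by rewrite -uD mulfK.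
have {vD}vE : v = (e P1 + e Q1 * y) / e D1 by rewrite -vD mulfK.
have {}du : der_fun u = (der_num P Q - u * (e D^`() * y)) / e D.
  by rewrite -du mulfK.
have {}dv : der_fun v = (der_num P1 Q1 - v * (e D1^`() * y)) / e D1.
  by rewrite -dv mulfK.
apply: der_fun_eq.
apply: (@der_specI _ _ (P * P1 + Q * Q1 * f) (P * Q1 + P1 * Q) (D * D1)).
- exact: mulf_neq0.
- rewrite uE vE !(rmorphD, rmorphM) /= ?(rmorphD, rmorphM) /= -yy.
  by field; rewrite nze nze1.
- rewrite du dv uE vE /der_num !(derivD, derivM) !(rmorphD, rmorphM) /=.
  rewrite ?(rmorphD, rmorphM) /= -?yy.
  by field; rewrite nze nze1 nz2K.
Qed.

Lemma der_fun_ev P : der_fun (e P) = e P^`() * y.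
Proof.
apply: der_fun_eq; apply: (@der_specI _ _ P 0 1).
- exact: oner_neq0.
- by rewrite rmorph1 rmorph0 mulr1 mul0r addr0.
- by rewrite /der_num -[in e 1^`()]polyC1 derivC rmorph1 deriv0 !mul0r !rmorph0; ring.
Qed.

Lemma der_fun_const c : der_fun (iota c) = 0.
Proof. by rewrite -(evC iota x) der_fun_ev derivC rmorph0 mul0r. Qed.

(** This is y d/dx, on which the differential dx / y takes the value 1. Unlike
    d/dx it preserves the coordinate ring. *)
Definition dual_derivation : derivation iota :=
  Derivation der_funD der_funM der_fun_const.

Local Notation D2 := dual_derivation.

Lemma dual_derivation_x : D2 x = y.
Proof. by rewrite -[X in D2 X](evX iota) /= der_fun_ev derivX rmorph1 mul1r. Qed.

Let nzy : y != 0.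
Proof. by case: (hyperelliptic_neq0 model). Qed.

Lemma derivation_y (Delta : derivation iota) :
  2%:R * y * Delta y = e f^`() * Delta x.
Proof. by rewrite -derivation_ev -yy derivationM; ring. Qed.

(** A derivation is determined by its value at x, since y^2 = f gives 2 y Delta
    y = f' Delta x. *)
Lemma derivation_dual (Delta : derivation iota) v :
  Delta v = Delta x / y * D2 v.
Proof.
have [P [Q [D [nzD vD]]]] := hyperelliptic_frac model v.
have nze : e D != 0 by rewrite (ev_eq0 model).
have all_der (G : derivation iota) : G v = G x / y * (der_num P Q - v * (e D^`() * y)) / e D.
  have := congr1 G vD; rewrite derivationM derivationD derivationM !derivation_ev.
  have -> : G y = e f^`() * G x / (2%:R * y).
    by rewrite -derivation_y mulrC mulKf // mulf_neq0.
  move=> E; apply: (mulIf nze); rewrite divfK // mulrC.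
  apply: (addrI (v * (e D^`() * G x))); rewrite E /der_num !rmorphM /= -yy.
  by field; rewrite nzy nz2K.
rewrite (all_der Delta) (all_der D2) dual_derivation_x.
by field; rewrite nzy nze.
Qed.

Lemma dual_derivation_coord_ring u : R u -> R (D2 u).
Proof.
move=> [P [Q ->]].
rewrite derivationD derivationM /= !der_fun_ev.
have -> : der_fun y = e ((2%:R)^-1%:P * f^`()).
  apply: (mulfI (_ : 2%:R * y != 0)); first by rewrite mulf_neq0.
  rewrite (derivation_y D2) dual_derivation_x rmorphM /= evC fmorphV rmorph_nat.
  by field.
exists (Q^`() * f + Q * ((2%:R)^-1%:P * f^`())), P^`().
by rewrite !(rmorphD, rmorphM) /= -yy; ring.
Qed.

Lemma dual_derivation_local_ring m z : prime_ideal iota x y m ->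
  local_ring iota x y m z -> local_ring iota x y m (D2 z).
Proof.
move=> pm [u [v [Ru Rv mv ->]]].
have nzv := compl_prime_neq0 pm mv; have RM := coord_ringM model.
have RD := dual_derivation_coord_ring.
exists (D2 u * v - u * D2 v), (v * v); split.
- by apply: coord_ringB; apply: RM => //; apply: RD.
- exact: RM.
- exact: (prime_ideal_compl pm).
- rewrite derivationM derivationV //.
  by field.
Qed.

(** The denominators of h form a proper ideal of the coordinate ring. Zorn's
    lemma puts it in a maximal ideal, which is prime and whose localisation
    misses h. *)
Lemma prime_avoiding h : ~ R h ->
  exists2 m, prime_ideal iota x y m & ~ local_ring iota x y m h.
Proof.
move=> nRh; have RM := coord_ringM model.
pose I : set K := [set r | R r /\ R (r * h)]%classic.
pose ideal (X : set K) := [/\ (forall u, X u -> R u),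
  (forall u v, X u -> X v -> X (u - v)), (forall u v, R u -> X v -> X (u * v))
  & ~ X 1].
have idealI : ideal I.
  split=> [u []//|u v [Ru Ruh] [Rv Rvh]|u v Ru [Rv Rvh]|[_]]; last by rewrite mul1r.
    by split; [apply: coord_ringB | rewrite mulrBl; apply: coord_ringB].
  by split; [apply: RM | rewrite -mulrA; apply: RM].
have [C [idealC maxC]] : exists C, ideal (I `|` C)%classic /\
    forall E, (C `<` E)%classic -> ~ ideal (I `|` E)%classic.
  apply: (@Zorn_bigcup K (fun X => ideal (I `|` X)%classic)) => F FP Ftot.
  pose U := (I `|` \bigcup_(X in F) X)%classic.
  have U2 u v : U u -> U v ->
      exists X : set K, [/\ ideal X, X u, X v & (X `<=` U)%classic].
    move=> [Iu|[X FX Xu]] [Iv|[Y FY Yv]].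
    - by exists I; split=> // ? ?; left.
    - exists (I `|` Y)%classic; split; [exact: FP| by left| by right|].
      by move=> w [?|?]; [left|right; exists Y].
    - exists (I `|` X)%classic; split; [exact: FP| by right| by left|].
      by move=> w [?|?]; [left|right; exists X].
    - have [XY|YX] := Ftot _ _ FX FY.
        exists (I `|` Y)%classic; split; [exact: FP| by right; apply: XY| by right|].
        by move=> w [?|?]; [left|right; exists Y].
      exists (I `|` X)%classic; split; [exact: FP| by right| by right; apply: YX|].
      by move=> w [?|?]; [left|right; exists X].
  split.
  - by move=> u Uu; have [X [[XR _ _ _] Xu _ _]] := U2 u u Uu Uu; apply: XR.
  - move=> u v Uu Uv; have [X [[_ XB _ _] Xu Xv XU]] := U2 u v Uu Uv.
    by apply: XU; apply: XB.
  - move=> u v Ru Uv; have [X [[_ _ XM _] Xv _ XU]] := U2 v v Uv Uv.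
    by apply: XU; apply: XM.
  - by move=> U1; have [X [[_ _ _ X1] /X1]] := U2 1 1 U1 U1.
pose M := (I `|` C)%classic.
have [MR MB MM M1] : ideal M by [].
have M0 : M 0.
  by left; split; rewrite ?mul0r; apply: coord_ring0.
have MN u : M u -> M (- u) by rewrite -sub0r; apply: MB.
have MD u v : M u -> M v -> M (u + v) by rewrite -{2}[v]opprK => Mu /MN; apply: MB.
exists M; last first.
  move=> [u [v [Ru Rv Mv hE]]]; apply: (Mv); left; split=> //.
  have nzv : v != 0 by apply/eqP => v0; apply: Mv; rewrite v0.
  by rewrite hE mulrC divfK.
split=> //.
  move=> u v Ru Rv Muv; apply: contrapT => /not_orP[Mu Mv].
  pose N : set K := [set w | exists a r, [/\ M a, R r & w = a + r * u]]%classic.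
  have MN' w : M w -> N w.
    by move=> Mw; exists w, 0; split; [|exact: coord_ring0|rewrite mul0r addr0].
  have Nu : N u.
    by exists 0, 1; split; [|exact: coord_ring1|rewrite mul1r add0r].
  have IN : (I `|` N = N)%classic.
    by apply/seteqP; split=> [w [Iw|//]|w Nw]; [apply: MN'; left|right].
  apply: (maxC N); first split.
  - by move=> w Cw; apply: MN'; right.
  - by move=> NC; apply: Mu; right; apply: NC.
  rewrite IN; split.
  - move=> _ [a [r [Ma Rr ->]]]; apply: (coord_ringD); first exact: MR.
    exact: RM.
  - move=> _ _ [a [r [Ma Rr ->]]] [a' [r' [Ma' Rr' ->]]].
    exists (a - a'), (r - r'); split; [exact: MB|exact: coord_ringB|ring].
  - move=> s _ Rs [a [r [Ma Rr ->]]].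
    exists (s * a), (s * r); split; [exact: MM|exact: RM|ring].
  - move=> [a [r [Ma Rr E1]]]; apply: Mv.
    have -> : v = v * a + r * (u * v) by rewrite -[LHS]mul1r E1; ring.
    by apply: MD; apply: MM.
have [u [v [Ru Rv nzv hE]]] := coord_ring_fraction model h.
by exists v => //; left; split=> //; rewrite hE mulrC divfK.
Qed.

(** As y d/dx preserves every localisation O, a sum of u dv with u and v in O
    takes a value in O there; and the coordinate ring is the intersection of its
    localisations. *)
Lemma regular_affine (om : differential iota) :
  (forall O, is_place iota O -> O x -> regular_at O om) -> R (om D2).
Proof.
move=> reg; apply: contrapT => /prime_avoiding[m pm]; apply.
have pO := local_ring_place model nz2 bezout pm.
have Ox : local_ring iota x y m x.
  exists x, 1; split; rewrite ?divr1 //; first exact: coord_ring_x.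
    exact: coord_ring1.
  exact: prime_ideal1 pm.
have [s [sO ->]] := reg _ pO Ox.
rewrite big_seq; apply: (place_sum pO) => uv /sO[Ou Ov].
by apply: (placeM pO) => //; apply: dual_derivation_local_ring.
Qed.

End AffineDifferentials.

(** * The chart at infinity and the genus *)

Section Reciprocal.

Variables (k K : fieldType) (iota : {rmorphism k -> K}).

Definition reciprocal n (P : {poly k}) : {poly k} := \poly_(i < n.+1) P`_(n - i).

Lemma ev_coef x n (P : {poly k}) : (size P <= n)%N ->
  ev iota x P = \sum_(i < n) iota P`_i * x ^+ i.
Proof.
move=> leP; rewrite evE (@horner_coef_wide _ n) ?size_map_poly //.
by apply: eq_bigr => i _; rewrite coef_map.
Qed.

Lemma size_reciprocal n (P : {poly k}) : (size (reciprocal n P) <= n.+1)%N.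
Proof. exact: size_poly. Qed.

Lemma reciprocalK n (P : {poly k}) : (size P <= n.+1)%N -> reciprocal n (reciprocal n P) = P.
Proof.
move=> leP; apply/polyP => i; rewrite coef_poly; case: ltnP => lein; last first.
  by rewrite nth_default // (leq_trans leP).
by rewrite coef_poly ltnS leq_subr subKn.
Qed.

Lemma reciprocal_eq0 n (P : {poly k}) : (size P <= n.+1)%N -> reciprocal n P = 0 -> P = 0.
Proof.
move=> leP P0; rewrite -(reciprocalK leP) P0.
by apply/polyP => i; rewrite coef_poly !coef0 if_same.
Qed.

Lemma ev_reciprocal x n (P : {poly k}) : x != 0 -> (size P <= n.+1)%N ->
  ev iota x P = x ^+ n * ev iota x^-1 (reciprocal n P).
Proof.
move=> nzx leP; rewrite (ev_coef x leP) (ev_coef x^-1 (size_reciprocal n P)).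
rewrite mulr_sumr [RHS](reindex_inj rev_ord_inj); apply: eq_bigr => i _ /=.
rewrite coef_poly ltn_subrL /= subSS subKn; last by rewrite -ltnS.
rewrite mulrCA; congr (_ * _); rewrite exprVn -expfB_cond ?(negPf nzx) //.
  by rewrite subKn // -ltnS.
by rewrite add0n leq_subr.
Qed.

End Reciprocal.

Section Genus.

Variables (k K : fieldType) (iota : {rmorphism k -> K}).
Variables (g : nat) (f : {poly k}).
Hypothesis nz2 : (2%:R : k) != 0.
Variables A B : {poly k}.
Hypothesis bezout : A * f + B * f^`() = 1.
Hypothesis size_f : (size f <= (g.+1).*2.+1)%N.
Hypothesis reciprocal_f : reciprocal (g.+1).*2 f = f.

(** Since f is reciprocal, (x, y) -> (1 / x, y / x^(g+1)) is an automorphism of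
    the curve. The places at which x has a pole are thus the places above 0 of
    the new coordinate. *)
Lemma hyperelliptic_infinity x y : hyperelliptic iota f x y ->
  hyperelliptic iota f x^-1 (y / x ^+ g.+1).
Proof.
move=> model; have [nzx nzy] := hyperelliptic_neq0 model.
have nzxn n : x ^+ n != 0 by rewrite expf_neq0.
split.
- have := ev_reciprocal iota nzx size_f; rewrite reciprocal_f => fE.
  rewrite expr_div_n (hyperelliptic_eq model) fE -exprM muln2 mulrAC mulfV ?mul1r //.
- move=> P Q; pose n := maxn (size P) (size Q).
  have leP : (size P <= n.+1)%N by rewrite leqW // leq_maxl.
  have leQ : (size Q <= n.+1)%N by rewrite leqW // leq_maxr.
  have nzxV : x^-1 != 0 by rewrite invr_eq0.
  rewrite (ev_reciprocal iota nzxV leP) (ev_reciprocal iota nzxV leQ) invrK => E0.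
  have [] := @hyperelliptic_free _ _ _ _ _ _ model ('X^(g.+1) * reciprocal n P) (reciprocal n Q).
    rewrite rmorphM rmorphXn /= evX -[RHS](mulr0 (x ^+ g.+1 * x ^+ n)) -E0 exprVn.
    by field; rewrite !nzxn.
  move=> /eqP; rewrite mulf_eq0 expf_eq0 polyX_eq0 andbF /= => /eqP.
  by move=> /(reciprocal_eq0 leP) -> /(reciprocal_eq0 leQ).
- move=> z; have [P [Q [D [nzD zD]]]] := hyperelliptic_frac model z.
  pose n := maxn (size D) (maxn (size P) (size Q)).
  have leD : (size D <= n.+1)%N by rewrite leqW // leq_maxl.
  have leP : (size P <= n.+1)%N by rewrite leqW // leq_max leq_maxl orbT.
  have leQ : (size Q <= n.+1)%N by rewrite leqW // leq_max leq_maxr orbT.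
  exists ('X^(g.+1) * reciprocal n P), (reciprocal n Q), ('X^(g.+1) * reciprocal n D).
  split.
    rewrite mulf_neq0 ?expf_neq0 ?polyX_eq0 //.
    by apply: contra_neq nzD; apply: reciprocal_eq0.
  move: zD; rewrite !(ev_reciprocal iota nzx leD, ev_reciprocal iota nzx leP,
    ev_reciprocal iota nzx leQ) => zD.
  rewrite !rmorphM !rmorphXn /= evX exprVn.
  apply: (mulfI (nzxn (n + g.+1)%N)); rewrite exprD.
  transitivity (z * (x ^+ n * ev iota x^-1 (reciprocal n D))); first by field; rewrite nzxn.
  by rewrite zD; field; rewrite nzxn.
Qed.

Definition monomial_differential (x y : K) (i : nat) : differential iota :=
  fun Delta => x ^+ i / y * Delta x.

(** From A f + B f' = 1 and 2 y dy = f' dx follows dx / y = A y dx + 2 B dy,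
    without denominators. *)
Lemma monomial_differential_affine x y i O : hyperelliptic iota f x y ->
  is_place iota O -> O x -> regular_at O (monomial_differential x y i).
Proof.
move=> model pO Ox; have [_ nzy] := hyperelliptic_neq0 model.
have RO := place_coord_ring model pO Ox.
have Oy : O y by apply: RO; apply: coord_ring_y.
have Oe P : O (ev iota x P) by apply: place_ev.
have Oxi : O (x ^+ i) by apply: (placeX pO).
pose u := x ^+ i * (ev iota x A * y).
pose v := x ^+ i * (2%:R * ev iota x B).
exists [:: (u, x); (v, y)]; split.
  move=> uv; rewrite !inE => /orP[] /eqP -> /=; split=> //.
    by do 2!apply: (placeM pO) => //.
  apply: (placeM pO) => //; apply: (placeM pO) => //.
  by rewrite -(rmorph_nat iota); apply: (place_const pO).
move=> Delta; rewrite !big_cons big_nil addr0 /= /monomial_differential /u /v.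
apply: (mulfI nzy).
have dy := derivation_y model Delta.
have yy := hyperelliptic_eq model.
have := congr1 (ev iota x) bezout; rewrite !(rmorphD, rmorphM) rmorph1 /= => bz.
transitivity (x ^+ i * Delta x); first by field.
transitivity (x ^+ i * (ev iota x A * y ^+ 2 * Delta x
   + ev iota x B * (2%:R * y * Delta y))); last by ring.
rewrite dy yy -[in LHS](mul1r (Delta x)) -bz.
by ring.
Qed.

(** With exponent g - 1 - i at infinity, exactly the i < g give differentials
    that are regular there too. *)
Lemma monomial_differential_infinity x y i Delta : x != 0 -> y != 0 -> (i < g)%N ->
  monomial_differential x y i Delta
    = - monomial_differential x^-1 (y / x ^+ g.+1) (g.-1 - i) Delta.
Proof.
move=> nzx nzy; rewrite /monomial_differential derivationV //.
case: g => // g' leig; rewrite /= exprVn -addn2.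
rewrite -{2}(subnK (leig : (i <= g')%N)) !exprD.
have := expf_neq0 (g' - i) nzx; move: (x ^+ (g' - i)) => X nzX.
have := expf_neq0 i nzx; move: (x ^+ i) => Y nzY.
by field; rewrite ?nzX ?nzY ?nzy ?nzx.
Qed.

(** A holomorphic differential is h dx / y with h its value on y d/dx.
    Regularity over the affine curve gives h = P + Q y with P and Q in k[x]. In
    the chart x' = 1 / x, y' = y / x^(g+1) one has dx / y = - x'^(g-1) dx' / y',
    so that x'^(g-1) h is also of the form P' + Q' y' with P' and Q' in k[x'];
    comparing degrees, Q = 0 and P has degree less than g. *)
Lemma hyperelliptic_genus x y : hyperelliptic iota f x y -> has_genus iota g.
Proof.
move=> model; have [nzx nzy] := hyperelliptic_neq0 model.
have model' := hyperelliptic_infinity model.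
set x' := x^-1 in model'; set y' := y / _ in model'.
have nzx' : x' != 0 by rewrite invr_eq0.
pose D2 := dual_derivation model nz2; pose D2' := dual_derivation model' nz2.
exists (fun i : 'I_g => monomial_differential x y i); split=> [i|om [[s omE] om_reg]].
  split=> [|O pO].
    exists [:: (x ^+ i / y, x)] => Delta.
    by rewrite big_cons big_nil addr0.
  have [Ox|Ox'] := place_val pO x; first exact: monomial_differential_affine.
  have [t [tO tE]] := monomial_differential_affine (g.-1 - i) model' pO Ox'.
  exists [seq (- uv.1, uv.2) | uv <- t]; split.
    move=> uv /mapP[uv' /tO[Ou Ov] ->]; split=> //.
    exact: (placeN pO).
  move=> Delta; rewrite monomial_differential_infinity // tE big_map -sumrN.
  by apply: eq_bigr => uv _; rewrite mulNr.
have omD2 Delta : om Delta = Delta x / y * om D2.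
  rewrite !omE mulr_sumr; apply: eq_bigr => uv _.
  by rewrite (derivation_dual model nz2 Delta) mulrCA.
have [P [Q hE]] : coord_ring iota x y (om D2).
  by apply: (regular_affine model nz2 bezout) => O pO _; apply: om_reg.
have [P' [Q' hE']] : coord_ring iota x' y' (om D2').
  by apply: (regular_affine model' nz2 bezout) => O pO _; apply: om_reg.
pose n := maxn (size P') (size Q').
have leP' : (size P' <= n.+1)%N by rewrite leqW // leq_maxl.
have leQ' : (size Q' <= n.+1)%N by rewrite leqW // leq_maxr.
have D2x : D2' x = - y' * x ^+ 2.
  have -> : D2' x = D2' x'^-1 by rewrite invrK.
  by rewrite (derivationV D2') // (dual_derivation_x model') exprVn invrK.
have [PE QE] : P * 'X^(n.+2) = - reciprocal n P' * 'X^(g.+1) /\ Q * 'X^(n.+2) = - reciprocal n Q'.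
  have [] := @hyperelliptic_free _ _ _ _ _ _ model
    (P * 'X^(n.+2) + reciprocal n P' * 'X^(g.+1)) (Q * 'X^(n.+2) + reciprocal n Q').
    rewrite !(rmorphD, rmorphM, rmorphXn) /= evX.
    have := hE'; rewrite omD2 D2x.
    rewrite (ev_reciprocal iota nzx' leP') (ev_reciprocal iota nzx' leQ') invrK hE.
    rewrite /x' /y' exprVn => E.
    transitivity (- x ^+ n.+2 * x ^+ g * x^-1 *
        (- (y / x ^+ g.+1) * x ^+ 2 / y * (ev iota x P + ev iota x Q * y)
         - ((x ^+ n)^-1 * ev iota x (reciprocal n P')
            + (x ^+ n)^-1 * ev iota x (reciprocal n Q') * (y / x ^+ g.+1)))).
      rewrite -[n.+2]addn2 -[g.+1]addn1 !exprD.
      have := expf_neq0 n nzx; move: (x ^+ n) => X nzX.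
      have := expf_neq0 g nzx; move: (x ^+ g) => Y nzY.
      by field; rewrite nzX nzY nzx nzy.
    by rewrite E subrr mulr0.
  by rewrite mulNr => /eqP; rewrite addr_eq0 => /eqP -> /eqP; rewrite addr_eq0 => /eqP ->.
have Q0 : Q = 0.
  apply/eqP/negPn/negP => nzQ; have := congr1 (fun S : {poly k} => size S) QE.
  rewrite size_mulXn // size_polyN => sQ; have := size_reciprocal n Q'.
  by rewrite -sQ addnC; apply/negP; rewrite -ltnNge !addnS !ltnS leq_addl.
have leP : (size P <= g)%N.
  have [->|nzP] := eqVneq P 0; first by rewrite size_poly0.
  have := congr1 (fun S : {poly k} => size S) PE.
  rewrite size_mulXn // mulNr size_polyN => sP.
  have : (size (reciprocal n P' * 'X^(g.+1))%R <= n.+1 + g.+1)%N.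
    apply: leq_trans (size_polyMleq _ _) _.
    by rewrite size_polyXn addnS /= leq_add2r size_reciprocal.
  by rewrite -sP !addSn !addnS !ltnS leq_add2l.
exists (\row_i P`_i); split.
  move=> Delta; rewrite omD2 hE Q0 rmorph0 mul0r addr0 (ev_coef iota x leP) mulr_sumr.
  apply: eq_bigr => i _; rewrite mxE /monomial_differential; ring.
move=> c cE; apply/rowP => i; rewrite mxE.
have := cE D2; rewrite hE Q0 rmorph0 mul0r addr0.
have -> : \sum_i0 iota (c 0 i0) * monomial_differential x y i0 D2
    = ev iota x (\poly_(j < g) (if insub j is Some j' then c 0 j' else 0)).
  rewrite (ev_coef iota x (size_poly _ _)); apply: eq_bigr => j _.
  rewrite coef_poly ltn_ord valK /monomial_differential.
  by rewrite (dual_derivation_x model nz2 : D2 x = y) divfK.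
move=> /eqP; rewrite -subr_eq0 -rmorphB (ev_eq0 model) subr_eq0 => /eqP ->.
by rewrite coef_poly ltn_ord valK.
Qed.

End Genus.

(** * Rational places and rational points *)

Section PointPlaces.

Variables (k K : fieldType) (iota : {rmorphism k -> K}).
Variables (f : {poly k}) (x y : K).
Hypothesis model : hyperelliptic iota f x y.
Hypothesis nz2 : (2%:R : k) != 0.
Variables A B : {poly k}.
Hypothesis bezout : A * f + B * f^`() = 1.

Local Notation e := (ev iota x).
Local Notation R := (coord_ring iota x y).

Let yy : y * y = e f.
Proof. by rewrite -expr2 (hyperelliptic_eq model). Qed.

Lemma maximal_local_ring m u v : prime_ideal iota x y m -> m u -> R v -> ~ m v ->
  maximal_ideal (local_ring iota x y m) (u / v).
Proof.
move=> pm mu Rv mv; have Ru := prime_ideal_sub pm mu.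
have nzv := compl_prime_neq0 pm mv.
split; first by exists u, v.
rewrite mulf_eq0 invr_eq0 (negPf nzv) orbF => nzu [a [b [Ra Rb mb abE]]].
have nzb := compl_prime_neq0 pm mb.
have : m (v * b).
  have -> : v * b = a * u.
    apply: (mulIf (_ : (u * b)^-1 != 0)); first by rewrite invr_eq0 mulf_neq0.
    transitivity (u / v)^-1; first by field; rewrite nzu nzv nzb.
    by rewrite abE; field; rewrite nzu nzb.
  exact: (prime_idealM pm).
exact: (prime_ideal_compl pm).
Qed.

Definition point_ideal (a b : k) : set K :=
  [set u | exists P Q, u = e P + e Q * y /\ P.[a] + Q.[a] * b = 0]%classic.

Section Point.

Variables a b : k.
Hypothesis abE : b ^+ 2 = f.[a].

(** This is the kernel of the evaluation P + Q y -> P(a) + Q(a) b, a ring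
    morphism because (a, b) is on the curve. *)
Lemma point_ideal_prime : prime_ideal iota x y (point_ideal a b).
Proof.
have uniq P Q P1 Q1 : e P + e Q * y = e P1 + e Q1 * y -> P = P1 /\ Q = Q1.
  move=> E; have [] := @hyperelliptic_free _ _ _ _ _ _ model (P - P1) (Q - Q1).
    by rewrite !rmorphB mulrBl; apply/eqP; rewrite addrACA -opprD E subrr.
  by move=> /subr0_eq -> /subr0_eq ->.
have mulE P Q P1 Q1 : (e P + e Q * y) * (e P1 + e Q1 * y)
    = e (P * P1 + Q * Q1 * f) + e (P * Q1 + Q * P1) * y.
  by rewrite !(rmorphD, rmorphM) /= ?(rmorphD, rmorphM) /= -yy; ring.
have valM P Q P1 Q1 : (P * P1 + Q * Q1 * f).[a] + (P * Q1 + Q * P1).[a] * b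
    = (P.[a] + Q.[a] * b) * (P1.[a] + Q1.[a] * b).
  by rewrite !(hornerD, hornerM) -abE; ring.
split.
- by move=> _ [P [Q [-> _]]]; exists P, Q.
- move=> _ _ [P [Q [-> E]]] [P1 [Q1 [-> E1]]]; exists (P - P1), (Q - Q1); split.
    by rewrite !rmorphB; ring.
  rewrite !hornerD !hornerN -[RHS](subrr 0) -{1}E -E1; ring.
- move=> _ _ [P [Q ->]] [P1 [Q1 [-> E1]]].
  by do 2!eexists; split; [exact: mulE | rewrite valM E1 mulr0].
- move=> [P [Q [E1]]].
  have [] := uniq 1 0 P Q; first by rewrite rmorph0 mul0r addr0 rmorph1.
  move=> <- <-; rewrite hornerC horner0 mul0r addr0 => /eqP.
  by rewrite oner_eq0.
- move=> _ _ [P [Q ->]] [P1 [Q1 ->]]; rewrite mulE => -[P2 [Q2 [/uniq[<- <-]]]].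
  rewrite valM => /eqP; rewrite mulf_eq0 => /orP[] /eqP E.
    by left; exists P, Q.
  by right; exists P1, Q1.
- exists (e ('X - a%:P)); last by rewrite (ev_eq0 model) polyXsubC_eq0.
  exists ('X - a%:P), 0; split; first by rewrite rmorph0 mul0r addr0.
  by rewrite !hornerE; ring.
Qed.

Definition point_place : set K := local_ring iota x y (point_ideal a b).

Lemma point_place_place : is_place iota point_place.
Proof. exact: (local_ring_place model nz2 bezout point_ideal_prime). Qed.

Lemma point_ideal_maximal u : point_ideal a b u -> maximal_ideal point_place u.
Proof.
move=> mu; rewrite -[u]divr1; apply: maximal_local_ring => //.
- exact: point_ideal_prime.
- exact: coord_ring1.
- exact: prime_ideal1 point_ideal_prime.
Qed.

Lemma point_place_x : maximal_ideal point_place (x - iota a).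
Proof.
apply: point_ideal_maximal; exists ('X - a%:P), 0; split.
  by rewrite rmorphB /= evX evC rmorph0 mul0r addr0.
by rewrite !hornerE; ring.
Qed.

Lemma point_place_y : maximal_ideal point_place (y - iota b).
Proof.
apply: point_ideal_maximal; exists (- b%:P), 1; split.
  by rewrite rmorphN /= evC rmorph1 mul1r addrC.
by rewrite !hornerE; ring.
Qed.

Lemma point_place_rational : rational_places iota point_place.
Proof.
split=> [|_ [_ [_ [[P [Q ->]] [P1 [Q1 ->]] mv ->]]]]; first exact: point_place_place.
set u := e P + e Q * y; set v := e P1 + e Q1 * y in mv *.
have nzv := compl_prime_neq0 point_ideal_prime mv.
have nzval : P1.[a] + Q1.[a] * b != 0.
  by apply/eqP => E; apply: mv; exists P1, Q1.
have [c cE] : exists c, c * (P1.[a] + Q1.[a] * b) = P.[a] + Q.[a] * b.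
  by exists ((P.[a] + Q.[a] * b) / (P1.[a] + Q1.[a] * b)); rewrite divfK.
exists c.
have -> : u / v - iota c = (u - iota c * v) / v by rewrite mulrBl mulfK.
apply: maximal_local_ring => //; [exact: point_ideal_prime| |by exists P1, Q1].
exists (P - c%:P * P1), (Q - c%:P * Q1); split.
  by rewrite !rmorphB !rmorphM /= evC /u /v; ring.
rewrite !(hornerD, hornerN, hornerM, hornerC).
transitivity (P.[a] + Q.[a] * b - c * (P1.[a] + Q1.[a] * b)); first by ring.
by rewrite cE subrr.
Qed.

End Point.

Lemma maximal_ideal_ev O P a : is_place iota O -> maximal_ideal O (x - iota a) ->
  maximal_ideal O (e P - iota P.[a]).
Proof.
move=> pO ma; have Ox : O x.
  by rewrite -[x](subrK (iota a)); apply: (placeD pO); [case: ma | apply: (place_const pO)].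
elim/poly_ind: P => [|P c IH]; first by rewrite horner0 !rmorph0 subr0; apply: (maximal_ideal0 pO).
rewrite !hornerE !(rmorphD, rmorphM) /= evX evC.
have -> : e P * x + iota c - (iota P.[a] * iota a + iota c)
    = x * (e P - iota P.[a]) + iota P.[a] * (x - iota a) by ring.
by apply: (maximal_idealD pO); apply: (maximal_idealM pO) => //; apply: (place_const pO).
Qed.

(** The residues a of x and b of y determine the residue of P + Q y, hence the
    center of O, hence O. *)
Lemma place_eq_point O a b : is_place iota O ->
  maximal_ideal O (x - iota a) -> maximal_ideal O (y - iota b) ->
  b ^+ 2 = f.[a] /\ O = point_place a b.
Proof.
move=> pO ma mb.
have Oc c : O (iota c) by apply: (place_const pO).
have Ox : O x.
  by rewrite -[x](subrK (iota a)); apply: (placeD pO) => //; case: ma.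
have Oy : O y.
  by rewrite -[y](subrK (iota b)); apply: (placeD pO) => //; case: mb.
have Oe P : O (e P) by exact: place_ev.
have valP P Q : maximal_ideal O (e P + e Q * y - iota (P.[a] + Q.[a] * b)).
  rewrite rmorphD rmorphM /=.
  have -> : e P + e Q * y - (iota P.[a] + iota Q.[a] * iota b)
     = (e P - iota P.[a]) + (e Q * (y - iota b) + iota b * (e Q - iota Q.[a])) by ring.
  apply: (maximal_idealD pO); first exact: maximal_ideal_ev.
  apply: (maximal_idealD pO); apply: (maximal_idealM pO) => //.
  exact: maximal_ideal_ev.
have centerE u : center iota x y O u <-> point_ideal a b u.
  split=> [[[P [Q uE]] mu]|[P [Q [-> E]]]].
    exists P, Q; split=> //; apply: (maximal_ideal_const pO).
    have -> : iota (P.[a] + Q.[a] * b) = u - (u - iota (P.[a] + Q.[a] * b)) by ring.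
    by apply: (maximal_idealB pO) => //; rewrite {1}uE; apply: valP.
  split; first by exists P, Q.
  by have := valP P Q; rewrite E rmorph0 subr0.
split.
  apply: subr0_eq; apply: (maximal_ideal_const pO).
  have -> : iota (b ^+ 2 - f.[a])
      = (e f - iota f.[a]) + (- (y + iota b)) * (y - iota b).
    by rewrite rmorphB rmorphXn /= -yy; ring.
  apply: (maximal_idealD pO); first exact: maximal_ideal_ev.
  by apply: (maximal_idealM pO) => //; apply/(placeN pO)/(placeD pO).
rewrite /point_place {1}(place_local_ring model nz2 bezout pO Ox).
by congr (local_ring _ _ _ _); apply/seteqP; split=> u /centerE.
Qed.

Lemma point_place_inj a b a' b' : b ^+ 2 = f.[a] ->
  point_place a b = point_place a' b' -> b' ^+ 2 = f.[a'] -> (a, b) = (a', b').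
Proof.
move=> abE E abE'; have pO := point_place_place abE.
have max_eq z c c' : maximal_ideal (point_place a b) (z - iota c) ->
    maximal_ideal (point_place a b) (z - iota c') -> c = c'.
  move=> mc mc'; apply: subr0_eq; apply: (maximal_ideal_const pO).
  have -> : iota (c - c') = (z - iota c') - (z - iota c) by rewrite rmorphB; ring.
  exact: (maximal_idealB pO).
congr (_, _).
  by apply: max_eq (point_place_x abE) _; rewrite E; apply: point_place_x.
by apply: max_eq (point_place_y abE) _; rewrite E; apply: point_place_y.
Qed.

End PointPlaces.

Section CountPlaces.

Variables (k : finFieldType) (K : fieldType) (iota : {rmorphism k -> K}).
Variables (g : nat) (f : {poly k}).
Hypothesis nz2 : (2%:R : k) != 0.
Variables A B : {poly k}.
Hypothesis bezout : A * f + B * f^`() = 1.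
Hypothesis size_f : (size f <= (g.+1).*2.+1)%N.
Hypothesis reciprocal_f : reciprocal (g.+1).*2 f = f.

Lemma card_eq_ord (T : finType) (U : Type) (X : set U) (h : T -> U) :
  injective h -> (forall u, X u <-> exists t, h t = u) ->
  (X #= `I_#|T|)%card.
Proof.
move=> h_inj XE; have -> : X = ((h \o enum_val) @` [set: 'I_#|T|])%classic.
  apply/seteqP; split=> [u /XE[t <-]|u [i _ <-]].
    by exists (enum_rank t) => //=; rewrite enum_rankK.
  by apply/XE; exists (enum_val i).
apply: card_eq_trans (card_esym card_II); apply: inj_card_eq => i j _ _ /=.
by move=> /h_inj; apply: enum_val_inj.
Qed.

(** The places at which x has a pole correspond to the points above 0 of the
    chart at infinity, given by the square roots of f(0) because f is
    reciprocal. *)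
Theorem card_rational_places x y : hyperelliptic iota f x y ->
  (rational_places iota #= `I_(#|[pred ab : k * k | ab.2 ^+ 2 == f.[ab.1]]|
     + #|[pred b : k | b ^+ 2 == f.[0]]|)%N)%card.
Proof.
move=> model; have [nzx nzy] := hyperelliptic_neq0 model.
have model' := hyperelliptic_infinity size_f reciprocal_f model.
set x' := x^-1 in model'; set y' := y / _ in model'.
pose T : finType := ({ab : k * k | ab.2 ^+ 2 == f.[ab.1]} + {b : k | b ^+ 2 == f.[0]})%type.
rewrite (_ : (_ + _)%N = #|T|); last by rewrite card_sum !card_sig.
pose h (t : T) : set K :=
  match t with
  | inl ab => point_place iota x y (sval ab).1 (sval ab).2
  | inr b => point_place iota x' y' 0 (sval b)
  end.
have fin_x a b : b ^+ 2 = f.[a] -> point_place iota x y a b x.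
  move=> abE; rewrite -[x in X in _ X](subrK (iota a)).
  apply: (placeD (point_place_place model nz2 bezout abE)).
    by case: (point_place_x model abE).
  exact: (place_const (point_place_place model nz2 bezout abE)).
have inf_x b : b ^+ 2 = f.[0] -> ~ point_place iota x' y' 0 b x.
  move=> bE; have [_] := point_place_x model' bE.
  by rewrite rmorph0 subr0 /x' invrK invr_eq0 => /(_ nzx).
apply: (@card_eq_ord _ _ _ h).
  move=> t1 t2; case: t1 => [[[a b] abE]|[b bE]]; case: t2 => [[[a' b'] abE']|[b' bE']];
    rewrite /=.
  - move=> E; congr inl; apply: val_inj => /=.
    by apply: (point_place_inj model nz2 bezout) E _; apply/eqP.
  - by move=> E; case: (inf_x b'); [apply/eqP|rewrite -E; apply: fin_x; apply/eqP].
  - by move=> E; case: (inf_x b); [apply/eqP|rewrite E; apply: fin_x; apply/eqP].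
  - move=> E; congr inr; apply: val_inj => /=.
    by case: (point_place_inj model' nz2 bezout (eqP bE) E (eqP bE')).
move=> O; split; last first.
  move=> [[[[a b] /= /eqP abE]|[b /= /eqP bE]] <-] /=.
    exact: (point_place_rational model nz2 bezout).
  exact: (point_place_rational model' nz2 bezout).
move=> [pO resO].
have [Ox|nOx] := pselect (O x).
  have Oy : O y by apply: (place_coord_ring model pO Ox); apply: coord_ring_y.
  have [a ma] := resO _ Ox; have [b mb] := resO _ Oy.
  have [/eqP abE ->] := place_eq_point model nz2 bezout pO ma mb.
  by exists (inl (exist _ (a, b) abE)).
have Ox' : O x' by case: (place_val pO x).
have Oy' : O y' by apply: (place_coord_ring model' pO Ox'); apply: coord_ring_y.
have [b mb] := resO _ Oy'.
have ma : maximal_ideal O (x' - iota 0).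
  by rewrite rmorph0 subr0; split=> // _; rewrite invrK.
have [/eqP bE ->] := place_eq_point model' nz2 bezout pO ma mb.
by exists (inr (exist _ b bE)).
Qed.

End CountPlaces.

(** * The plane equation *)

Section SwapXY.

Variable k : fieldType.

Lemma swapXYM (G H : {poly {poly k}}) : swapXY (G * H) = swapXY G * swapXY H.
Proof. exact: (swapXY_is_monoid_morphism k).2. Qed.

Lemma swapXYB (G H : {poly {poly k}}) : swapXY (G - H) = swapXY G - swapXY H.
Proof. exact: swapXY_is_zmod_morphism. Qed.

Lemma swapXYD (G H : {poly {poly k}}) : swapXY (G + H) = swapXY G + swapXY H.
Proof. by apply/eqP; rewrite -subr_eq -swapXYB addrK. Qed.

Lemma swapXY1 : swapXY (1 : {poly {poly k}}) = 1.
Proof. exact: (swapXY_is_monoid_morphism k).1. Qed.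

End SwapXY.

Section FunctionFieldModel.

Variables (k K : fieldType) (iota : {rmorphism k -> K}).

Lemma ev2D (G H : {poly {poly k}}) x y :
  (map_poly2 iota (G + H)).[x, y]
    = (map_poly2 iota G).[x, y] + (map_poly2 iota H).[x, y].
Proof. by rewrite /map_poly2 rmorphD !hornerE. Qed.

Lemma ev2M (G H : {poly {poly k}}) x y :
  (map_poly2 iota (G * H)).[x, y]
    = (map_poly2 iota G).[x, y] * (map_poly2 iota H).[x, y].
Proof. by rewrite /map_poly2 rmorphM !hornerE. Qed.

Lemma ev2N (G : {poly {poly k}}) x y :
  (map_poly2 iota (- G)).[x, y] = - (map_poly2 iota G).[x, y].
Proof. by rewrite /map_poly2 rmorphN !hornerE. Qed.

Lemma ev2_inner (P : {poly k}) x y : (map_poly2 iota P%:P).[x, y] = ev iota y P.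
Proof. by rewrite /map_poly2 map_polyC hornerC. Qed.

Lemma ev2_outer (P : {poly k}) x y : (map_poly2 iota P^:P).[x, y] = ev iota x P.
Proof.
rewrite /map_poly2 -map_poly_comp.
have -> : map_poly (map_poly iota \o polyC) P = (map_poly iota P)^:P.
  by rewrite -map_poly_comp; apply: eq_map_poly => c; rewrite /= map_polyC.
by rewrite horner_map hornerC.
Qed.

Lemma ev2X x y : (map_poly2 iota 'X).[x, y] = x.
Proof. by rewrite /map_poly2 map_polyX hornerX hornerC. Qed.

Lemma ev2Y x y : (map_poly2 iota 'Y).[x, y] = y.
Proof. by rewrite ev2_inner evX. Qed.

Variable f : {poly k}.

Definition double_cover : {poly {poly k}} := 'Y ^+ 2 - f^:P.

Lemma swap_double_cover : swapXY double_cover = 'X^2 - f%:P.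
Proof.
by rewrite /double_cover swapXYB !expr2 swapXYM swapXY_Y swapXY_map_polyC.
Qed.

(** Modulo the equation, which is monic in Y, every polynomial in X and Y
    reduces to a unique P + Q Y; a denominator of this form is cleared by its
    conjugate. *)
Lemma function_field_hyperelliptic x y :
  is_function_field iota double_cover x y -> hyperelliptic iota f x y.
Proof.
move=> [kerE fracE].
have yy : y * y = ev iota x f.
  have /kerE : exists Q, double_cover = Q * double_cover by exists 1; rewrite mul1r.
  rewrite /double_cover ev2D ev2N ev2_outer expr2 ev2M ev2Y => /eqP.
  by rewrite subr_eq0 => /eqP.
have free P Q : ev iota x P + ev iota x Q * y = 0 -> P = 0 /\ Q = 0.
  move=> E; have /kerE[S SE] : (map_poly2 iota (P^:P + Q^:P * 'Y)).[x, y] = 0.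
    by rewrite ev2D ev2M !ev2_outer ev2Y.
  have {SE} := congr1 (@swapXY _) SE.
  rewrite swapXYD !swapXYM !swapXY_map_polyC swapXY_Y swap_double_cover => SE.
  have S0 : swapXY S = 0.
    apply/eqP/negPn/negP => nzS.
    have monicC : ('X^2 - f%:P : {poly {poly k}}) \is monic.
      exact: monicXnsubC.
    have := congr1 (fun T : {poly {poly k}} => size T) SE.
    rewrite size_Mmonic // size_XnsubC // addnS /= => sE.
    have : (size (P%:P + Q%:P * 'X : {poly {poly k}})%R <= 2)%N.
      rewrite (leq_trans (size_polyD _ _)) // geq_max.
      by rewrite (leq_trans (size_polyC_leq1 _)) //= mul_polyC (leq_trans (size_scale_leq _ _)) ?size_polyX.
    by rewrite sE addn2 !ltnS leqNgt size_poly_gt0 nzS.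
  rewrite S0 mul0r in SE.
  have := congr1 (fun T : {poly {poly k}} => T`_0) SE.
  have := congr1 (fun T : {poly {poly k}} => T`_1) SE.
  by rewrite !coefD !coefMX !coefC /= add0r addr0.
split=> //.
have polyE (H : {poly {poly k}}) : exists P Q,
    (map_poly2 iota H).[x, y] = ev iota x P + ev iota x Q * y.
  have innerE (c : {poly k}) : exists P Q, ev iota y c = ev iota x P + ev iota x Q * y.
    elim/poly_ind: c => [|c d [P [Q IH]]].
      by exists 0, 0; rewrite !rmorph0 mul0r addr0.
    exists (Q * f + d%:P), P; rewrite !(rmorphD, rmorphM) /= evX !evC IH -yy.
    by ring.
  elim/poly_ind: H => [|H c [P [Q IH]]].
    by exists 0, 0; rewrite /map_poly2 rmorph0 !horner0 !rmorph0 mul0r addr0.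
  have [P1 [Q1 cE]] := innerE c.
  exists (P * 'X + P1), (Q * 'X + Q1).
  by rewrite ev2D ev2M IH ev2X ev2_inner cE !(rmorphD, rmorphM) /= evX; ring.
move=> z; have [S [T [nzT ->]]] := fracE z.
have [P [Q ->]] := polyE S; move: nzT; have [P1 [Q1 ->]] := polyE T => nzT.
have normE : (ev iota x P1 + ev iota x Q1 * y) * (ev iota x P1 - ev iota x Q1 * y)
    = ev iota x (P1 * P1 - Q1 * Q1 * f).
  by rewrite rmorphB !rmorphM /= -yy; ring.
exists (P * P1 - Q * Q1 * f), (Q * P1 - P * Q1), (P1 * P1 - Q1 * Q1 * f); split.
  apply: contra_neq nzT => D0; move/eqP: normE; rewrite D0 rmorph0 mulf_eq0.
  move=> /orP[/eqP //|/eqP E].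
  have [] := free P1 (- Q1); first by rewrite rmorphN mulNr.
  by move=> -> /eqP; rewrite oppr_eq0 => /eqP ->; rewrite !rmorph0 mul0r addr0.
rewrite -normE mulrA divfK // !rmorphB !rmorphM /= -yy; ring.
Qed.

End FunctionFieldModel.

Section Irreducibility.

(** The equation is monic of degree 2 in Y, so that a proper factorisation has
    two factors linear in Y and makes f the square of a polynomial. A squarefree
    polynomial of positive degree is not a square. *)
Lemma double_cover_irreducible (L : fieldType) (f A B : {poly L}) :
  (1 < size f)%N -> A * f + B * f^`() = 1 ->
  [/\ double_cover f != 0, double_cover f \isn't a GRing.unit
    & forall S T : {poly {poly L}}, double_cover f = S * T ->
        S \is a GRing.unit \/ T \is a GRing.unit].
Proof.
move=> ltf bezout.
have szC : size ('X^2 - f%:P : {poly {poly L}}) = 3.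
  exact: size_XnsubC.
have monicC : ('X^2 - f%:P : {poly {poly L}}) \is monic.
  exact: monicXnsubC.
have unit_swap (S : {poly {poly L}}) : swapXY S \is a GRing.unit -> S \is a GRing.unit.
  move=> /unitrPr[V SV]; apply/unitrPr; exists (swapXY V).
  by rewrite -{1}[S]swapXYK -swapXYM SV swapXY1.
have not_square r : r ^+ 2 <> f.
  move=> fE; have : r %| 1.
    rewrite -bezout -fE dvdp_add // dvdp_mull //; first by rewrite expr2 dvdp_mulIl.
    by rewrite expr2 derivM dvdp_add // ?dvdp_mulIl ?dvdp_mulIr.
  rewrite dvdp1 => /eqP szr; move: ltf.
  by rewrite -fE expr2 size_mul ?szr // -size_poly_eq0 szr.
split.
- by rewrite -swapXY_eq0 swap_double_cover -size_poly_eq0 szC.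
- apply/negP => uC; have : swapXY (double_cover f) \is a GRing.unit.
    by apply: unit_swap; rewrite swapXYK.
  by rewrite swap_double_cover poly_unitE szC.
move=> S0 T0 STE.
have {STE} := congr1 (@swapXY _) STE; rewrite swap_double_cover swapXYM.
move: (unit_swap S0) (unit_swap T0).
move: (swapXY S0) (swapXY T0) => S T uS uT STE.
have nzST : S * T != 0 by rewrite -STE -size_poly_eq0 szC.
have /andP[nzS nzT] : (S != 0) && (T != 0) by rewrite -negb_or -mulf_eq0.
have lcE : lead_coef S * lead_coef T = 1.
  by rewrite -lead_coefM -STE; apply/eqP; rewrite -monicE.
have ulS : lead_coef S \is a GRing.unit by apply/unitrPr; exists (lead_coef T).
have ulT : lead_coef T \is a GRing.unit by apply/unitrPr; exists (lead_coef S); rewrite mulrC.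
have szE : (size S + size T)%N = 4.
  have := size_mul nzS nzT; rewrite -STE szC; move: nzS; rewrite -size_poly_gt0.
  by case: (size S) => // s _; rewrite !addSn /= => <-.
have const_unit (V : {poly {poly L}}) : size V = 1%N -> lead_coef V \is a GRing.unit ->
    V \is a GRing.unit.
  by move=> sV uV; rewrite poly_unitE sV eqxx /=; move: uV; rewrite lead_coefE sV.
have [sS|nS1] := eqVneq (size S) 1%N; first by left; apply: uS; apply: const_unit.
have [sT|nT1] := eqVneq (size T) 1%N; first by right; apply: uT; apply: const_unit.
have sS : size S = 2%N.
  move: nzS nzT szE nS1 nT1; rewrite -!size_poly_gt0.
  by case: (size S) => [|[|[|s]]] //; case: (size T) => [|[|b]] //= _ _; rewrite !addnS.
have rootS : S.[- S`_0 / S`_1] = 0.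
  rewrite horner_coef sS !big_ord_recl big_ord0 /= expr0 expr1 addr0 mulr1.
  have uS1 : S`_1 \is a GRing.unit by move: ulS; rewrite lead_coefE sS.
  by rewrite mulrCA mulrV // mulr1 addrN.
have := congr1 (fun V : {poly {poly L}} => V.[- S`_0 / S`_1]) STE.
rewrite hornerM rootS mul0r !hornerE => /eqP; rewrite subr_eq0 => /eqP.
by move/not_square.
Qed.

End Irreducibility.

Definition curve_poly (k : fieldType) (a : k) : {poly k} :=
  Poly [:: 1; 0; - a; 0; - 33%:R; 0; 2%:R * a; 0; - 33%:R; 0; - a; 0; 1].

Lemma curve_polyE (k : fieldType) (a : k) : curve_poly a =
  'X ^+ 12 - a%:P * 'X ^+ 10 - 33%:R * 'X ^+ 8 + 2%:R * a%:P * 'X ^+ 6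
  - 33%:R * 'X ^+ 4 - a%:P * 'X ^+ 2 + 1.
Proof.
rewrite /curve_poly /= !cons_poly_def !(polyCN, polyCM, polyC0, polyC1, polyC_natr) mul0r.
by ring.
Qed.

Lemma C_double_cover (k : fieldType) (a : k) : C_ a = double_cover (curve_poly a).
Proof.
have liftD (P Q : {poly k}) : (P + Q)^:P = P^:P + Q^:P by apply: rmorphD.
have liftN (P : {poly k}) : (- P)^:P = - P^:P by apply: rmorphN.
have liftM (P Q : {poly k}) : (P * Q)^:P = P^:P * Q^:P by apply: rmorphM.
have liftX n : ('X ^+ n : {poly k})^:P = 'X ^+ n by apply: map_polyXn.
have liftC (c : k) : (c%:P)^:P = c%:P%:P by apply: map_polyC.
have lift1 : (1 : {poly k})^:P = 1 by apply: rmorph1.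
have liftn n : (n%:R : {poly k})^:P = n%:R by apply: rmorph_nat.
rewrite /C_ /double_cover curve_polyE; congr (_ - _).
by rewrite !(liftX, liftC, lift1, liftn, liftD, liftN, liftM).
Qed.

Lemma map_curve_poly (k L : fieldType) (j : {rmorphism k -> L}) a :
  map_poly j (curve_poly a) = curve_poly (j a).
Proof.
apply/polyP => i; rewrite coef_map !coef_Poly.
by do 13!(case: i => [|i] /=;
  first by rewrite ?(rmorphN, rmorphM, rmorph_nat, rmorph0, rmorph1)); rewrite !nth_nil rmorph0.
Qed.

Lemma map_double_cover (k L : fieldType) (j : {rmorphism k -> L}) f :
  map_poly2 j (double_cover f) = double_cover (map_poly j f).
Proof.
rewrite /map_poly2 /double_cover rmorphB /= rmorphXn /= map_polyC /= map_polyX; congr (_ - _).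
by rewrite -!map_poly_comp; apply: eq_map_poly => c; rewrite /= map_polyC.
Qed.

Lemma map_C_ (k L : fieldType) (j : {rmorphism k -> L}) a :
  map_poly2 j (C_ a) = C_ (j a).
Proof. by rewrite !C_double_cover map_double_cover map_curve_poly. Qed.

Lemma size_curve_poly (k : fieldType) (a : k) : size (curve_poly a) = 13.
Proof. by rewrite (@PolyK _ 0) //= oner_neq0. Qed.

Lemma reciprocal_curve_poly (k : fieldType) (a : k) : reciprocal 12 (curve_poly a) = curve_poly a.
Proof.
apply/polyP => i; rewrite coef_poly !coef_Poly.
by do 13!(case: i => [|i] //=); rewrite nth_nil.
Qed.

(** For G = s^3 - a s^2 - 36 s + 4 a, the Euclidean algorithm gives (2 a - 3 s)
    G + (s^2 - a s - 24) G' = 8 (a^2 + 108). With t = x^2, s = t + 1 / t and f =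
    t^3 G(s) this shows that the common divisors of f and f' divide 8 (a^2 +
    108) t^4 (t^2 - 1). Now f is congruent to -64 modulo t^2 - 1 and to 1 modulo
    t. *)
Lemma curve_poly_bezout (k : fieldType) (a : k) :
  (2%:R : k) != 0 -> a ^+ 2 + 108%:R != 0 ->
  exists A B, A * curve_poly a + B * (curve_poly a)^`() = 1.
Proof.
move=> nz2 nzd; set f := curve_poly a.
suff /Bezout_eq1_coprimepP[[A B] /= AB] : coprimep f f^`() by exists A, B.
apply/coprimepP => d df df'.
have dvd_const (c : k) P : c != 0 -> d %| c%:P * P -> d %| P.
  by move=> nzc; rewrite mul_polyC dvdpZr.
have two : 2%:R%:P = 2%:R :> {poly k} by apply: polyC_natr.
pose t : {poly k} := 'X ^+ 2.
pose delta : {poly k} := a%:P ^+ 2 + 108%:R.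
have deltaE : (a ^+ 2 + 108%:R)%:P = delta by rewrite polyCD polyC_exp polyC_natr.
have fE : f = t ^+ 6 - a%:P * t ^+ 5 - 33%:R * t ^+ 4 + 2%:R * a%:P * t ^+ 3
  - 33%:R * t ^+ 2 - a%:P * t + 1 by rewrite /f curve_polyE /t -!exprM.
have dfE : 'X * f^`() = 2%:R * (6%:R * t ^+ 6 - 5%:R * a%:P * t ^+ 5 - 132%:R * t ^+ 4
   + 6%:R * a%:P * t ^+ 3 - 66%:R * t ^+ 2 - a%:P * t).
  by rewrite /f curve_polyE /t !derivE; ring.
have {dfE}df' : d %| 6%:R * t ^+ 6 - 5%:R * a%:P * t ^+ 5 - 132%:R * t ^+ 4
   + 6%:R * a%:P * t ^+ 3 - 66%:R * t ^+ 2 - a%:P * t.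
  by apply: (dvd_const _ _ nz2); rewrite two -dfE dvdp_mull.
rewrite fE in df.
have dI : d %| 8%:R * delta * t ^+ 4 * (t ^+ 2 - 1).
  (* U / t and V / t^2 are the cofactors of G and G' at s = t + 1 / t. *)
  pose V := (t ^+ 2 + 1) ^+ 2 - a%:P * t * (t ^+ 2 + 1) - 24%:R * t ^+ 2.
  pose U := 2%:R * a%:P * t - 3%:R * (t ^+ 2 + 1).
  suff -> : 8%:R * delta * t ^+ 4 * (t ^+ 2 - 1) = ((t ^+ 2 - 1) * U - 3%:R * V) * (t ^+ 6
      - a%:P * t ^+ 5 - 33%:R * t ^+ 4 + 2%:R * a%:P * t ^+ 3
      - 33%:R * t ^+ 2 - a%:P * t + 1)
    + V * (6%:R * t ^+ 6 - 5%:R * a%:P * t ^+ 5 - 132%:R * t ^+ 4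
      + 6%:R * a%:P * t ^+ 3 - 66%:R * t ^+ 2 - a%:P * t).
    by rewrite dvdp_add // dvdp_mull.
  by rewrite /U /V /delta; ring.
have dX : d %| 'X^8.
  have -> : 'X^8 = t ^+ 4 by rewrite /t -exprM.
  have nz8 : (8%:R : k) != 0 by rewrite (natrX _ 2 3) expf_neq0.
  have nz64 : (64%:R : k) != 0 by rewrite (natrX _ 2 6) expf_neq0.
  apply: (dvd_const _ _ nzd); apply: (dvd_const _ _ nz8); apply: (dvd_const _ _ nz64).
  rewrite deltaE !polyC_natr.
  (* q is the quotient of f + 64 by t^2 - 1. *)
  pose q := t ^+ 4 - a%:P * t ^+ 3 - 32%:R * t ^+ 2 + a%:P * t - 65%:R.
  suff -> : 64%:R * (8%:R * (delta * t ^+ 4))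
    = q * (8%:R * delta * t ^+ 4 * (t ^+ 2 - 1))
      - 8%:R * delta * t ^+ 4 * (t ^+ 6
      - a%:P * t ^+ 5 - 33%:R * t ^+ 4 + 2%:R * a%:P * t ^+ 3
      - 33%:R * t ^+ 2 - a%:P * t + 1) by rewrite dvdp_sub // dvdp_mull.
  by rewrite /q; ring.
have : coprimep f 'X^8.
  apply: coprimep_expr; rewrite -['X]subr0 -polyC0 coprimep_XsubC.
  by rewrite /root horner_coef0 /f coef_Poly /= oner_eq0.
by rewrite -fE in df; move/coprimepP => /(_ d df dX).
Qed.

(** * Quadratic character sums and 2-isogenies *)

Section QuadraticCharacter.

Variable F : finFieldType.
Hypothesis nz2 : (2%:R : F) != 0.

Implicit Types (a b c e u w x : F) (phi : F -> int).

(** The quadratic character of F, with value 0 at 0. *)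
Definition chi a : int := #|[pred y : F | y ^+ 2 == a]|%:Z - 1.

Lemma chiE a : 1 + chi a = \sum_y (y ^+ 2 == a)%:R.
Proof.
rewrite addrC subrK -natz -sum1_card natr_sum big_mkcond /=.
by apply: eq_bigr => y _; rewrite inE; case: eqP.
Qed.

Lemma chi0 : chi 0 = 0.
Proof.
rewrite /chi (_ : #|_| = 1%N) ?subrr //; apply: (@fintype.eq_card1 _ (0 : F)) => y.
by rewrite !inE expf_eq0.
Qed.

Lemma eq_opp a : (a == - a) = (a == 0).
Proof. by rewrite -subr_eq0 opprK -mulr2n -mulr_natr mulf_eq0 (negPf nz2) orbF. Qed.

Lemma chi_sqr a : a != 0 -> chi (a ^+ 2) = 1.
Proof.
move=> nza; rewrite /chi (@fintype.eq_card _ _ (mem [:: a; - a])); last first.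
  by move=> y; rewrite !inE eqf_sqr.
by rewrite (card_uniqP _) //= inE eq_opp nza.
Qed.

Lemma chi_cases a : a != 0 ->
  (exists2 b, b != 0 & a = b ^+ 2) /\ chi a = 1
  \/ (forall b, b ^+ 2 != a) /\ chi a = -1.
Proof.
move=> nza; case: (pickP [pred b : F | b ^+ 2 == a]) => [b /= /eqP bE|nob].
  have nzb : b != 0 by apply: contra_neq nza => b0; rewrite -bE b0 expr0n.
  by left; rewrite -bE chi_sqr //; split=> //; exists b.
right; split=> [b|]; first by have /= -> := nob b.
by rewrite /chi fintype.eq_card0.
Qed.

Lemma chi_mulsq c a : c != 0 -> chi (c ^+ 2 * a) = chi a.
Proof.
move=> nzc; have [->|nza] := eqVneq a 0; first by rewrite mulr0.
have [[[b nzb ->] ->]|[nsq ->]] := chi_cases nza.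
  by rewrite -exprMn chi_sqr // mulf_neq0.
have nzca : c ^+ 2 * a != 0 by rewrite mulf_neq0 // expf_neq0.
have [[[b nzb bE] _]|[_ ->//]] := chi_cases nzca.
have := nsq (b / c); rewrite expr_div_n -bE mulrAC mulfV ?mul1r ?eqxx //.
by rewrite expf_neq0.
Qed.

Lemma sum_chi : \sum_a chi a = 0.
Proof.
apply: (addrI (\sum_(a : F) 1)); rewrite addr0 -big_split /=.
under eq_bigr => a _ do rewrite chiE.
rewrite exchange_big /=; apply: eq_bigr => y _.
by rewrite (bigD1 (y ^+ 2)) //= eqxx big1 ?addr0 // => a; rewrite eq_sym => /negPf ->.
Qed.

Lemma sum_chi_shift b : \sum_a chi (a + b) = 0.
Proof. by rewrite -[RHS]sum_chi; apply/esym/reindex_inj/addIr. Qed.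

Lemma chi_le1 a : chi a <= 1.
Proof.
have [->|/chi_cases[[_ ->]|[_ ->]]//] := eqVneq a 0; by rewrite chi0.
Qed.

(** For a non-square a, the sums chi b + chi (a b) are nonpositive and add up to
    0, so that they all vanish. *)
Lemma chiM a b : chi (a * b) = chi a * chi b.
Proof.
have [->|nza] := eqVneq a 0; first by rewrite mul0r chi0 mul0r.
have [[[c nzc ->] _]|[nsqa chia]] := chi_cases nza.
  by rewrite chi_mulsq // chi_sqr // mul1r.
have le0 c : chi c + chi (a * c) <= 0.
  have [->|nzc] := eqVneq c 0; first by rewrite mulr0 chi0.
  have [[[d nzd ->] ->]|[_ ->]] := chi_cases nzc.
    by rewrite mulrC chi_mulsq // chia.
  by rewrite addrC subr_le0 chi_le1.
have sum0 : \sum_c (chi c + chi (a * c)) = 0.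
  rewrite big_split /= sum_chi add0r -[RHS]sum_chi.
  by rewrite [RHS](reindex_inj (mulfI nza)).
have sum0N : \sum_c - (chi c + chi (a * c)) = 0 by rewrite sumrN sum0 oppr0.
have term0 : forall c, true -> - (chi c + chi (a * c)) = 0.
  by apply: psumr_eq0P sum0N => c _; rewrite oppr_ge0.
apply/eqP; rewrite chia mulN1r -addr_eq0 addrC -oppr_eq0; apply/eqP.
exact: term0.
Qed.

Lemma chiX2 a : a != 0 -> chi a * chi a = 1.
Proof. by move=> nza; rewrite -chiM -expr2 chi_sqr. Qed.

Lemma chiV a : chi a^-1 = chi a.
Proof.
have [->|nza] := eqVneq a 0; first by rewrite invr0.
by rewrite -[LHS](chi_mulsq _ nza) expr2 mulfK.
Qed.

Lemma nz4 : (4%:R : F) != 0.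
Proof. by rewrite (natrX _ 2 2) expf_neq0. Qed.

Lemma quadratic_roots w e :
  \sum_u (u ^+ 2 - w * u + e == 0)%:R = 1 + chi (w ^+ 2 - 4%:R * e).
Proof.
rewrite chiE [RHS](reindex_inj (addIr (- w))) /=.
rewrite [RHS](reindex_inj (mulfI nz2)) /=; apply: eq_bigr => u _.
congr (_%:R); rewrite -[in RHS]subr_eq0.
have -> : (2%:R * u - w) ^+ 2 - (w ^+ 2 - 4%:R * e) = 4%:R * (u ^+ 2 - w * u + e) by ring.
by rewrite mulf_eq0 (negPf nz4).
Qed.

Lemma sum_sqr phi : \sum_x phi (x ^+ 2) = \sum_t phi t * (1 + chi t).
Proof.
under [RHS]eq_bigr => t _ do rewrite chiE mulr_sumr.
rewrite exchange_big /=; apply: eq_bigr => y _.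
rewrite (bigD1 (y ^+ 2)) //= eqxx mulr1 big1 ?addr0 // => a.
by rewrite eq_sym => /negPf ->; rewrite mulr0.
Qed.

(** The fibre of u -> u + e / u above w consists of the roots of the polynomial
    u^2 - w u + e. *)
Lemma sum_add_inv phi e : e != 0 ->
  \sum_(u | u != 0) phi (u + e / u) = \sum_w phi w * (1 + chi (w ^+ 2 - 4%:R * e)).
Proof.
move=> nze; under [RHS]eq_bigr => w _ do rewrite -quadratic_roots mulr_sumr.
rewrite exchange_big /= [RHS](bigD1 (0 : F)) //= [X in _ = X + _]big1 ?add0r; last first.
  by move=> w _; rewrite mulr0 expr0n subr0 add0r (negPf nze) mulr0.
apply: eq_bigr => u nzu; rewrite (bigD1 (u + e / u)) //= big1 => [|w neqw].
  have -> : u ^+ 2 - (u + e / u) * u + e = 0 by field.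
  by rewrite eqxx mulr1 addr0.
have -> : u ^+ 2 - w * u + e = u * (u + e / u - w) by field.
by rewrite mulf_eq0 (negPf nzu) subr_eq0 eq_sym (negPf neqw) mulr0.
Qed.

(** With w = u + eps^2 / u one has w + 2 eps = (u + eps)^2 / u and w - 2 eps =
    (u - eps)^2 / u, so that chi u is the common value of chi (w + 2 eps) and
    chi (w - 2 eps) when neither vanishes. Thus sum_add_inv, applied to phi
    times the sum h of these two characters, gives twice the formula, up to
    terms at w = 2 eps and w = - 2 eps that are the same on both sides. *)
Lemma sum_add_inv_chi phi eps : eps != 0 ->
  \sum_(u | u != 0) chi u * phi (u + eps ^+ 2 / u)
    = \sum_w phi w * (chi (w + 2%:R * eps) + chi (w - 2%:R * eps)).
Proof.
move=> nzeps.
have nze : eps ^+ 2 != 0 by rewrite expf_neq0.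
have chi4 a : chi (4%:R * a) = chi a by rewrite (natrX _ 2 2) chi_mulsq.
have nz2e : 2%:R * eps != 0 by rewrite mulf_neq0.
pose h w := chi (w + 2%:R * eps) + chi (w - 2%:R * eps).
have h_eps : h (2%:R * eps) = chi eps.
  rewrite /h subrr chi0 addr0 -[RHS]chi4; congr chi; ring.
have h_neps : h (- (2%:R * eps)) = chi (- eps).
  rewrite /h addNr chi0 add0r -[RHS]chi4; congr chi; ring.
have hu u : u != 0 -> h (u + eps ^+ 2 / u)
    = 2%:R * chi u - (u == eps)%:R * chi eps - (u == - eps)%:R * chi (- eps).
  move=> nzu; have [->|neq] := eqVneq u eps.
    have -> : eps + eps ^+ 2 / eps = 2%:R * eps by field.
    by rewrite h_eps eq_opp (negPf nzeps) /=; ring.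
  have [->|neqN] := eqVneq u (- eps).
    have -> : - eps + eps ^+ 2 / - eps = - (2%:R * eps).
      by rewrite invrN mulrN expr2 mulfK //; ring.
    by rewrite h_neps /=; ring.
  rewrite /h -[in RHS](chiV u).
  have -> : u + eps ^+ 2 / u + 2%:R * eps = (u + eps) ^+ 2 * u^-1 by field.
  have -> : u + eps ^+ 2 / u - 2%:R * eps = (u - eps) ^+ 2 * u^-1 by field.
  by rewrite !chi_mulsq ?addr_eq0 ?opprK //=; ring.
have hw w : h w * (1 + chi (w ^+ 2 - 4%:R * eps ^+ 2))
    = 2%:R * h w - (w == 2%:R * eps)%:R * chi eps
      - (w == - (2%:R * eps))%:R * chi (- eps).
  have -> : w ^+ 2 - 4%:R * eps ^+ 2 = (w + 2%:R * eps) * (w - 2%:R * eps) by ring.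
  rewrite chiM; have [->|neq] := eqVneq w (2%:R * eps).
    by rewrite h_eps subrr chi0 eq_opp (negPf nz2e) /=; ring.
  have [->|neqN] := eqVneq w (- (2%:R * eps)).
    by rewrite h_neps addNr chi0 /=; ring.
  rewrite /h; have := @chiX2 (w + 2%:R * eps); have := @chiX2 (w - 2%:R * eps).
  rewrite subr_eq0 addr_eq0 neq neqN.
  move: (chi _) (chi _) => c d /(_ isT) cc /(_ isT) dd.
  transitivity (c + d + d * d * c + d * (c * c)); first by ring.
  by rewrite cc dd /=; ring.
have L := sum_add_inv (fun w => phi w * h w) nze; rewrite /= in L.
have sum_pt (g : F -> int) a : \sum_w g w * (w == a)%:R = g a.
  by rewrite (bigD1 a) //= eqxx mulr1 big1 ?addr0 // => w /negPf ->; rewrite mulr0.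
have sum_pt0 (g : F -> int) a : a != 0 -> \sum_(w | w != 0) g w * (w == a)%:R = g a.
  move=> nza; rewrite (bigD1 a) //= eqxx mulr1 big1 ?addr0 // => w /andP[_ /negPf ->].
  by rewrite mulr0.
have E1 : \sum_(u | u != 0) phi (u + eps ^+ 2 / u) * h (u + eps ^+ 2 / u)
    = 2%:R * (\sum_(u | u != 0) chi u * phi (u + eps ^+ 2 / u))
      - phi (2%:R * eps) * chi eps - phi (- (2%:R * eps)) * chi (- eps).
  rewrite -[phi (2%:R * eps) * _](_ : \sum_(u | u != 0)
    phi (u + eps ^+ 2 / u) * chi eps * (u == eps)%:R = _); last first.
    by rewrite sum_pt0 //; congr (phi _ * _); field.
  rewrite -[phi (- _) * _](_ : \sum_(u | u != 0)
    phi (u + eps ^+ 2 / u) * chi (- eps) * (u == - eps)%:R = _); last first.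
    rewrite sum_pt0 ?oppr_eq0 //; congr (phi _ * _).
    by rewrite invrN mulrN expr2 mulfK //; ring.
  rewrite mulr_sumr -!sumrB; apply: eq_bigr => u nzu; rewrite hu //; ring.
have E2 : \sum_w phi w * h w * (1 + chi (w ^+ 2 - 4%:R * eps ^+ 2))
    = 2%:R * (\sum_w phi w * h w)
      - phi (2%:R * eps) * chi eps - phi (- (2%:R * eps)) * chi (- eps).
  rewrite -[phi (2%:R * eps) * _](sum_pt (fun w => phi w * chi eps)).
  rewrite -[phi (- _) * _](sum_pt (fun w => phi w * chi (- eps))).
  rewrite mulr_sumr -!sumrB; apply: eq_bigr => w _.
  by rewrite -mulrA hw; ring.
move: L; rewrite E1 E2 => L.
apply: (mulfI (_ : (2%:R : int) != 0)) => //.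
by move: L => /addIr /addIr.
Qed.

(** The two sums are those of the elliptic curve y^2 = x (x^2 + a x + b) and of
    its quotient by the 2-torsion point (0, 0). For x != 0 the left summand is
    chi (x + b / x + a), and sum_add_inv applies. *)
Lemma isogeny2 a b : b != 0 ->
  \sum_x chi (x * (x ^+ 2 + a * x + b))
    = \sum_x chi (x * (x ^+ 2 - 2%:R * a * x + (a ^+ 2 - 4%:R * b))).
Proof.
move=> nzb; rewrite (bigD1 (0 : F)) //= mul0r chi0 add0r.
transitivity (\sum_(u | u != 0) chi (u + b / u + a)).
  apply: eq_bigr => u nzu; rewrite -[RHS](chi_mulsq _ nzu); congr chi.
  by field.
rewrite (sum_add_inv (fun w => chi (w + a)) nzb).
transitivity (\sum_w (chi (w + a) + chi ((w + a) * (w ^+ 2 - 4%:R * b)))).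
  by apply: eq_bigr => w _; rewrite chiM; ring.
rewrite big_split /= sum_chi_shift add0r.
rewrite [RHS](reindex_inj (addIr a)) /=; apply: eq_bigr => w _; congr chi; ring.
Qed.

Definition legendre_sum k : int := \sum_x chi (x * (x - 1) * (x - k ^+ 2)).

(** The quotient of y^2 = x (x - 1) (x - k^2) by (0, 0) is again a Legendre
    curve; its parameter l = 2 sqrt k / (1 + k) is that of the arithmetic-
    geometric mean. *)
Lemma legendre_sum_agm k l : k != 0 -> l ^+ 2 * (1 + k) ^+ 2 = 4%:R * k ->
  legendre_sum k = legendre_sum l.
Proof.
move=> nzk klE; have nzk1 : 1 + k != 0.
  apply: contraNneq nzk => k0; have /eqP : 4%:R * k = 0 by rewrite -klE k0; ring.
  by rewrite mulf_eq0 (negPf nz4).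
have nzk2 : k ^+ 2 != 0 by rewrite expf_neq0.
transitivity (\sum_x chi (x * (x ^+ 2 + - (1 + k ^+ 2) * x + k ^+ 2))).
  by apply: eq_bigr => x _; congr chi; ring.
rewrite (isogeny2 _ nzk2) (reindex_inj (addIr (- (1 + k) ^+ 2))) /=.
have nzsq : (1 + k) ^+ 2 != 0 by rewrite expf_neq0.
rewrite (reindex_inj (mulfI nzsq)) /=; apply: eq_bigr => x _.
have nzc : (1 + k) ^+ 3 != 0 by rewrite expf_neq0.
rewrite -[RHS](chi_mulsq _ nzc); congr chi.
transitivity ((1 + k) ^+ 4 * x * (x - 1) * ((1 + k) ^+ 2 * x - l ^+ 2 * (1 + k) ^+ 2)).
  rewrite klE; ring.
ring.
Qed.

Definition cubic_sum a b c : int := \sum_x chi ((x - a) * (x - b) * (x - c)).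

Lemma cubic_sum_legendre a b c d k : d != 0 -> b - a = d ^+ 2 ->
  k ^+ 2 * (b - a) = c - a -> cubic_sum a b c = legendre_sum k.
Proof.
move=> nzd dE kE; rewrite /cubic_sum (reindex_inj (addIr a)) /=.
have nzd2 : d ^+ 2 != 0 by rewrite expf_neq0.
rewrite (reindex_inj (mulfI nzd2)) /=; apply: eq_bigr => x _.
have nzd3 : d ^+ 3 != 0 by rewrite expf_neq0.
rewrite -[RHS](chi_mulsq _ nzd3); congr chi.
have -> : d ^+ 2 * x + a - c = d ^+ 2 * x - k ^+ 2 * d ^+ 2 by rewrite -dE kE; ring.
have -> : d ^+ 2 * x + a - b = d ^+ 2 * x - d ^+ 2 by rewrite -dE; ring.
ring.
Qed.

End QuadraticCharacter.

(** * The field with p^2 elements *)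

(** With p = 4 m + 3, this is c^(2 m + 1) = 1 or -1, multiplied by c. *)
Lemma prime_field_sqrt (p : nat) (c : 'F_p) : prime p -> (p %% 4 = 3)%N ->
  c = (c ^+ (p %/ 4)%N.+1) ^+ 2 \/ c = - (c ^+ (p %/ 4)%N.+1) ^+ 2.
Proof.
move=> pr_p p3.
have [->|nzc] := eqVneq c 0; first by left; rewrite !expr0n.
pose m := (p %/ 4)%N; have pE : p = (m * 4 + 3)%N by rewrite {1}(divn_eq p 4) p3.
have sq1 : (c ^+ (2 * m + 1)) ^+ 2 = 1.
  apply: (mulfI nzc); rewrite mulr1 -exprM -exprS.
  by have := expf_card c; rewrite card_Fp // {3}pE => {2}<-; congr (c ^+ _); lia.
rewrite -exprM -/m; have -> : (m.+1 * 2 = (2 * m + 1).+1)%N by lia.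
rewrite exprS; move/eqP: sq1; rewrite sqrf_eq1 => /orP[] /eqP ->.
  by left; rewrite mulr1.
by right; rewrite mulrN1 opprK.
Qed.

Section QuadraticExtension.

Variables (p : nat) (F : finFieldType) (j : {rmorphism 'F_p -> F}).
Hypothesis pr_p : prime p.
Hypothesis p3 : (p %% 4 = 3)%N.
Hypothesis cardF : #|F| = (p ^ 2)%N.

Lemma prime_field_neq0 (c : 'F_p) : (j c != 0) = (c != 0).
Proof. by rewrite fmorph_eq0. Qed.

Lemma two_neq0 : (2%:R : F) != 0.
Proof.
have pos_p : (2 < p)%N.
  by move: p3 (prime_gt1 pr_p); case: (p) => [|[|[|]]].
rewrite -(rmorph_nat j) prime_field_neq0 -(dvdn_pcharf (pchar_Fp pr_p)).
by rewrite gtnNdvd.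
Qed.

Local Notation nz2 := two_neq0.

(** 4 divides q - 1 for q = p^2, and some x^((q - 1) / 2) differs from 1, hence
    is -1, because the polynomial X^((q - 1) / 2) - 1 has too few roots. *)
Lemma sqrt_opp1 : exists i : F, i ^+ 2 = -1.
Proof.
pose m := (p %/ 4)%N; have pE : p = (m * 4 + 3)%N by rewrite {1}(divn_eq p 4) p3.
pose n := (2 * (2 * m + 1) * (m + 1))%N.
have qE : #|F| = (4 * n).+1 by rewrite cardF pE /n; lia.
have powE (x : F) : x != 0 -> (x ^+ (2 * n)) ^+ 2 = 1.
  move=> nzx; apply: (mulfI nzx); rewrite mulr1 -exprM -exprS.
  by have := expf_card x; rewrite qE => {2}<-; congr (x ^+ _); lia.
have [x nzx xE] : exists2 x : F, x != 0 & x ^+ (2 * n) != 1.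
  apply: contrapT => no.
  have allx (x : F) : x != 0 -> x ^+ (2 * n) = 1.
    by move=> nzx; apply/eqP/negPn/negP => nex; apply: no; exists x.
  have nzP : 'X^(2 * n) - 1%:P != 0 :> {poly F}.
    by apply: monic_neq0; apply: monicXnsubC; rewrite /n; lia.
  have roots : all (root ('X^(2 * n) - 1%:P)) (enum (predC1 (0 : F))).
    by apply/allP => x; rewrite mem_enum inE => /allx xE; rewrite /root hornerD hornerN hornerXn hornerC xE subrr.
  have := max_poly_roots nzP roots (enum_uniq _).
  rewrite size_XnsubC; last by rewrite /n; lia.
  by rewrite -cardE cardC1 qE /n; lia.
exists (x ^+ n); rewrite -exprM mulnC; apply/eqP.
by have /eqP := powE x nzx; rewrite sqrf_eq1 (negPf xE).
Qed.

Local Notation chi := (@chi F).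

(** By prime_field_sqrt, as -1 is a square in F. *)
Lemma chi_prime_field (c : 'F_p) : c != 0 -> chi (j c) = 1.
Proof.
move=> nzc; have [i iE] := sqrt_opp1.
have nzjc := prime_field_neq0 c; rewrite nzc in nzjc.
have [cE|cE] := prime_field_sqrt c pr_p p3.
  move: nzjc; rewrite cE rmorphXn => nz; rewrite chi_sqr ?nz2 //.
  by rewrite expf_eq0 /= in nz.
move: nzjc; rewrite cE rmorphN rmorphXn /= -mulN1r -iE -exprMn => nz.
by rewrite chi_sqr ?nz2 //; rewrite expf_eq0 /= in nz.
Qed.

Lemma chi_opp1 : chi (-1) = 1.
Proof. by rewrite -(rmorph1 j) -rmorphN chi_prime_field // oppr_eq0 oner_eq0. Qed.

Lemma chiN x : chi (- x) = chi x.
Proof. by rewrite -mulN1r chiM ?nz2 // chi_opp1 mul1r. Qed.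

(** 2 i = (1 + i)^2, and 2 is a square in F. *)
Lemma chi_sqrt_opp1 i : i ^+ 2 = -1 -> chi i = 1.
Proof.
move=> iE; have nz1i : 1 + i != 0.
  apply/eqP => i1; have iN1 : i = -1 by rewrite -[i](addKr 1) i1 addr0.
  have E : 2%:R = i ^+ 2 + 1 by rewrite iN1; ring.
  by have := nz2; rewrite E iE addNr eqxx.
have := chi_sqr nz2 nz1i.
have -> : (1 + i) ^+ 2 = 2%:R * i.
  by transitivity (1 + 2%:R * i + i ^+ 2); [ring | rewrite iE; ring].
rewrite chiM ?nz2 // -(rmorph_nat j) chi_prime_field ?mul1r //.
by rewrite -prime_field_neq0 rmorph_nat nz2.
Qed.

Lemma chi_sqrt_prime_field x c : c != 0 -> x ^+ 2 = j c -> chi x = 1.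
Proof.
move=> nzc xE; have [i iE] := sqrt_opp1; pose b := c ^+ (p %/ 4)%N.+1.
have nzb : b != 0 by rewrite expf_neq0.
have [cE|cE] := prime_field_sqrt c pr_p p3.
  have /eqP : x ^+ 2 = (j b) ^+ 2 by rewrite xE {1}cE rmorphXn.
  by rewrite eqf_sqr => /orP[] /eqP ->; rewrite ?chiN chi_prime_field.
have /eqP : x ^+ 2 = (i * j b) ^+ 2 by rewrite xE {1}cE exprMn iE mulN1r rmorphN rmorphXn.
by rewrite eqf_sqr => /orP[] /eqP ->;
  rewrite ?chiN chiM ?nz2 // chi_sqrt_opp1 // chi_prime_field.
Qed.

(** If v is in F_p, the sum runs over F_p. Otherwise every element of F is b - a
    v for exactly one pair of a and b in F_p; as chi is trivial on the nonzero
    elements of F_p, the vanishing of the sum of chi over F reads (p - 1) (1 +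
    T) = 0, where T is the sum at hand. *)
Lemma sum_chi_line v :
  \sum_(c : 'F_p) chi (j c - v) = p%:Z * (\sum_(c : 'F_p) (v == j c)%:R) - 1.
Proof.
have sum_prime : \sum_(c : 'F_p) chi (j c) = p%:Z - 1.
  rewrite (bigD1 (0 : 'F_p)) //= rmorph0 chi0 add0r.
  rewrite (eq_bigr (fun=> 1)); last by move=> c nzc; rewrite chi_prime_field.
  by rewrite sumr_const cardC1 card_Fp // natz -subn1 subzn // prime_gt0.
have [[c0 v0]|nov] := pselect (exists c0, v = j c0).
  have -> : \sum_(c : 'F_p) (v == j c)%:R = 1 :> int.
    rewrite v0 (bigD1 c0) //= eqxx big1 ?addr0 // => c neq.
    by case: eqP => // /(fmorph_inj j) E; rewrite E eqxx in neq.
  rewrite mulr1 v0.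
  rewrite -sum_prime [RHS](reindex_inj (addIr (- c0))).
  by apply: eq_bigr => c _; rewrite rmorphB.
rewrite [X in _ * X]big1 ?mulr0 ?sub0r; last first.
  by move=> c _; case: eqP => // vE; case: nov; exists c.
pose T := \sum_(c : 'F_p) chi (j c - v); rewrite -/T.
pose h (ab : 'F_p * 'F_p) : F := j ab.2 - j ab.1 * v.
have h_inj : injective h.
  move=> [a b] [a' b']; rewrite /h /= => E.
  have [aa|neq] := eqVneq a a'.
    by move: E; rewrite aa => /addIr/(fmorph_inj j) ->.
  case: nov; exists ((b - b') / (a - a')).
  have nzd : j (a - a') != 0 by rewrite prime_field_neq0 subr_eq0.
  rewrite fmorph_div; apply: (mulIf nzd); rewrite divfK // !rmorphB.
  transitivity (j b - j b' - ((j b - j a * v) - (j b' - j a' * v))); first by ring.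
  by rewrite E; ring.
have h_bij : bijective h.
  apply: inj_card_bij h_inj _.
  by rewrite cardF card_prod !card_Fp // expnS expn1.
have := sum_chi F; rewrite (reindex h) /=; last exact: onW_bij.
rewrite -(pair_bigA _ (fun a b => chi (h (a, b)))) /=.
rewrite (bigD1 (0 : 'F_p)) //= /h /=.
under eq_bigr => b _ do rewrite rmorph0 mul0r subr0.
rewrite sum_prime (eq_bigr (fun=> T)); last first.
  move=> a nza; rewrite (reindex_inj (mulfI nza)) /=; apply: eq_bigr => b _.
  rewrite rmorphM -mulrBr chiM ?nz2 // chi_prime_field // mul1r //.
rewrite sumr_const cardC1 card_Fp // -mulr_natr natz -subn1 -subzn ?prime_gt0 //.
move=> E; have /eqP : (T + 1) * (p%:Z - 1) = 0 by rewrite -E; ring.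
rewrite mulf_eq0 => /orP[|]; first by rewrite addr_eq0 => /eqP.
by rewrite subr_eq0 => /eqP; have := prime_gt1 pr_p; lia.
Qed.

(** For the curve y^2 = x^3 - x. Each twist y^2 = x^3 - c x with c nonzero in
    F_p has the same sum, because the square roots of c are squares in F. The
    sum over c of these equal sums is computed in the other order by
    sum_chi_line: only the 2 (p - 1) elements x with x^2 nonzero in F_p
    contribute, each with chi x = 1. *)
Theorem sum_chi_1728 : \sum_x chi (x * (x ^+ 2 - 1)) = 2%:R * p%:Z.
Proof.
set S := LHS.
have twist (c : 'F_p) : c != 0 -> \sum_x chi (x * (x ^+ 2 - j c)) = S.
  move=> nzc; have [d dE] : exists d : F, d ^+ 2 = j c.
    have [i iE] := sqrt_opp1; have [cE|cE] := prime_field_sqrt c pr_p p3.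
      by exists (j (c ^+ (p %/ 4)%N.+1)); rewrite -rmorphXn -cE.
    exists (i * j (c ^+ (p %/ 4)%N.+1)).
    by rewrite exprMn iE mulN1r -rmorphXn -rmorphN -cE.
  have nzd : d != 0.
    apply: contra_neq nzc => d0; apply/eqP; rewrite -(fmorph_eq0 j) -dE d0.
    by rewrite expr0n.
  rewrite (reindex_inj (mulfI nzd)) /=; apply: eq_bigr => x _; rewrite -dE.
  have -> : d * x * ((d * x) ^+ 2 - d ^+ 2) = d ^+ 2 * (d * (x * (x ^+ 2 - 1))) by ring.
  by rewrite chi_mulsq ?nz2 // chiM ?nz2 // (chi_sqrt_prime_field nzc dE) mul1r.
have cube0 : \sum_x chi (x * (x ^+ 2 - j 0)) = 0.
  rewrite -[RHS](sum_chi F); apply: eq_bigr => x _; rewrite rmorph0 subr0.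
  have [->|nzx] := eqVneq x 0; first by rewrite mul0r.
  by rewrite mulrC chi_mulsq ?nz2.
have E1 : \sum_(c : 'F_p) \sum_x chi (x * (x ^+ 2 - j c)) = (p%:Z - 1) * S.
  rewrite (bigD1 (0 : 'F_p)) //= cube0 add0r (eq_bigr (fun=> S)); last exact: twist.
  by rewrite sumr_const cardC1 card_Fp // -mulr_natl natz -subn1 -subzn // prime_gt0.
have E2 : \sum_(c : 'F_p) \sum_x chi (x * (x ^+ 2 - j c)) = p%:Z * (2%:R * (p%:Z - 1)).
  rewrite exchange_big /=.
  transitivity (\sum_x (p%:Z * (\sum_(c : 'F_p) chi x * (x ^+ 2 == j c)%:R) - chi x)).
    apply: eq_bigr => x _; rewrite -mulr_sumr -[X in _ - X]mulr1.
    transitivity (chi x * \sum_(c : 'F_p) chi (j c - x ^+ 2)).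
      by rewrite mulr_sumr; apply: eq_bigr => c _; rewrite chiM ?nz2 // -(chiN (j c - x ^+ 2)) opprB.
    by rewrite sum_chi_line; ring.
  rewrite sumrB (sum_chi F) subr0 -mulr_sumr; congr (_ * _).
  rewrite exchange_big /= (bigD1 (0 : 'F_p)) //= big1 ?add0r; last first.
    move=> x _; rewrite rmorph0 expf_eq0 /=; case: eqP => [->|_].
      by rewrite chi0 mul0r.
    by rewrite mulr0.
  rewrite (eq_bigr (fun=> 2%:R)); last first.
    move=> c nzc; transitivity (\sum_x (x ^+ 2 == j c)%:R : int).
      apply: eq_bigr => x _; case: eqP => [xE|_]; last by rewrite mulr0.
      by rewrite (chi_sqrt_prime_field nzc xE) mul1r.
    by rewrite -chiE chi_prime_field.
  have predE : (p.-1)%:R = p%:Z - 1 by rewrite natz -subn1 -subzn // prime_gt0.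
  by rewrite sumr_const cardC1 card_Fp // -[LHS]mulr_natr predE.
apply: (mulfI (_ : p%:Z - 1 != 0)).
  by rewrite subr_eq0; apply/eqP; have := prime_gt1 pr_p; lia.
by rewrite -E1 E2; ring.
Qed.

End QuadraticExtension.

(** * Decomposition of the point count *)

Section CurveSum.

Variable F : finFieldType.
Hypothesis nz2 : (2%:R : F) != 0.
Variable i : F.
Hypothesis iE : i ^+ 2 = -1.

Local Notation chi := (@chi F).

Variables a r1 r2 r3 : F.

(** The cubic G with f(x) = x^6 G(x^2 + x^-2). *)
Definition quotient_cubic s : F := s ^+ 3 - a * s ^+ 2 - 36%:R * s + 4%:R * a.

Local Notation G := quotient_cubic.

Let chi64 x : chi (- (64%:R * x)) = chi x.
Proof.
have nz8i : 8%:R * i != 0.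
  rewrite mulf_neq0 ?(natrX _ 2 3) ?expf_neq0 //.
  by apply/eqP => i0; have := oner_neq0 F; rewrite -oppr_eq0 -iE i0 expr0n eqxx.
rewrite -[RHS](chi_mulsq nz2 _ nz8i); congr chi.
by rewrite exprMn iE; ring.
Qed.

(** The map s -> (2 s - 12) / (s + 2) is of order 3; it permutes 2, -2 and
    infinity cyclically and preserves the set of roots of G. It comes from an
    automorphism of order 3 of the curve C_a. *)
Lemma mobius_sum (phi : F -> int) :
  \sum_(s | s != - 2%:R) phi ((2%:R * s - 12%:R) / (s + 2%:R))
    = \sum_(u | u != 2%:R) phi u.
Proof.
have nz16 : (16%:R : F) != 0 by rewrite (natrX _ 2 4) expf_neq0.
rewrite [RHS](reindex_onto (fun s => (2%:R * s - 12%:R) / (s + 2%:R))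
  (fun u => - (2%:R * u + 12%:R) / (u - 2%:R))) /=; last first.
  move=> u neq; have nzu : u - 2%:R != 0 by rewrite subr_eq0.
  have E : - (2%:R * u + 12%:R) / (u - 2%:R) + 2%:R = - 16%:R / (u - 2%:R) by field.
  have nzE : - 16%:R / (u - 2%:R) != 0 by rewrite mulf_neq0 ?oppr_eq0 ?invr_eq0.
  by rewrite E; field; rewrite nzu oppr_eq0.
apply: eq_bigl => s; rewrite -[LHS]/(s != - 2%:R); have [->|neq] := eqVneq s (- 2%:R).
  rewrite addNr invr0 mulr0 /= eq_sym (negPf nz2) /= sub0r invrN mulrN mulNr opprK mulr0 add0r.
  symmetry; apply/negbTE; rewrite -subr_eq0.
  have -> : 12%:R / 2%:R - - 2%:R = 2%:R ^+ 3 :> F by field.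
  by rewrite expf_neq0.
have nzs : s + 2%:R != 0 by rewrite -[2%:R]opprK subr_eq0.
have E : (2%:R * s - 12%:R) / (s + 2%:R) - 2%:R = - 16%:R / (s + 2%:R) by field.
have nzE : - 16%:R / (s + 2%:R) != 0 by rewrite mulf_neq0 ?oppr_eq0 ?invr_eq0.
rewrite -subr_eq0 E nzE /=; symmetry; apply/eqP; field.
by rewrite nzs oppr_eq0.
Qed.

(** For rho s = (2 s - 12) / (s + 2) one has (s + 2)^3 G(rho s) = - 64 G(s), and
    -64 is a square. *)
Lemma quotient_sum_pos : \sum_s chi ((s + 2%:R) * G s) = \sum_s chi (G s) - 1.
Proof.
have chiG2 : chi (G 2%:R) = 1.
  rewrite (_ : G _ = - (64%:R * 1)) ?chi64 //; last by rewrite /G; ring.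
  by rewrite -(expr1n _ 2) chi_sqr ?oner_neq0.
rewrite [in RHS](bigD1 (2%:R : F)) //= chiG2 addrC addrK -mobius_sum.
rewrite (bigD1 (- 2%:R : F)) //= addNr mul0r chi0 add0r.
apply: eq_bigr => s neq; have nzs : s + 2%:R != 0 by rewrite -[2%:R]opprK subr_eq0.
have nzs2 : (s + 2%:R) ^+ 2 != 0 by rewrite expf_neq0.
rewrite -[LHS]chi64 -[RHS](chi_mulsq nz2 _ nzs2); congr chi; rewrite /G.
by field.
Qed.

Lemma quotient_sum_neg : \sum_s chi ((s - 2%:R) * G s) = \sum_s chi (G s) - 1.
Proof.
have chiG2 : chi (G (- 2%:R)) = 1.
  rewrite (_ : G _ = 8%:R ^+ 2); last by rewrite /G; ring.
  by rewrite chi_sqr // (natrX _ 2 3) expf_neq0.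
rewrite [in RHS](bigD1 (- 2%:R : F)) //= chiG2 addrC addrK.
rewrite (bigD1 (2%:R : F)) //= subrr mul0r chi0 add0r -mobius_sum.
apply: eq_bigr => s neq; have nzs : s + 2%:R != 0 by rewrite -[2%:R]opprK subr_eq0.
have nzs2 : (s + 2%:R) ^+ 2 != 0 by rewrite expf_neq0.
have nz32 : (32%:R : F) != 0 by rewrite (natrX _ 2 5) expf_neq0.
rewrite -[RHS](chi_mulsq nz2 _ nz32) -[LHS](chi_mulsq nz2 _ nzs2); congr chi; rewrite /G.
by field.
Qed.

(** Substitution of t = x^2, then of s = t + 1 / t. The four resulting sums
    belong to the quotients of C_a by the lifts of the group x -> x, -x, 1 / x,
    -1 / x; the order 3 automorphism identifies three of them. *)
Lemma sum_chi_curve : \sum_x chi (curve_poly a).[x]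
  = \sum_s chi ((s - 2%:R) * (s + 2%:R) * G s) + 3%:R * (\sum_s chi (G s)) - 1.
Proof.
pose g t : F := t ^+ 6 - a * t ^+ 5 - 33%:R * t ^+ 4 + 2%:R * a * t ^+ 3
   - 33%:R * t ^+ 2 - a * t + 1.
have gE t : t != 0 -> g t = t ^+ 2 * (t * G (t + 1 / t)).
  by move=> nzt; rewrite /g /G; field.
have chi1 : chi 1 = 1 by rewrite -(expr1n _ 2) chi_sqr ?oner_neq0.
transitivity (\sum_x chi (g (x ^+ 2))).
  by apply: eq_bigr => x _; congr chi; rewrite /curve_poly horner_Poly /= /g; ring.
rewrite (sum_sqr (fun t => chi (g t))).
rewrite (bigD1 (0 : F)) //= chi0 addr0 mulr1.
have -> : g 0 = 1 by rewrite /g !expr0n /=; ring.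
transitivity (1 + (\sum_(t | t != 0) chi t * chi (G (t + 1 ^+ 2 / t))
    + \sum_(t | t != 0) chi (G (t + 1 / t)))).
  rewrite chi1 -big_split /=; congr (_ + _); apply: eq_bigr => t nzt.
  rewrite (gE _ nzt) chi_mulsq // chiM // expr1n.
  have := chiX2 nz2 nzt; move: (chi t) (chi (G _)) => c d cc.
  by transitivity (c * d + c * c * d); [ring | rewrite cc; ring].
rewrite (sum_add_inv_chi nz2 (fun s => chi (G s)) (oner_neq0 F)).
rewrite (sum_add_inv nz2 (fun s => chi (G s)) (oner_neq0 F)).
have Epos : \sum_w chi (G w) * (chi (w + 2%:R * 1) + chi (w - 2%:R * 1))
    = \sum_s chi ((s + 2%:R) * G s) + \sum_s chi ((s - 2%:R) * G s).
  by rewrite -big_split; apply: eq_bigr => w _; rewrite /= !mulr1 !chiM //; ring.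
have Emid : \sum_w chi (G w) * (1 + chi (w ^+ 2 - 4%:R * 1))
    = \sum_s chi (G s) + \sum_s chi ((s - 2%:R) * (s + 2%:R) * G s).
  rewrite -big_split; apply: eq_bigr => w _ /=; rewrite [X in _ = _ + X]chiM //.
  rewrite (_ : w ^+ 2 - _ = (w - 2%:R) * (w + 2%:R)); ring.
by rewrite Epos Emid quotient_sum_pos quotient_sum_neg; ring.
Qed.

Hypothesis G_roots : forall s, G s = (s - r1) * (s - r2) * (s - r3).

(** With u = s - r1, the involution u -> eps^2 / u exchanges infinity with r1, 2
    with r2 and -2 with r3. The genus 2 curve v^2 = (s^2 - 4) G(s) therefore has
    two elliptic quotients, on which w = u + eps^2 / u is a coordinate. *)
Lemma sum_chi_sextic eps : eps != 0 ->
  eps ^+ 2 = (2%:R - r1) * (r2 - r1) -> eps ^+ 2 = (- 2%:R - r1) * (r3 - r1) ->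
  \sum_s chi ((s - 2%:R) * (s + 2%:R) * G s)
  = cubic_sum (- (2%:R * eps)) (2%:R + r2 - 2%:R * r1) (r3 - 2%:R - 2%:R * r1)
    + cubic_sum (2%:R * eps) (2%:R + r2 - 2%:R * r1) (r3 - 2%:R - 2%:R * r1).
Proof.
move=> nzeps e1 e2.
have nze : eps ^+ 2 != 0 by rewrite expf_neq0.
set M := 2%:R + r2 - _; set N := r3 - _ - _.
rewrite (reindex_inj (addIr r1)) /= (bigD1 (0 : F)) //= add0r.
rewrite G_roots subrr !mul0r mulr0 chi0 add0r.
transitivity (\sum_(u | u != 0) chi u * chi ((u + eps ^+ 2 / u - M) * (u + eps ^+ 2 / u - N))).
  apply: eq_bigr => u nzu; rewrite -chiM // -[RHS](chi_mulsq nz2 _ nzu); congr chi.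
  rewrite G_roots.
  transitivity (u * ((u - (2%:R - r1)) * (u - (r2 - r1)))
     * ((u - (- 2%:R - r1)) * (u - (r3 - r1)))); first by ring.
  have -> : (u - (2%:R - r1)) * (u - (r2 - r1)) = u * (u + eps ^+ 2 / u - M).
    by rewrite e1 /M; field.
  have -> : (u - (- 2%:R - r1)) * (u - (r3 - r1)) = u * (u + eps ^+ 2 / u - N).
    by rewrite e2 /N; field.
  ring.
rewrite (sum_add_inv_chi nz2 (fun w => chi ((w - M) * (w - N))) nzeps).
rewrite /cubic_sum -big_split; apply: eq_bigr => w _ /=.
by rewrite mulrDr -!chiM //; congr (chi _ + chi _); ring.
Qed.

End CurveSum.

(** * Certificates for supersingularity *)

(** Data for the curve with a = r1 + r2 + r3: the roots r1, r2, r3 of G, the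
    square root eps of sum_chi_sextic, and for each of the three elliptic curves
    that occur the Legendre parameters k along a chain of 2-isogenies to y^2 =
    x^3 - x. A pair (u, v) stands for u + v i with i^2 = -1. *)
Record certificate := Certificate {
  cert_prime : N;
  cert_roots : N * N * N;
  cert_sqrt : N;
  cert_paths : seq (N * N) * seq (N * N) * seq (N * N)
}.

Section Checker.

Variable p : N.

(** The factor p - 1 stands for -1, since subtraction in N is truncated. *)
Definition negp (m : N) : N := N.modulo (N.pred p * m) p.

Definition gauss_mul (u v : N * N) : N * N :=
  (N.modulo (u.1 * v.1 + N.pred p * (u.2 * v.2)) p,
   N.modulo (u.1 * v.2 + u.2 * v.1) p).

Definition gauss_scale (m : N) (u : N * N) : N * N :=
  (N.modulo (m * u.1) p, N.modulo (m * u.2) p).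

Definition agm_step (k l : N * N) : bool :=
  let k1 := ((1 + k.1)%num, k.2) in
  gauss_mul (gauss_mul l l) (gauss_mul k1 k1) == gauss_scale 4 k.

Fixpoint agm_path (k : N * N) (ks : seq (N * N)) : bool :=
  if ks is l :: ks' then agm_step k l && agm_path l ks'
  else gauss_mul k k == (N.pred p, 0%num).

Definition supersingular_path (a b c : N) (ks : seq (N * N)) : bool :=
  let d := N.modulo (b + negp a) p in let d' := N.modulo (c + negp a) p in
  if ks is k :: ks' then
    [&& d != 0%num, d' != 0%num, gauss_mul (gauss_mul k k) (d, 0%num) == (d', 0%num)
      & agm_path k ks']
  else false.

Definition congr_p (m n : N) : bool := N.modulo m p == N.modulo n p.

End Checker.

Definition check_certificate (c : certificate) : bool :=
  let: Certificate p (r1, r2, r3) e (w0, w1, w2) := c in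
  let a := (r1 + r2 + r3)%num in
  let M := (2 + r2 + negp p (2 * r1))%num in
  let N := (negp p 2 + r3 + negp p (2 * r1))%num in
  [&& N.modulo p 4 == 3%num,
      N.modulo e p != 0%num,
      N.modulo (a * a + 108) p != 0%num,
      (* The coefficients of G = (s - r1) (s - r2) (s - r3). *)
      congr_p p (r1 * r2 + r1 * r3 + r2 * r3 + 36) 0,
      congr_p p (r1 * r2 * r3 + 4 * a) 0,
      (* e^2 = (2 - r1) (r2 - r1) = (- 2 - r1) (r3 - r1), with the negative terms
         moved across. *)
      congr_p p (e * e + 2 * r1 + r1 * r2) (2 * r2 + r1 * r1),
      congr_p p (e * e + 2 * r3 + r1 * r3) (2 * r1 + r1 * r1),
      supersingular_path p r1 r2 r3 w0,
      supersingular_path p (negp p (2 * e)) M N w1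
    & supersingular_path p (2 * e) M N w2].

Lemma nat_of_binD m n : nat_of_bin (N.add m n) = (nat_of_bin m + nat_of_bin n)%N.
Proof. by case: m n => [|m] [|n] //=; rewrite ?addn0 ?nat_of_add_pos. Qed.

Lemma nat_of_binM m n : nat_of_bin (N.mul m n) = (nat_of_bin m * nat_of_bin n)%N.
Proof. by case: m n => [|m] [|n] //=; rewrite ?muln0 ?nat_of_mul_pos. Qed.

Lemma nat_of_bin_eq0 n : (nat_of_bin n == 0%N) = (n == 0%num).
Proof.
apply/eqP/eqP => [n0|->//].
by rewrite -(nat_of_binK n) n0.
Qed.

Lemma nat_of_bin_lt m n : N.lt m n -> (nat_of_bin m < nat_of_bin n)%N.
Proof.
move=> ltmn; rewrite -(N.sub_add m n); last exact: N.lt_le_incl.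
rewrite nat_of_binD -[X in (X < _)%N]add0n ltn_add2r lt0n nat_of_bin_eq0.
by apply/eqP; apply: N.sub_gt.
Qed.

Section Soundness.

Variables (p : N) (F : finFieldType) (j : {rmorphism 'F_p -> F}).
Hypothesis pr_p : prime p.
Hypothesis p3 : (p %% 4 = 3)%N.
Hypothesis cardF : #|F| = (p ^ 2)%N.

Local Notation chi := (@chi F).

Definition residue (n : N) : F := (nat_of_bin n)%:R.

Lemma residueD m n : residue (m + n) = residue m + residue n.
Proof. by rewrite /residue nat_of_binD natrD. Qed.

Lemma residueM m n : residue (m * n) = residue m * residue n.
Proof. by rewrite /residue nat_of_binM natrM. Qed.

Lemma residue_char : residue p = 0.
Proof.
by rewrite /residue -(rmorph_nat j) (pcharf0 (pchar_Fp pr_p)) rmorph0.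
Qed.

Lemma residue_mod n : residue (N.modulo n p) = residue n.
Proof.
by rewrite [in RHS](N.div_mod' n p) residueD residueM residue_char mul0r add0r.
Qed.

Lemma bin_prime_neq0 : p <> 0%num.
Proof. by move=> p0; move: pr_p; rewrite p0. Qed.

Lemma residue_eq0 n : (residue n == 0) = (N.modulo n p == 0%num).
Proof.
rewrite -residue_mod; apply/eqP/eqP => [|-> //].
have := N.mod_lt n p bin_prime_neq0; move: (N.modulo n p) => m ltmp.
have ltmpn := nat_of_bin_lt ltmp.
rewrite /residue -(rmorph_nat j) => /eqP; rewrite fmorph_eq0.
rewrite -(dvdn_pcharf (pchar_Fp pr_p)) => dvd_pm.
have [/eqP|pos_m] := posnP m; first by rewrite nat_of_bin_eq0 => /eqP.
by move: dvd_pm; rewrite gtnNdvd.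
Qed.

Lemma residue_pred : residue (N.pred p) = -1.
Proof.
apply/eqP; rewrite -subr_eq0 opprK -[X in _ + X]/(residue 1) -residueD.
by rewrite N.add_1_r N.succ_pred ?residue_char //; apply: bin_prime_neq0.
Qed.

Lemma residue_neg m : residue (negp p m) = - residue m.
Proof. by rewrite /negp residue_mod residueM residue_pred mulN1r. Qed.

Lemma residue_congr m n : congr_p p m n -> residue m = residue n.
Proof. by move=> /eqP mnE; rewrite -residue_mod mnE residue_mod. Qed.

Variable i : F.
Hypothesis iE : i ^+ 2 = -1.

Definition gauss (u : N * N) : F := residue u.1 + i * residue u.2.

Lemma gaussM u v : gauss (gauss_mul p u v) = gauss u * gauss v.
Proof.
rewrite /gauss /gauss_mul /= !residue_mod !residueD !residueM residue_pred -iE.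
by ring.
Qed.

Lemma gauss_scaleE m u : gauss (gauss_scale p m u) = residue m * gauss u.
Proof. by rewrite /gauss /gauss_scale /= !residue_mod !residueM; ring. Qed.

Let nz2 : (2%:R : F) != 0.
Proof. exact: two_neq0 pr_p p3. Qed.

(** Each step preserves legendre_sum, and the last curve, with k^2 = -1, is y^2
    = x^3 - x. *)
Lemma agm_pathP k ks : gauss k != 0 -> agm_path p k ks ->
  legendre_sum (gauss k) = 2%:R * (nat_of_bin p)%:Z.
Proof.
elim: ks k => [|l ks IH] k nzk /=.
  move=> /eqP kE; rewrite -(sum_chi_1728 j pr_p p3 cardF); apply: eq_bigr => x _.
  have -> : gauss k ^+ 2 = -1.
    by rewrite expr2 -gaussM kE /gauss /= residue_pred mulr0 addr0.
  by congr chi; ring.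
move=> /andP[/eqP klE /IH <-]; last first.
  apply/eqP => l0; have := congr1 gauss klE; rewrite !gaussM l0 gauss_scaleE !mul0r.
  move/eqP; rewrite eq_sym mulf_eq0 (negPf nzk) orbF.
  by rewrite -[residue 4]/(4%:R : F) (natrX _ 2 2) expf_eq0 (negPf nz2).
apply: legendre_sum_agm => //.
have := congr1 gauss klE; rewrite !gaussM gauss_scaleE => E.
rewrite !expr2 -[4%:R]/(residue 4) -E.
have -> : 1 + gauss k = gauss ((1 + k.1)%num, k.2) by rewrite /gauss residueD addrA.
by [].
Qed.

(** The difference b - a of two roots is in F_p, hence a square in F, so that
    the cubic is a Legendre curve over F and not a twist of one. *)
Lemma supersingular_pathP a b c ks : supersingular_path p a b c ks ->
  cubic_sum (residue a) (residue b) (residue c) = 2%:R * (nat_of_bin p)%:Z.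
Proof.
rewrite /supersingular_path; case: ks => // k ks /and4P[].
set d := N.modulo _ p; set d' := N.modulo _ p => nzd nzd' /eqP kE path_k.
have dE : residue d = residue b - residue a.
  by rewrite /d residue_mod residueD residue_neg.
have d'E : residue d' = residue c - residue a.
  by rewrite /d' residue_mod residueD residue_neg.
have mod_mod n : N.modulo (N.modulo n p) p = N.modulo n p.
  by apply: N.Div0.mod_mod.
have nzrd : residue d != 0 by rewrite residue_eq0 /d mod_mod.
have nzrd' : residue d' != 0 by rewrite residue_eq0 /d' mod_mod.
have {}kE : gauss k ^+ 2 * residue d = residue d'.
  have := congr1 gauss kE; rewrite !gaussM /gauss /= -[residue 0]/(0 : F).
  by rewrite !mulr0 !addr0 -expr2.
have nzk : gauss k != 0.
  by apply: contra_neq nzrd' => k0; rewrite -kE k0 expr0n mul0r.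
rewrite -(agm_pathP nzk path_k).
have [s sE] : exists s : F, s ^+ 2 = residue d.
  have [dE'|dE'] := prime_field_sqrt ((nat_of_bin d)%:R : 'F_p) pr_p p3.
    exists (j ((nat_of_bin d)%:R ^+ (p %/ 4)%N.+1)).
    by rewrite -rmorphXn -dE' rmorph_nat.
  exists (i * j ((nat_of_bin d)%:R ^+ (p %/ 4)%N.+1)).
  by rewrite exprMn iE mulN1r -rmorphXn -rmorphN -dE' rmorph_nat.
apply: (cubic_sum_legendre nz2 (d := s)); rewrite -?dE -?d'E ?sE //.
by apply: contra_neq nzrd => s0; rewrite -sE s0 expr0n.
Qed.

Theorem check_certificateP r1 r2 r3 e ws :
  check_certificate (Certificate p (r1, r2, r3) e ws) ->
  \sum_x chi (curve_poly (residue (r1 + r2 + r3))).[x] = (10%:R * (nat_of_bin p)%:Z - 1).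
Proof.
case: ws => [[w0 w1] w2] /and5P[_ nze _ /residue_congr s2 /and5P[]].
move=> /residue_congr s3 /residue_congr e1 /residue_congr e2.
move=> /supersingular_pathP E0 /andP[/supersingular_pathP E1 /supersingular_pathP E2].
rewrite !(residueD, residueM, residue_neg) -?[residue 0]/(0 : F) in s2 s3 e1 e2 E0 E1 E2 *.
rewrite -[residue 2]/(2%:R : F) -?[residue 4]/(4%:R : F) -?[residue 36]/(36%:R : F)
  in s2 s3 e1 e2 E1 E2 *.
rewrite -residue_eq0 in nze.
move: (residue r1) (residue r2) (residue r3) (residue e) => x1 x2 x3 eps in s2 s3 e1 e2 nze E0 E1 E2 *.
have G_roots s : quotient_cubic (x1 + x2 + x3) s = (s - x1) * (s - x2) * (s - x3).
  rewrite /quotient_cubic.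
  transitivity ((s - x1) * (s - x2) * (s - x3)
    - (x1 * x2 + x1 * x3 + x2 * x3 + 36%:R) * s + (x1 * x2 * x3 + 4%:R * (x1 + x2 + x3))).
    ring.
  by rewrite s2 s3; ring.
rewrite (sum_chi_curve nz2 iE).
rewrite (sum_chi_sextic nz2 G_roots nze); first last.
- transitivity ((eps * eps + 2%:R * x3 + x1 * x3) - (2%:R * x3 + x1 * x3)); first by ring.
  by rewrite e2; ring.
- transitivity ((eps * eps + 2%:R * x1 + x1 * x2) - (2%:R * x1 + x1 * x2)); first by ring.
  by rewrite e1; ring.
have -> : x3 - 2%:R - 2%:R * x1 = - 2%:R + x3 - 2%:R * x1 by ring.
rewrite E1 E2 (eq_bigr (fun s => chi ((s - x1) * (s - x2) * (s - x3)))); last first.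
  by move=> s _; rewrite G_roots.
by rewrite -/(cubic_sum x1 x2 x3) E0; ring.
Qed.

(** The curves for a and -a are isomorphic by X -> i X. *)
Lemma sum_chi_curveN a : \sum_x chi (curve_poly (- a)).[x] = \sum_x chi (curve_poly a).[x].
Proof.
have nzi : i != 0.
  by apply/eqP => i0; have := oner_neq0 F; rewrite -oppr_eq0 -iE i0 expr0n eqxx.
rewrite [LHS](reindex_inj (mulfI nzi)) /=; apply: eq_bigr => x _; congr chi.
rewrite /curve_poly !horner_Poly /=.
have i4 n : i ^+ (4 * n) = 1 by rewrite exprM -[4%N]/(2 * 2)%N exprM iE sqrrN !expr1n.
transitivity (i ^+ (4 * 3) * x ^+ 12 + a * (i ^+ (4 * 2) * i ^+ 2) * x ^+ 10
  - 33%:R * i ^+ (4 * 2) * x ^+ 8 - 2%:R * a * (i ^+ (4 * 1) * i ^+ 2) * x ^+ 6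
  - 33%:R * i ^+ (4 * 1) * x ^+ 4 + a * i ^+ 2 * x ^+ 2 + 1); first by ring.
by rewrite !i4 iE; ring.
Qed.

End Soundness.

(** * The tables *)

(** The chains were found by breadth-first search in the graph of 2-isogenies between
    supersingular curves; their lengths are of the order of log p. *)
Definition certificates : seq certificate := [::
  Certificate 11 (0,6,5) 1 ([:: (0,1)], [:: (0,4); (8,6); (0,1)], [:: (0,3); (8,5); (0,10)]);
  Certificate 23 (0,6,17) 9 ([:: (0,1)], [:: (0,9); (15,11); (7,0); (0,1)], [:: (0,18); (15,12);
    (7,0); (0,1)]);
  Certificate 71 (15,35,47) 38 ([:: (32,0); (10,0); (21,0); (0,70)], [:: (64,0); (21,0); (0,70)],
    [:: (17,0); (0,30); (57,36); (64,0); (21,0); (0,70)]);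
  Certificate 131 (17,93,77) 63 ([:: (0,12); (31,120); (110,43); (128,56); (0,1)], [:: (0,11);
    (31,11); (110,88); (128,75); (0,130)], [:: (0,63); (115,68); (73,82); (0,35); (114,113); (87,9);
    (128,75); (0,130)]);
  Certificate 251 (94,227,211) 125 ([:: (0,117); (220,68); (204,157); (0,181); (84,18); (79,170);
    (0,123); (51,237); (233,195); (248,182); (0,1)], [:: (0,80); (225,21); (235,188); (106,98);
    (233,195); (248,182); (0,1)], [:: (0,118); (220,183); (204,94); (0,70); (84,233); (79,81);
    (0,128); (51,14); (233,56); (248,69); (0,250)]);
  Certificate 263 (7,100,234) 18 ([:: (0,166); (251,78); (192,41); (180,198); (106,259); (43,16);
    (217,0); (0,1)], [:: (0,34); (131,147); (239,206); (80,175); (106,259); (43,16); (217,0);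
    (0,1)], [:: (0,172); (202,226); (138,183); (110,123); (135,221); (176,0); (40,0); (0,262)]);
  Certificate 491 (189,334,205) 101 ([:: (0,215); (11,135); (301,8); (297,92); (16,205); (177,131);
    (401,46); (488,188); (0,1)], [:: (0,225); (257,176); (463,94); (341,225); (348,268); (469,388);
    (156,444); (488,303); (0,490)], [:: (0,293); (41,85); (388,326); (156,444); (488,303); (0,490)]);
  Certificate 599 (220,509,493) 318 ([:: (0,25); (289,194); (93,34); (242,555); (264,0); (0,1)], [::
    (0,24); (289,405); (93,565); (242,44); (264,0); (0,1)], [:: (0,128); (205,100); (445,454);
    (96,319); (93,34); (242,555); (264,0); (0,1)]);
  Certificate 1031 (44,194,943) 960 ([:: (0,159); (1022,1027); (466,1021); (746,684); (383,687);
    (150,350); (205,103); (22,564); (82,0); (0,1)], [:: (0,192); (478,793); (562,22); (29,622);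
    (568,640); (22,564); (82,0); (0,1)], [:: (0,777); (1008,773); (583,244); (927,374); (733,99);
    (496,813); (422,641); (205,928); (22,467); (82,0); (0,1)]);
  Certificate 1283 (228,770,292) 1257 ([:: (0,469); (450,748); (195,35); (1086,376); (834,573);
    (1194,244); (1126,326); (980,819); (802,630); (1280,947); (0,1282)], [:: (0,664); (902,419);
    (71,329); (1062,331); (12,241); (1126,957); (980,464); (802,653); (1280,336); (0,1)], [::
    (0,625); (602,20); (322,192); (12,241); (1126,957); (980,464); (802,653); (1280,336); (0,1)]);
  Certificate 1439 (68,303,84) 148 ([:: (553,0); (0,687); (957,771); (850,1169); (169,93);
    (1062,563); (1169,840); (1051,0); (0,1438)], [:: (562,0); (882,0); (1132,0); (0,640); (943,252);
    (800,246); (500,1249); (1062,563); (1169,840); (1051,0); (0,1438)], [:: (913,0); (179,0);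
    (837,0); (346,0); (1089,0); (1299,0); (382,0); (0,1)]);
  Certificate 1583 (132,144,1514) 369 ([:: (0,876); (1222,1232); (1575,1568); (843,1073);
    (1405,265); (880,41); (852,488); (461,0); (0,1582)], [:: (0,709); (1524,1187); (822,207);
    (1027,867); (562,801); (710,1291); (1241,63); (1485,1217); (852,488); (461,0); (0,1582)], [::
    (0,312); (1109,1265); (167,835); (58,992); (1246,1012); (759,208); (467,91); (997,0); (1116,0);
    (0,1)]);
  Certificate 2039 (1113,1580,1838) 85 ([:: (734,0); (0,850); (1405,1658); (711,1854); (383,1167);
    (1140,650); (260,578); (582,0); (1399,0); (0,2038)], [:: (1167,0); (973,0); (0,491);
    (1760,1143); (956,1198); (1580,1205); (1996,994); (1613,1009); (1963,639); (1560,1295); (634,0);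
    (0,1)], [:: (225,0); (54,0); (508,0); (1399,0); (0,2038)]);
  Certificate 2087 (1525,1789,1612) 311 ([:: (876,0); (0,1658); (801,1253); (620,1204); (1778,1833);
    (1539,2072); (408,0); (1101,0); (0,2086)], [:: (1890,0); (1739,0); (0,382); (1072,4);
    (1471,1190); (1895,895); (1378,1122); (1394,43); (980,0); (0,1)], [:: (29,0); (1110,0);
    (1101,0); (0,2086)]);
  Certificate 2543 (810,1131,1167) 1059 ([:: (2339,0); (845,0); (0,648); (1877,1765); (650,2446);
    (1514,750); (460,1946); (105,1545); (315,0); (703,0); (0,1)], [:: (1167,0); (1793,0); (497,0);
    (1437,0); (703,0); (0,1)], [:: (685,0); (0,1984); (993,1271); (1380,0); (497,0); (1437,0);
    (703,0); (0,1)]);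
  Certificate 2843 (438,1589,1501) 832 ([:: (0,366); (249,2073); (1943,1456); (2692,2421);
    (134,2460); (2557,198); (575,708); (2367,1433); (2687,2289); (1675,2342); (1864,2522);
    (620,2356); (2840,1560); (0,2842)], [:: (0,190); (1824,670); (42,2077); (473,1029); (1943,2471);
    (7,585); (2404,2347); (1883,2224); (7,1250); (434,341); (2786,2255); (2289,1875); (2840,1283);
    (0,1)], [:: (0,1264); (2719,891); (2371,2677); (2252,744); (478,1324); (1639,2573); (543,1561);
    (1864,2522); (620,2356); (2840,1560); (0,2842)]);
  Certificate 3371 (1029,2230,1045) 2070 ([:: (0,1605); (2471,2369); (2851,3295); (2200,3168);
    (0,2788); (2130,2172); (216,1248); (822,265); (3242,834); (1806,1946); (2890,1462); (1464,1173);
    (78,1335); (3368,1069); (0,1)], [:: (0,182); (1638,967); (3144,160); (2447,477); (1605,1988);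
    (2128,2992); (1070,1348); (2053,3121); (1160,44); (3359,724); (3368,1069); (0,1)], [:: (0,2503);
    (2195,262); (842,1513); (1160,44); (3359,724); (3368,1069); (0,1)]);
  Certificate 5639 (1560,3697,1576) 3132 ([:: (1800,0); (4724,0); (0,5451); (2772,863); (411,1158);
    (5258,652); (1036,995); (5389,398); (5419,2519); (5075,3788); (1357,0); (0,1)], [:: (175,0);
    (0,858); (4254,1303); (3836,3244); (2538,536); (4563,4629); (5270,2469); (1733,2272); (5154,0);
    (2844,0); (1693,0); (4276,0); (0,5638)], [:: (4603,0); (0,4243); (5024,5406); (401,319);
    (336,5108); (443,3113); (3845,4645); (1793,2872); (5075,1851); (1357,0); (0,1)]);
  Certificate 5879 (1721,2734,2718) 1005 ([:: (0,681); (5562,3609); (2834,2659); (1558,3032);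
    (4189,2451); (5724,5662); (3733,5587); (1890,2622); (2912,0); (1401,0); (5115,0); (1142,0);
    (0,5878)], [:: (0,3402); (4376,3323); (1235,2154); (4494,5068); (5008,133); (5634,568);
    (1356,5401); (1924,1035); (2934,3657); (3930,2159); (4731,0); (0,1)], [:: (0,682); (5562,2270);
    (2834,3220); (1558,2847); (4189,3428); (5724,217); (3733,292); (1890,3257); (2912,0); (1401,0);
    (5115,0); (1142,0); (0,5878)]);
  Certificate 6971 (326,1461,342) 6307 ([:: (0,756); (4944,636); (6510,4900); (701,6804);
    (2868,5236); (6889,2666); (2387,5040); (3816,3037); (6295,114); (6709,5940); (2755,617);
    (6968,2245); (0,6970)], [:: (0,3920); (5453,4650); (1273,5822); (6464,6115); (107,6317);
    (2461,4593); (4634,4730); (3816,3037); (6295,114); (6709,5940); (2755,617); (6968,2245);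
    (0,6970)], [:: (0,9); (3412,4265); (6444,2161); (4326,1987); (3268,4035); (6562,1300);
    (4229,3604); (2936,2761); (2755,617); (6968,2245); (0,6970)]);
  Certificate 7079 (2639,6124,6108) 3602 ([:: (0,2011); (55,5483); (940,6890); (3904,4519);
    (1681,5271); (1752,6513); (6179,6393); (3771,6491); (416,7030); (2479,1366); (4053,3517);
    (6539,4783); (4276,6021); (4480,0); (0,1)], [:: (0,2010); (55,1596); (940,189); (3904,2560);
    (1681,1808); (1752,566); (6179,686); (3771,588); (416,49); (2479,5713); (4053,3562);
    (6539,2296); (4276,1058); (4480,0); (0,1)], [:: (0,2979); (5366,3598); (5405,3691); (3433,5244);
    (1722,7015); (3440,5814); (1047,3759); (6539,2296); (4276,1058); (4480,0); (0,1)]);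
  Certificate 7823 (2813,3794,3926) 5543 ([:: (1140,0); (0,7822)], [:: (4119,0); (2158,0); (0,4684);
    (6066,6779); (1882,4809); (5023,5403); (5798,887); (5020,3094); (988,0); (2230,0); (3554,0);
    (6677,0); (0,1)], [:: (4817,0); (6929,0); (5874,0); (1184,0); (267,0); (3537,0); (0,4156);
    (3190,389); (5898,1884); (1920,7541); (6835,1081); (5964,5553); (5926,6747); (1140,0);
    (0,7822)]);
  Certificate 8039 (3679,3953,3695) 669 ([:: (1250,0); (682,0); (2938,0); (0,4494); (6649,234);
    (282,3152); (5798,5354); (3785,5510); (1978,7272); (377,597); (5681,5728); (5827,0); (0,1)], [::
    (1102,0); (6397,0); (0,5189); (317,4411); (5575,7060); (141,2898); (3453,439); (2945,7783);
    (7648,5000); (6214,3195); (1142,196); (5681,5728); (5827,0); (0,1)], [:: (6005,0); (0,5763);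
    (3921,2270); (6394,434); (647,2882); (3790,3183); (871,6233); (2219,2856); (6313,794); (6615,0);
    (2206,0); (0,8038)]);
  Certificate 8291 (2527,4352,4336) 1817 ([:: (0,5231); (6313,5434); (5952,6478); (4645,4455);
    (780,5425); (8028,5007); (225,8171); (6227,4929); (5586,6008); (483,4863); (191,2349);
    (833,5746); (8288,6100); (0,8290)], [:: (0,1279); (6413,1778); (4178,4799); (1051,5625);
    (7439,7950); (5109,4144); (3145,3648); (833,2545); (8288,2191); (0,1)], [:: (0,5232);
    (6313,2857); (5952,1813); (4645,3836); (780,2866); (8028,3284); (225,120); (6227,3362);
    (5586,2283); (483,3428); (191,5942); (833,2545); (8288,2191); (0,1)]);
  Certificate 9839 (2860,6477,2876) 4107 ([:: (6107,0); (0,7278); (9681,4512); (7823,6143);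
    (1576,7172); (8271,887); (8542,1029); (5184,1559); (6600,8926); (3004,0); (0,9838)], [::
    (1601,0); (8141,0); (0,9282); (3816,5443); (7419,4535); (7531,769); (2343,7192); (4028,7535);
    (2532,9178); (3345,0); (4130,0); (6829,0); (0,1)], [:: (7609,0); (0,7711); (2452,4155);
    (4762,6537); (1764,2313); (8634,8568); (3290,641); (2532,9178); (3345,0); (4130,0); (6829,0);
    (0,1)]);
  Certificate 9851 (960,7196,4651) 8499 ([:: (0,8049); (392,8598); (6574,7199); (7841,3387);
    (6467,5224); (1797,1851); (3992,9556); (8815,5939); (9821,322); (5540,7012); (6532,1116);
    (8060,1011); (9848,3980); (0,1)], [:: (0,6758); (860,7119); (3248,1094); (37,7165); (6990,654);
    (4535,4981); (4859,3555); (5540,7012); (6532,1116); (8060,1011); (9848,3980); (0,1)], [::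
    (0,5167); (4545,4890); (5930,1010); (1247,8067); (149,1267); (2246,4333); (9128,3608);
    (8132,9622); (5463,3591); (9044,6001); (8915,9839); (9379,8789); (1857,5850); (9848,3980);
    (0,1)]);
  Certificate 10799 (3112,4769,4753) 1649 ([:: (0,9289); (5995,9827); (6855,4596); (4883,4838);
    (2950,2640); (2670,455); (9714,1762); (9187,9290); (10571,6236); (1226,5387); (1950,1896);
    (4333,0); (5534,0); (0,1)], [:: (0,3246); (6912,2970); (4463,7461); (4915,461); (9589,4046);
    (172,1290); (7706,9820); (9530,5084); (1389,8325); (9182,3668); (5259,0); (0,10798)], [::
    (0,9290); (5995,972); (6855,6203); (4883,5961); (2950,8159); (2670,10344); (9714,9037);
    (9187,1509); (10571,4563); (1226,5412); (1950,8903); (4333,0); (5534,0); (0,1)]);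
  Certificate 10859 (1160,7950,5310) 8422 ([:: (0,2401); (3550,8530); (2431,2814); (5868,8038);
    (6020,4179); (7321,4788); (902,2893); (3611,8990); (3086,10076); (9266,4005); (10386,2293);
    (10856,1425); (0,10858)], [:: (0,5240); (3398,7153); (6360,6327); (3465,6183); (10086,10632);
    (5803,10857); (9266,4005); (10386,2293); (10856,1425); (0,10858)], [:: (0,7598); (2015,2593);
    (3798,184); (10798,1047); (10209,1327); (7005,7759); (8237,2087); (3328,3531); (2849,4259);
    (5879,9216); (9570,538); (964,1557); (539,10189); (10856,1425); (0,10858)]);
  Certificate 11171 (8458,10630,8474) 5414 ([:: (0,4679); (5605,6362); (764,10750); (2101,8544);
    (7760,1843); (3032,11062); (0,8212); (9343,10334); (7269,8647); (3160,2494); (621,671);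
    (3332,6611); (11168,8810); (0,1)], [:: (0,5023); (6574,3805); (742,7337); (1555,1013);
    (5367,8185); (7452,5033); (8832,3973); (7905,7420); (11168,2361); (0,11170)], [:: (0,3258);
    (10799,4481); (10676,6288); (8742,1279); (9915,4428); (111,6854); (10380,9492); (8585,7422);
    (8832,3973); (7905,7420); (11168,2361); (0,11170)]);
  Certificate 12107 (2196,4843,6733) 9806 ([:: (0,6362); (11161,7946); (571,8524); (11135,4384);
    (4331,4639); (9274,855); (1876,256); (3200,1648); (4814,7075); (1914,5936); (6887,9937);
    (4861,10526); (5450,11294); (12104,1877); (0,1)], [:: (0,7542); (176,9345); (8464,11766);
    (176,239); (839,2173); (8376,6496); (4248,4012); (7982,3831); (9212,3453); (7312,6281);
    (5450,11294); (12104,1877); (0,1)], [:: (0,10537); (1904,6749); (5017,6645); (6394,10742);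
    (7079,1392); (720,5749); (8420,5546); (10302,4787); (2286,2008); (10114,4054); (6723,9540);
    (12104,1877); (0,1)]);
  Certificate 12119 (3697,6374,6358) 2669 ([:: (0,1591); (9537,3340); (942,7512); (9595,12055);
    (9796,9924); (5167,7843); (8047,4131); (819,4695); (5244,11013); (8867,7686); (6815,6676);
    (7493,1699); (8698,0); (0,1)], [:: (0,7952); (723,8091); (5721,9926); (8101,1451); (2952,404);
    (4661,3526); (7925,7436); (4156,6475); (1562,4039); (3771,3645); (3030,5989); (10979,10169);
    (5622,0); (11804,0); (2536,0); (3415,0); (0,12118)], [:: (0,1592); (9537,8779); (942,4607);
    (9595,64); (9796,2195); (5167,4276); (8047,7988); (819,7424); (5244,1106); (8867,4433);
    (6815,5443); (7493,10420); (8698,0); (0,1)]);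
  Certificate 14879 (2927,14643,14627) 3171 ([:: (0,7501); (1896,10544); (13409,8370); (13119,4188);
    (10017,4002); (5080,758); (5166,6438); (8492,13336); (10334,3629); (5860,4819); (7053,360);
    (582,0); (0,14878)], [:: (0,7500); (1896,4335); (13409,6509); (13119,10691); (10017,10877);
    (5080,14121); (5166,8441); (8492,1543); (10334,11250); (5860,10060); (7053,14519); (582,0);
    (0,14878)], [:: (0,7750); (9036,5089); (11999,9265); (6717,2904); (14190,14157); (5385,6802);
    (4972,13802); (9851,4829); (7507,7698); (10241,2701); (9328,6857); (7879,0); (14291,0); (0,1)]);
  Certificate 15647 (620,1112,3071) 10816 ([:: (14192,0); (0,6010); (3334,14092); (10964,12849);
    (5996,1373); (8914,15467); (15461,15061); (11151,15479); (14055,4599); (13608,12418);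
    (13400,2449); (10014,10882); (8553,0); (7986,0); (0,1)], [:: (13720,0); (12680,0); (3506,0);
    (3894,0); (1146,0); (4176,0); (728,0); (10736,0); (11132,0); (7986,0); (0,1)], [:: (4927,0);
    (0,5249); (8002,10086); (15625,5524); (11899,4441); (235,11982); (14261,7195); (14476,7679);
    (8002,4501); (11618,2699); (1569,0); (10736,0); (11132,0); (7986,0); (0,1)]);
  Certificate 16931 (193,973,957) 16159 ([:: (0,3992); (6014,5474); (2142,5281); (1108,16403);
    (13204,10576); (5283,2546); (7625,9084); (1554,9710); (16928,6659); (0,1)], [:: (0,3991);
    (6014,11457); (2142,11650); (1108,528); (13204,6355); (5283,14385); (7625,7847); (1554,7221);
    (16928,10272); (0,16930)], [:: (0,3032); (3272,12558); (4520,3665); (7210,1036); (14283,6337);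
    (5899,6578); (2616,2600); (9853,8784); (15793,3477); (3749,16544); (7625,9084); (1554,9710);
    (16928,6659); (0,1)]);
  Certificate 17159 (563,3546,579) 16021 ([:: (13745,0); (15556,0); (1718,0); (0,7356); (2828,7777);
    (9305,2494); (11060,12227); (3156,5271); (7698,16949); (1710,9864); (13577,4619); (3177,6421);
    (259,0); (0,1)], [:: (13673,0); (0,11183); (9240,1440); (16826,11229); (11351,16836);
    (2970,9551); (11047,283); (14141,7435); (12232,823); (11719,12415); (13577,4619); (3177,6421);
    (259,0); (0,1)], [:: (13769,0); (8007,0); (0,2043); (15043,14688); (15054,5160); (12497,9216);
    (9418,14102); (14586,14519); (9402,0); (6803,0); (16894,0); (0,17158)]);
  Certificate 18719 (5466,7809,14298) 11132 ([:: (6201,0); (410,0); (15316,0); (13386,0); (2294,0);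
    (2995,0); (0,7800); (7295,14015); (1163,16985); (7590,10519); (16907,15290); (7152,9639);
    (93,0); (15027,0); (0,1)], [:: (18218,0); (0,7556); (12613,3600); (12411,5689); (3484,15874);
    (11825,15843); (5481,9248); (3876,6299); (8447,18045); (4517,0); (477,0); (10529,0); (5032,0);
    (15027,0); (0,1)], [:: (16374,0); (0,7152); (2861,7660); (10214,3662); (17055,15132);
    (15681,4053); (15744,9282); (263,16729); (7590,10519); (16907,15290); (7152,9639); (93,0);
    (15027,0); (0,1)]);
  Certificate 18839 (2136,15500,2152) 4284 ([:: (11790,0); (17234,0); (0,13496); (7046,3504);
    (10958,14305); (1539,986); (13442,6965); (3925,1743); (7582,3897); (7265,17453); (8396,4121);
    (13995,6847); (8391,5242); (10113,0); (0,1)], [:: (2480,0); (12653,0); (0,14805); (9660,2932);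
    (13048,4213); (10312,12384); (2549,11593); (8625,1858); (8391,5242); (10113,0); (0,1)], [::
    (16922,0); (16632,0); (0,9707); (5872,4565); (8203,12005); (3424,14908); (13934,15833);
    (11292,477); (14696,17619); (8802,9993); (2549,11593); (8625,1858); (8391,5242); (10113,0);
    (0,1)]);
  Certificate 23039 (2575,12883,12867) 10300 ([:: (0,8978); (16945,17480); (959,7815); (6150,19360);
    (18546,2108); (14120,10761); (14113,0); (17515,0); (14930,0); (0,1)], [:: (0,21848);
    (19757,12658); (21228,6112); (4517,14338); (18586,7192); (19784,21285); (14097,9084);
    (18170,4988); (9567,22648); (3499,2196); (19366,17483); (14904,15253); (13260,483);
    (21879,17252); (18397,0); (14930,0); (0,1)], [:: (0,8979); (16945,5559); (959,15224);
    (6150,3679); (18546,20931); (14120,12278); (14113,0); (17515,0); (14930,0); (0,1)]);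
  Certificate 23159 (15821,21693,15837) 8495 ([:: (13202,0); (0,15100); (11287,17692); (7454,13764);
    (6667,6454); (10623,12167); (10363,16205); (9743,6271); (2890,19598); (272,22863);
    (22146,12595); (15750,22385); (9786,18185); (12902,3193); (10719,0); (0,1)], [:: (21270,0);
    (9085,0); (9586,0); (9279,0); (0,17900); (1340,5214); (8142,6179); (3779,22936); (12366,374);
    (10762,0); (12128,0); (12271,0); (11754,0); (12434,0); (0,23158)], [:: (12157,0); (0,16730);
    (18620,19031); (6719,10632); (20422,8342); (21935,19888); (4318,9280); (1803,22727);
    (18404,6309); (22238,0); (11754,0); (12434,0); (0,23158)]);
  Certificate 23459 (4224,5321,19986) 3840 ([:: (0,16469); (18922,21591); (16018,6516);
    (1585,10812); (887,22890); (6622,12592); (20828,7601); (5555,20892); (16048,21090);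
    (7338,20686); (7781,15757); (6758,11603); (23456,18706); (0,23458)], [:: (0,3747); (19204,3195);
    (6369,19157); (15552,858); (10073,682); (6148,20139); (5170,1633); (16767,8380); (23456,4753);
    (0,1)], [:: (0,13075); (11948,17523); (17844,10181); (14664,6180); (16127,12006); (6867,20130);
    (22066,5930); (13750,20999); (22752,9155); (4484,19871); (22713,6933); (11911,13557);
    (14674,9466); (6758,11603); (23456,18706); (0,23458)]);
  Certificate 25463 (4573,14526,17712) 5102 ([:: (21402,0); (12603,0); (7877,0); (0,21034);
    (2935,15464); (12708,14775); (20909,11208); (6886,25077); (16805,16872); (12149,20836);
    (16763,2628); (1506,18890); (1378,10353); (2231,0); (0,1)], [:: (2683,0); (0,6043);
    (14883,7223); (2470,7233); (18015,2607); (16431,1359); (16994,1621); (7687,24370); (17351,5192);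
    (215,13712); (20308,25416); (23038,1326); (23741,0); (23226,0); (0,25462)], [:: (21747,0);
    (0,13817); (3325,13883); (16407,1447); (2667,17800); (8871,19456); (4396,16429); (3857,8822);
    (12149,20836); (16763,2628); (1506,18890); (1378,10353); (2231,0); (0,1)]);
  Certificate 25919 (144,728,712) 576 ([:: (0,13139); (13653,15002); (16203,20814); (1110,9628);
    (14041,2181); (6726,1601); (15663,13041); (21348,23225); (22088,3617); (25594,0); (0,25918)],
    [:: (0,13854); (2723,6820); (17650,15283); (13608,12271); (22679,16289); (19496,21253);
    (22601,2688); (4113,4851); (1891,11452); (14041,23738); (6726,24318); (15663,12878);
    (21348,2694); (22088,22302); (25594,0); (0,25918)], [:: (0,13140); (13653,10917); (16203,5105);
    (1110,16291); (14041,23738); (6726,24318); (15663,12878); (21348,2694); (22088,22302);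
    (25594,0); (0,25918)]);
  Certificate 26723 (7911,24616,24719) 15740 ([:: (0,15538); (7246,26151); (12027,24809);
    (302,7990); (1823,1897); (19502,13002); (12506,8304); (1627,21607); (17220,20302);
    (16084,21930); (12561,13454); (4533,13331); (3824,15430); (26720,18439); (0,1)], [:: (0,6313);
    (1062,4263); (23572,17046); (14798,15030); (420,1822); (10105,5424); (9908,19335); (5171,12683);
    (19347,21991); (17220,20302); (16084,21930); (12561,13454); (4533,13331); (3824,15430);
    (26720,18439); (0,1)], [:: (0,25515); (1295,26336); (24546,18820); (8775,3324); (19932,25873);
    (10925,17121); (19740,4839); (17292,15665); (1205,25049); (25279,1085); (4533,13331);
    (3824,15430); (26720,18439); (0,1)]);
  Certificate 27791 (15268,18745,22162) 5695 ([:: (6770,0); (11809,0); (0,20398); (12947,20713);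
    (25092,9237); (10282,8307); (17162,24677); (14485,25740); (1716,14141); (21084,6210);
    (12516,26130); (7985,0); (0,27790)], [:: (10986,0); (25140,0); (0,26098); (26530,12530);
    (2475,14816); (4668,11639); (15758,18402); (3236,18242); (24436,15859); (12418,0); (19800,0);
    (0,1)], [:: (7295,0); (25683,0); (0,1191); (18867,19727); (7789,22236); (7910,9417);
    (8712,18686); (8992,15378); (4235,3033); (3236,18242); (24436,15859); (12418,0); (19800,0);
    (0,1)]);
  Certificate 29759 (13496,23410,27133) 4153 ([:: (28390,0); (0,27105); (22808,21875);
    (11657,14516); (28447,17421); (12696,2998); (22328,17547); (23366,14337); (9465,11079);
    (18230,0); (4055,0); (23343,0); (1003,0); (19999,0); (0,1)], [:: (331,0); (268,0); (28164,0);
    (10040,0); (13821,0); (0,21900); (10045,11448); (3976,24927); (20518,5766); (19853,19699);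
    (11085,16455); (28297,19742); (27840,1860); (9754,0); (0,29758)], [:: (16764,0); (7866,0);
    (0,12216); (29194,5651); (23861,1970); (23349,29233); (22682,7667); (13606,2786); (5092,19702);
    (11491,4728); (28297,19742); (27840,1860); (9754,0); (0,29758)]);
  Certificate 31511 (6392,10334,15723) 8632 ([:: (21344,0); (6229,0); (22315,0); (6393,0);
    (0,19153); (4305,23447); (7637,5691); (21105,30420); (872,24633); (16608,2429); (8166,30529);
    (114,12270); (8678,3309); (26676,8611); (10095,0); (0,1)], [:: (16333,0); (0,5806);
    (4305,23447); (7637,5691); (21105,30420); (872,24633); (16608,2429); (8166,30529); (114,12270);
    (8678,3309); (26676,8611); (10095,0); (0,1)], [:: (6385,0); (0,27003); (2218,18525);
    (19761,21810); (3381,7884); (8166,8754); (4493,16229); (16387,0); (13494,0); (13865,0);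
    (8692,0); (26433,0); (14071,0); (16265,0); (21410,0); (0,31510)]);
  Certificate 32579 (17659,24870,29873) 18626 ([:: (0,32553); (27911,21017); (14980,23065);
    (16254,1105); (20131,733); (25955,10428); (705,4207); (31107,28491); (2220,12157);
    (31267,14527); (15694,2217); (21767,26701); (16615,673); (32576,1289); (0,32578)], [:: (0,9926);
    (13378,14976); (19740,31548); (20808,29315); (19412,2665); (457,8458); (29453,5831);
    (8226,24005); (19871,23072); (6051,30221); (4885,10090); (20018,9068); (17862,28892);
    (16030,30263); (32576,1289); (0,32578)], [:: (0,20028); (15604,12653); (2730,7002);
    (28867,11176); (27646,22194); (30117,31089); (15168,16861); (16894,23987); (28656,5406);
    (6939,28019); (24348,6587); (21255,18075); (17862,3687); (16030,2316); (32576,31290); (0,1)]);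
  Certificate 33791 (3427,7654,25328) 1555 ([:: (15590,0); (26780,0); (0,28520); (10428,58);
    (7977,21546); (33328,33421); (4344,14514); (27212,29533); (22130,30884); (2355,29218); (1807,0);
    (2047,0); (11434,0); (0,1)], [:: (33332,0); (12768,0); (4112,0); (30150,0); (0,12453);
    (17521,13120); (24138,27432); (23891,16899); (17588,17489); (29941,15271); (4604,0); (3715,0);
    (33604,0); (2047,0); (11434,0); (0,1)], [:: (25102,0); (0,26441); (33502,24451); (10895,31567);
    (30468,20712); (26929,6438); (14419,19666); (12272,8823); (2355,4573); (1807,0); (2047,0);
    (11434,0); (0,1)]);
  Certificate 34283 (67,24787,12920) 15550 ([:: (0,6228); (15383,7994); (5133,13194); (1407,25431);
    (8749,1805); (25004,31254); (33299,21647); (29258,9482); (33458,10351); (21531,3519);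
    (28581,12481); (26736,16795); (219,8933); (34280,25914); (0,34282)], [:: (0,24766); (1820,2540);
    (9415,7974); (19069,31854); (34136,33201); (28636,11933); (22635,26773); (21397,28802);
    (1605,27996); (15005,17856); (31951,25083); (16927,5635); (34130,30192); (34280,25914);
    (0,34282)], [:: (0,31107); (20555,30923); (14452,28331); (9300,23515); (2121,3110);
    (27948,12686); (32625,20522); (6833,15741); (12177,21839); (15789,28730); (29613,19800);
    (19528,16794); (27206,32356); (7907,14729); (219,25350); (34280,8369); (0,1)]);
  Certificate 35099 (10094,16052,23253) 14554 ([:: (0,16804); (14833,34917); (29363,8083);
    (31124,7532); (16695,11813); (4034,11080); (3439,13557); (23268,1892); (23049,9553);
    (4655,7262); (25144,1971); (14267,31046); (22375,935); (9296,11965); (18096,19935);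
    (35096,28688); (0,35098)], [:: (0,8907); (27758,7389); (16887,8000); (11150,2604); (28271,8746);
    (20738,18960); (15361,3740); (29501,17036); (1549,26661); (22375,34164); (9296,23134);
    (18096,15164); (35096,6411); (0,1)], [:: (0,32324); (13695,28276); (17109,15181); (7826,6479);
    (34724,18111); (8143,24156); (13217,11703); (5881,14621); (23239,20965); (16145,4618);
    (17282,14334); (17069,1696); (35096,28688); (0,35098)]);
  Certificate 37619 (5062,29320,15216) 2238 ([:: (0,11449); (3508,538); (32063,8615); (23796,8453);
    (19092,2783); (27467,10493); (8398,32200); (30700,27977); (14513,17511); (15258,22682);
    (8461,35636); (16554,6436); (37616,4119); (0,1)], [:: (0,25034); (16051,23748); (28117,21681);
    (27473,33704); (12125,12271); (6832,15890); (16554,31183); (37616,33500); (0,37618)], [::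
    (0,17143); (13320,8792); (13527,11508); (22392,4602); (15236,5731); (19802,26294);
    (11257,14750); (10259,6426); (31554,32461); (23397,15500); (14513,20108); (15258,14937);
    (8461,1983); (16554,31183); (37616,33500); (0,37618)]);
  Certificate 50291 (6998,41634,7014) 14008 ([:: (0,31671); (2202,37147); (34250,8467); (2092,9169);
    (34663,12434); (28785,6356); (2840,21537); (46386,14140); (29393,27412); (14111,4820);
    (27119,48456); (37866,24775); (36665,32262); (3412,21935); (19879,2475); (50288,46162); (0,1)],
    [:: (0,15052); (32867,33827); (12873,5329); (17597,41078); (41404,43024); (18538,41813);
    (18123,22565); (14925,8517); (16858,7567); (36725,20804); (10273,13671); (41074,18526);
    (19879,47816); (50288,4129); (0,50290)], [:: (0,31237); (14266,18453); (16408,41329);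
    (779,20990); (47780,42623); (20863,7710); (49494,47935); (12683,3546); (38805,22476);
    (21700,20585); (2707,47023); (3412,21935); (19879,2475); (50288,46162); (0,1)]);
  Certificate 53411 (10069,50353,50337) 13135 ([:: (0,767); (30716,40558); (5877,23247);
    (48951,16832); (30696,49354); (38790,19034); (9879,1624); (30774,5388); (43592,40060);
    (29496,23883); (53408,32139); (0,53410)], [:: (0,766); (30716,12853); (5877,30164);
    (48951,36579); (30696,4057); (38790,34377); (9879,51787); (30774,48023); (43592,13351);
    (29496,29528); (53408,21272); (0,1)], [:: (0,3838); (20398,10080); (26251,18347); (2069,29314);
    (16114,39604); (49434,37815); (45404,13938); (31562,17728); (38079,11483); (47716,36228);
    (37959,25394); (37934,18511); (16375,49017); (29496,29528); (53408,21272); (0,1)]);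
  Certificate 53639 (20424,48489,48473) 25582 ([:: (0,1290); (49104,47032); (10759,46642);
    (21801,9960); (4557,5947); (42028,51396); (50895,24756); (47517,22427); (16328,8193);
    (14191,12423); (7421,4699); (33589,21322); (20014,15857); (15366,46159); (41504,0); (0,1)], [::
    (0,1289); (49104,6607); (10759,6997); (21801,43679); (4557,47692); (42028,2243); (50895,28883);
    (47517,31212); (16328,45446); (14191,41216); (7421,48940); (33589,32317); (20014,37782);
    (15366,7480); (41504,0); (0,1)], [:: (0,6453); (29048,8992); (1343,26647); (50895,28883);
    (47517,31212); (16328,45446); (14191,41216); (7421,48940); (33589,32317); (20014,37782);
    (15366,7480); (41504,0); (0,1)]);
  Certificate 54959 (12333,45633,52506) 51182 ([:: (15897,0); (17645,0); (0,41064); (48119,44340);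
    (6101,8261); (41031,0); (45762,0); (44689,0); (16820,0); (9547,0); (50858,0); (52828,0);
    (52844,0); (50950,0); (0,1)], [:: (22793,0); (24947,0); (0,52751); (41248,20447); (16580,13045);
    (6101,46698); (41031,0); (45762,0); (44689,0); (16820,0); (9547,0); (50858,0); (52828,0);
    (52844,0); (50950,0); (0,1)], [:: (7809,0); (0,14581); (41111,45430); (19637,38580);
    (23690,20694); (52071,34666); (23976,6452); (35642,37238); (2931,33984); (30152,54287);
    (46088,11789); (20533,49855); (48105,47438); (4003,0); (0,54958)]);
  Certificate 56519 (16250,23318,25848) 27936 ([:: (28403,0); (0,33069); (53778,15470);
    (45179,14431); (52285,27782); (14553,31543); (12231,29201); (4604,1319); (38509,38663);
    (48166,9855); (35944,11300); (25957,49409); (46890,7064); (12337,47935); (49004,45128);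
    (55887,0); (0,1)], [:: (39670,0); (0,55069); (32721,46103); (18366,24595); (51622,10083);
    (30111,6535); (41326,22665); (35243,10606); (10147,45206); (31143,28872); (2633,53099);
    (19998,41939); (46968,0); (2972,0); (626,0); (0,56518)], [:: (55785,0); (33938,0); (0,43835);
    (42273,21588); (16449,25719); (37826,33018); (14751,46155); (26419,9760); (32361,37817);
    (42879,31010); (19998,41939); (46968,0); (2972,0); (626,0); (0,56518)]);
  Certificate 59051 (7666,38338,38322) 30664 ([:: (0,9582); (54977,20936); (37808,53222);
    (20497,8184); (1934,50108); (58322,31772); (25972,17642); (19885,31410); (31940,2291);
    (20762,14582); (48949,24514); (2159,46773); (51705,14244); (55375,49834); (29026,22142);
    (59048,58565); (0,59050)], [:: (0,47907); (17627,27871); (44598,25770); (39568,19404);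
    (22469,8011); (32837,19682); (48100,17506); (31940,56760); (20762,44469); (48949,34537);
    (2159,12278); (51705,44807); (55375,9217); (29026,36909); (59048,486); (0,1)], [:: (0,9583);
    (54977,38115); (37808,5829); (20497,50867); (1934,8943); (58322,27279); (25972,41409);
    (19885,27641); (31940,56760); (20762,44469); (48949,34537); (2159,12278); (51705,44807);
    (55375,9217); (29026,36909); (59048,486); (0,1)]);
  Certificate 61007 (36170,46040,53669) 17033 ([:: (59261,0); (0,2086); (55859,11311);
    (33660,28671); (13080,15340); (22191,17857); (12323,9316); (40729,40658); (15528,33777);
    (56097,17936); (46946,44639); (40899,14542); (36837,34825); (33945,14999); (5039,0); (46880,0);
    (491,0); (0,1)], [:: (7702,0); (0,57060); (39948,31892); (21345,47206); (40069,33335);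
    (27126,49492); (874,34242); (22669,16445); (55112,33188); (60510,0); (0,61006)], [:: (55390,0);
    (60621,0); (49291,0); (18589,0); (56189,0); (0,24545); (39948,29115); (21345,13801);
    (40069,27672); (27126,11515); (874,26765); (22669,44562); (55112,27819); (60510,0); (0,61006)]);
  Certificate 61559 (15152,22850,42891) 57251 ([:: (22398,0); (16651,0); (52660,0); (0,39189);
    (51958,31929); (46481,13676); (6888,26954); (34401,47955); (58299,13827); (40649,7029);
    (52469,7253); (5136,45260); (15812,0); (0,1)], [:: (8185,0); (35823,0); (16890,0); (0,47250);
    (35110,41988); (28438,59061); (33834,5531); (51207,53528); (34713,16582); (41913,60793);
    (54370,32331); (57423,60650); (12800,47257); (5136,45260); (15812,0); (0,1)], [:: (22781,0);
    (0,52288); (51958,31929); (46481,13676); (6888,26954); (34401,47955); (58299,13827);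
    (40649,7029); (52469,7253); (5136,45260); (15812,0); (0,1)]);
  Certificate 67043 (1533,43438,54903) 37263 ([:: (0,56108); (38178,30888); (23533,12065);
    (39357,64321); (17692,56615); (32021,49096); (26789,34947); (19913,47427); (6105,12363);
    (12705,54963); (60686,47181); (56740,4749); (32898,61534); (9325,62545); (29563,26561);
    (67040,18891); (0,67042)], [:: (0,55779); (62874,55489); (64606,8087); (45488,38246);
    (32084,15885); (41154,29977); (57117,7902); (12584,64273); (24842,21772); (46784,43579);
    (41573,1525); (53932,57906); (61119,65211); (11905,9926); (5765,60010); (29563,26561);
    (67040,18891); (0,67042)], [:: (0,64492); (25478,5177); (18977,57412); (25936,38933);
    (53100,15953); (39583,33874); (53049,32424); (31648,6723); (6960,1712); (12168,51479);
    (51437,56532); (5765,60010); (29563,26561); (67040,18891); (0,67042)]);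
  Certificate 69371 (7898,39498,39482) 31592 ([:: (0,9872); (24916,32251); (704,66967);
    (58467,9079); (10075,63323); (8020,32861); (11441,355); (41855,41133); (58254,39444);
    (67172,38611); (11979,20734); (61359,28986); (1618,18146); (46943,5212); (59951,6075);
    (69368,49968); (0,69370)], [:: (0,49357); (59013,45632); (54764,59224); (23501,43711);
    (8283,47851); (11507,3903); (3301,54586); (67054,32894); (15258,4047); (60986,60603);
    (48534,52704); (26354,39688); (1618,18146); (46943,5212); (59951,6075); (69368,49968);
    (0,69370)], [:: (0,9873); (44455,32251); (17920,19929); (68810,35697); (17680,35870);
    (4647,56099); (66209,48049); (62633,54244); (63652,5936); (19773,12333); (31136,38477);
    (8386,34168); (32378,9376); (37093,3337); (9486,55521); (69368,19403); (0,1)]);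
  Certificate 71339 (3885,11995,56585) 28895 ([:: (0,50330); (61721,1133); (27192,7064);
    (58114,66312); (68775,60140); (41009,1149); (54744,11590); (25639,52969); (64821,42121);
    (12268,25026); (61220,70391); (39035,20375); (18518,29671); (56648,42035); (6160,17795);
    (71336,14161); (0,71338)], [:: (0,8456); (33983,6662); (8570,41486); (65801,51027); (6163,673);
    (63981,7750); (60391,49733); (70349,54592); (67684,13722); (29178,56236); (34989,60954);
    (8171,3661); (65245,36713); (71336,14161); (0,71338)], [:: (0,47638); (23634,31897);
    (62181,70200); (17535,20581); (45570,53753); (3931,52540); (7521,30679); (33592,19900);
    (6934,2943); (38844,412); (68936,27130); (12019,36388); (65245,34626); (71336,57178); (0,1)]);
  Certificate 71843 (7392,15086,59991) 6720 ([:: (0,39130); (18138,11105); (4009,30696);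
    (4855,44009); (57285,21640); (63466,1041); (16641,17717); (64422,19120); (35341,7329);
    (35741,2749); (5431,14604); (53196,54732); (17785,3302); (52468,11058); (71840,53006); (0,1)],
    [:: (0,12106); (7765,763); (2397,26094); (32789,58734); (34654,14857); (71529,58705);
    (25172,16445); (43458,24580); (25198,13499); (5283,1176); (22894,35231); (3200,51523);
    (56416,60072); (52468,11058); (71840,53006); (0,1)], [:: (0,45431); (11390,62786); (56339,6245);
    (17700,13037); (26463,44702); (56214,70228); (66986,55715); (47002,17398); (32287,34259);
    (32058,3953); (46121,52763); (33350,49938); (63734,60759); (28374,6158); (19441,39755);
    (71840,53006); (0,1)]);
  Certificate 74771 (41828,59606,59590) 57001 ([:: (0,59872); (19914,5198); (43622,24922);
    (19304,38084); (55443,11252); (63705,66730); (66589,28402); (10015,48498); (72306,45984);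
    (6827,44804); (25361,39930); (10032,25257); (29098,39974); (37842,43898); (74768,6847);
    (0,74770)], [:: (0,59871); (19914,69573); (43622,49849); (19304,36687); (55443,63519);
    (63705,8041); (66589,46369); (10015,26273); (72306,28787); (6827,29967); (25361,34841);
    (10032,49514); (29098,34797); (37842,30873); (74768,67924); (0,1)], [:: (0,279); (68822,42959);
    (57106,47191); (33524,52488); (19304,36687); (55443,63519); (63705,8041); (66589,46369);
    (10015,26273); (72306,28787); (6827,29967); (25361,34841); (10032,49514); (29098,34797);
    (37842,30873); (74768,67924); (0,1)]);
  Certificate 74891 (19013,63717,19029) 36853 ([:: (0,26370); (9552,11413); (61765,33789);
    (14468,429); (40438,33523); (44182,69428); (46220,4426); (51664,45156); (28073,70478);
    (58728,53636); (37712,57933); (19452,8919); (40458,43574); (63205,26265); (53578,18323);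
    (58710,57048); (74888,43762); (0,1)], [:: (0,36077); (68461,30355); (42064,61423);
    (46664,46845); (18392,8011); (69596,42636); (68431,9099); (40560,43617); (9897,60081);
    (38419,10287); (58870,56025); (53802,3806); (22283,74198); (53578,18323); (58710,57048);
    (74888,43762); (0,1)], [:: (0,52669); (15447,44788); (51263,4438); (31688,73669); (34578,44001);
    (71265,71590); (9137,67888); (2468,71267); (56209,43198); (16247,19657); (74888,43762); (0,1)]);
  Certificate 75239 (26210,50387,26226) 22807 ([:: (74953,0); (28181,0); (0,39702); (9523,69933);
    (41814,41156); (38130,15508); (48630,25491); (62892,39738); (20409,42007); (39641,62251);
    (66201,32296); (20710,49721); (17048,74921); (3620,55285); (50770,45066); (36156,64682);
    (21817,0); (0,1)], [:: (56790,0); (53750,0); (72154,0); (51999,0); (15438,0); (68748,0);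
    (19035,0); (51330,0); (8727,0); (42729,0); (53416,0); (0,75238)], [:: (68708,0); (8457,0);
    (0,51262); (44206,486); (44689,54430); (19912,10689); (24164,33959); (49876,31815);
    (31474,15767); (31839,15149); (36421,52764); (20613,39770); (27881,13530); (1462,73174);
    (35733,46385); (35569,0); (53416,0); (0,75238)]);
  Certificate 81119 (10871,67071,10887) 21754 ([:: (51224,0); (69908,0); (32824,0); (21293,0);
    (7962,0); (0,61816); (8416,16387); (79033,80915); (3354,50329); (68783,51050); (72347,9081);
    (22616,42537); (26869,15036); (25796,54971); (45314,68081); (26666,1676); (6247,68539);
    (68114,0); (0,81118)], [:: (9539,0); (60277,0); (52788,0); (0,45585); (52710,64499); (721,982);
    (79427,25845); (25796,54971); (45314,68081); (26666,1676); (6247,68539); (68114,0); (0,81118)],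
    [:: (71275,0); (67808,0); (24383,0); (51223,0); (12127,0); (55655,0); (12069,0); (11154,0);
    (0,73163); (25840,75565); (29526,26815); (12387,9583); (61077,23387); (56467,7779);
    (76521,48636); (72986,0); (12999,0); (0,1)]);
  Certificate 81359 (59266,76942,59282) 44174 ([:: (78789,0); (21774,0); (7237,0); (21528,0);
    (53360,0); (23708,0); (0,23950); (80710,16774); (12286,51908); (28852,65331); (9368,61715);
    (19321,29754); (39258,76420); (23129,77738); (27079,56792); (62036,0); (50752,0); (0,1)], [::
    (29024,0); (67021,0); (0,60261); (47967,70359); (50971,74557); (51206,20035); (27492,58173);
    (62931,12444); (34852,25051); (59422,77369); (23129,3621); (27079,24567); (62036,0); (50752,0);
    (0,1)], [:: (75111,0); (0,36917); (51138,55910); (24486,3413); (13405,67200); (20322,6462);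
    (18072,22465); (55321,62053); (46631,34810); (7762,35911); (51883,38220); (74452,54924);
    (41845,79341); (30601,0); (0,81358)]);
  Certificate 89783 (54176,65402,80929) 40674 ([:: (3778,0); (40714,0); (61330,0); (0,70455);
    (68634,10964); (13290,42857); (19817,68125); (60680,89680); (31959,38801); (55587,43022);
    (5499,68758); (21957,85121); (26360,40990); (32075,0); (43368,0); (0,89782)], [:: (13273,0);
    (57996,0); (9571,0); (0,750); (32936,84808); (32773,81677); (59929,26207); (65437,57730);
    (55587,43022); (5499,68758); (21957,85121); (26360,40990); (32075,0); (43368,0); (0,89782)], [::
    (42619,0); (73270,0); (0,53687); (9918,44590); (54509,65219); (76401,65738); (55984,63418);
    (50302,32246); (88496,62569); (11680,87433); (30505,4752); (18188,68516); (5278,28035);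
    (39958,71353); (26360,40990); (32075,0); (43368,0); (0,89782)]);
  Certificate 95027 (11045,70440,23348) 39573 ([:: (0,75396); (92883,69262); (62863,12008);
    (47740,45575); (76369,1887); (18212,47675); (88005,83181); (48321,75463); (75893,6119);
    (18038,57773); (90857,38591); (37764,8861); (16387,25526); (49799,51150); (95024,62504); (0,1)],
    [:: (0,66832); (88610,5386); (84437,55243); (55476,6051); (86657,5446); (13198,23622);
    (2398,45220); (64351,55866); (70715,50918); (34832,92475); (6628,10533); (67819,42517);
    (73044,52169); (19564,64019); (93997,26298); (45294,23541); (95024,62504); (0,1)], [::
    (0,70761); (80260,55176); (9404,67178); (49531,81149); (35045,31933); (26838,82609);
    (63901,90925); (89481,87372); (80336,82368); (17674,86106); (29819,67239); (84017,35236);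
    (1243,56512); (92875,90776); (49799,43877); (95024,32523); (0,95026)])
]%num.

(** A certificate for a also serves for -a. *)
Definition certified (pa : N * N) : bool :=
  has (fun c => let: (r1, r2, r3) := cert_roots c in
    let a := (r1 + r2 + r3)%num in
    (cert_prime c == pa.1) && (congr_p pa.1 pa.2 a || congr_p pa.1 (pa.2 + a) 0))
  certificates.

Lemma certificates_valid : all check_certificate certificates.
Proof. by vm_compute. Qed.

Lemma tables_certified : all certified (table1 ++ table2 ++ table3 ++ table4).
Proof. by vm_compute. Qed.

Lemma all_hasP (T : Type) (P Q : pred T) (s : seq T) :
  all P s -> has Q s -> exists x, P x /\ Q x.
Proof.
elim: s => //= x s IH /andP[Px /IH{}IH] /orP[Qx|/IH//].
by exists x.
Qed.

Lemma table_certificate p a : (p, a) \in table1 ++ table2 ++ table3 ++ table4 ->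
  exists r1 r2 r3 e ws, check_certificate (Certificate p (r1, r2, r3) e ws)
    /\ (congr_p p a (r1 + r2 + r3) || congr_p p (a + (r1 + r2 + r3)) 0).
Proof.
move=> pa_in; have pa_ok : certified (p, a) := allP tables_certified _ pa_in.
have [[q [[r1 r2] r3] e ws] [cP /= /andP[/eqP qE aE]]] := all_hasP certificates_valid pa_ok.
by rewrite qE in cP; exists r1, r2, r3, e, ws.
Qed.

Section MaximalCurve.

Variables p a : N.
Hypothesis pr_p : prime p.
Hypothesis pa_in : (p, a) \in table1 ++ table2 ++ table3 ++ table4.

Lemma table_mod4 : (p %% 4 = 3)%N.
Proof.
have [r1 [r2 [r3 [e [ws [cP _]]]]]] := table_certificate pa_in.
move: cP; rewrite /check_certificate; case: ws => [[w0 w1] w2] /andP[/eqP p_mod4 _].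
by rewrite [in LHS](N.div_mod' p 4) p_mod4 nat_of_binD nat_of_binM mulnC modnMDl.
Qed.

Lemma table_sum_chi (F : finFieldType) (j : {rmorphism 'F_p -> F}) : #|F| = (p ^ 2)%N ->
  \sum_x chi (curve_poly (j a%:R)).[x] = 10%:R * (nat_of_bin p)%:Z - 1.
Proof.
move=> cardF; have [r1 [r2 [r3 [e [ws [cP aE]]]]]] := table_certificate pa_in.
have [i iE] := sqrt_opp1 pr_p table_mod4 cardF.
rewrite -(check_certificateP j pr_p table_mod4 cardF iE cP) rmorph_nat.
case/orP: aE => /(residue_congr j pr_p); rewrite -[a%:R]/(residue F a).
  by move=> ->.
rewrite residueD => /eqP; rewrite addr_eq0 => /eqP ->.
by rewrite (sum_chi_curveN iE).
Qed.

Lemma table_discriminant : (a%:R : 'F_p) ^+ 2 + 108%:R != 0.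
Proof.
have [r1 [r2 [r3 [e [ws [cP aE]]]]]] := table_certificate pa_in.
have -> : (a%:R : 'F_p) ^+ 2 = (residue 'F_p (r1 + r2 + r3)) ^+ 2.
  case/orP: aE => /(residue_congr idfun pr_p); rewrite -[a%:R]/(residue 'F_p a).
    by move=> ->.
  by rewrite residueD => /eqP; rewrite addr_eq0 => /eqP ->; rewrite sqrrN.
move: cP; rewrite /check_certificate; case: ws => [[w0 w1] w2] /and4P[_ _ nzd _].
by move: nzd; rewrite -(residue_eq0 idfun pr_p) residueD residueM expr2.
Qed.

End MaximalCurve.

Theorem theorem3p15 (p a : N) (hp : prime p)
    (hpa : (p, a) \in table1 ++ table2 ++ table3 ++ table4) :
  Fp2_maximal (C_ (a%:R : 'F_p)).
Proof.
have p3 := table_mod4 hpa.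
have nz2 : (2%:R : 'F_p) != 0.
  have p_gt2 : (2 < p)%N.
    by move: p3 (prime_gt1 hp); case: (nat_of_bin p) => [|[|[|]]].
  by rewrite -(dvdn_pcharf (pchar_Fp hp)) gtnNdvd.
have nzd := table_discriminant hp hpa.
have bezout (L : fieldType) (j : {rmorphism 'F_p -> L}) : exists A B,
    A * curve_poly (j a%:R) + B * (curve_poly (j a%:R))^`() = 1.
  apply: curve_poly_bezout; first by rewrite -(rmorph_nat j) fmorph_eq0.
  by rewrite -(rmorph_nat j) -rmorphXn -rmorphD fmorph_eq0.
split=> [L j|F j cardF K iota x y].
  have [A [B AB]] := bezout L j.
  rewrite map_C_ C_double_cover; apply: double_cover_irreducible AB.
  by rewrite size_curve_poly.
rewrite map_C_ C_double_cover => /function_field_hyperelliptic model.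
have [A [B AB]] := bezout F j.
have nz2F : (2%:R : F) != 0 by rewrite -(rmorph_nat j) fmorph_eq0.
have size_f : (size (curve_poly (j a%:R)) <= 13)%N by rewrite size_curve_poly.
have rec_f := reciprocal_curve_poly (j a%:R).
exists 5; split; first exact: (@hyperelliptic_genus _ _ _ 5 _ nz2F _ _ AB size_f rec_f _ _ model).
have card_pts := @card_rational_places _ _ _ 5 _ nz2F _ _ AB size_f rec_f _ _ model.
suff -> : (p ^ 2 + 1 + 2 * 5 * p)%N = (#|[pred ab : F * F | ab.2 ^+ 2 == (curve_poly (j a%:R)).[ab.1]]|
     + #|[pred b : F | b ^+ 2 == (curve_poly (j a%:R)).[0]]|)%N by [].
have affE : #|[pred ab : F * F | ab.2 ^+ 2 == (curve_poly (j a%:R)).[ab.1]]|%:Z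
    = (p ^ 2)%N%:Z + (10%:R * (nat_of_bin p)%:Z - 1).
  rewrite -(table_sum_chi hp hpa j cardF) -cardF -[in RHS]natz -sumr_const -big_split /=.
  transitivity (\sum_(ab : F * F) (ab.2 ^+ 2 == (curve_poly (j a%:R)).[ab.1])%:R : int).
    rewrite -natz -sum1_card natr_sum big_mkcond /=.
    by apply: eq_bigr => ab _; rewrite inE; case: eqP.
  rewrite -(pair_bigA _ (fun u z => (z ^+ 2 == (curve_poly (j a%:R)).[u])%:R : int)) /=.
  by apply: eq_bigr => u _; rewrite chiE.
have infE : #|[pred b : F | b ^+ 2 == (curve_poly (j a%:R)).[0]]|%:Z = 2%:R.
  rewrite horner_coef0 coef_Poly /= -[LHS](subrK 1) -/(chi 1).
  by rewrite -(expr1n F 2) chi_sqr ?oner_neq0.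
by apply/eqP; rewrite -eqz_nat [X in _ == X]PoszD affE infE; apply/eqP; lia.
Qed.
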